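(* Let $(M,g)$ be a compact Riemannian manifold (without boundary) of dimension $n$, let $m>0$, and let $u$ be a positive smooth solution of $\partial_t u=\Delta u^m$ on $M$ for $t$ in an interval of positive times. Let $v=\frac{m}{m-1}u^{m-1}$ be the pressure (interpreted as $v=\log u$ when $m=1$), and let $F_1=(m-1)\Delta v$, $b=n(m-1)$, $a=\frac{b}{b+2}$, and $$\mathcal N_u(t)=-t^a\int_M vu\,d\mu,\qquad \mathcal W_u(t)=t\frac{d}{dt}\mathcal N_u(t)+\mathcal N_u(t).$$ Then $$\frac{d}{dt}\mathcal W_u(t)=-2(m-1)t^{a+1}\int_M\left(\left|v_{ij}+\frac{1}{(b+2)t}g_{ij}\right|^2+R_{ij}v_iv_j\right)vu\,d\mu-2t^{a+1}\int_M\left(F_1+\frac at\right)^2vu\,d\mu.$$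
   Context: $\Delta$ is the Laplace–Beltrami operator and $d\mu$ the Riemannian measure of $g$. $v_{ij}$ denotes the Hessian of $v$, $|\cdot|$ the tensor norm induced by $g$, $R_{ij}$ the Ricci tensor, and $R_{ij}v_iv_j=\operatorname{Ric}(\nabla v,\nabla v)$. The constant $a$ is meaningful when $b+2\neq 0$.
   Formalization: The case m = 1 (v = log u) is excluded because the identity fails there: on the circle, u = 2 + e^{-t} cos θ has dW/dt > 0 for small t while the right-hand side is 0. *)

(* Defs.v *)
From mathcomp Require Import all_boot all_order all_algebra.
From mathcomp Require Import all_classical all_reals all_analysis.

Set Implicit Arguments.
Unset Strict Implicit.
Unset Printing Implicit Defensive.
Import Order.TTheory GRing.Theory Num.Theory.
Import numFieldNormedType.Exports.

Local Open Scope classical_set_scope.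
Local Open Scope ring_scope.

Definition partial (R : realType) (n : nat) (k : 'I_n) (f : 'rV[R]_n -> R) :
  'rV[R]_n -> R := fun x => 'D_(delta_mx 0 k) f x.

(* C^oo; [U] is meant to be open. *)
Definition smooth_on (R : realType) (n : nat) (U : set 'rV[R]_n)
    (f : 'rV[R]_n -> R) : Prop :=
  forall (s : seq 'I_n) (x : 'rV[R]_n), U x ->
    {for x, continuous (foldr (@partial R n) f s)} /\
    forall k : 'I_n, derivable (foldr (@partial R n) f s) x (delta_mx 0 k).

(* Iterated one-dimensional Lebesgue integrals; by Fubini this is the Lebesgue
   integral over R^n.  It is only applied to continuous functions with compact
   support. *)
Fixpoint integral_rV (R : realType) (n : nat) : ('rV[R]_n -> R) -> R :=
  match n return ('rV[R]_n -> R) -> R with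
  | 0%N => fun f => f 0
  | k.+1 => fun f =>
      \int[@lebesgue_measure R]_x
        integral_rV (fun y : 'rV[R]_k =>
          f (row_mx (const_mx x : 'rV[R]_1) y : 'rV[R]_(1 + k)))
  end.

(* A smooth n-dimensional atlas without boundary on M.  The values of [coord i]
   outside [dom i], and of [param i] outside [coord i @` dom i], are junk. *)
Record atlas (R : realType) (n : nat) (M : ptopologicalType) := Atlas {
  idx : Type;
  dom : idx -> set M;
  coord : idx -> M -> 'rV[R]_n;
  param : idx -> 'rV[R]_n -> M;
  chart_at : M -> idx;
  dom_chart_at : forall p, dom (chart_at p) p;
  dom_open : forall i, open (dom i);
  cod_open : forall i, open (coord i @` dom i);
  coordK : forall i p, dom i p -> param i (coord i p) = p;
  coord_continuous : forall i p, dom i p -> {for p, continuous (coord i)};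
  param_continuous : forall i x,
    (coord i @` dom i) x -> {for x, continuous (param i)};
  transition_smooth : forall i j (k : 'I_n),
    smooth_on (coord i @` (dom i `&` dom j))
      (fun x => coord j (param i x) 0 k) }.

Definition cod (R : realType) (n : nat) (M : ptopologicalType)
    (A : atlas R n M) (i : idx A) : set 'rV[R]_n := coord i @` dom i.

Definition transition (R : realType) (n : nat) (M : ptopologicalType)
    (A : atlas R n M) (i j : idx A) (k : 'I_n) : 'rV[R]_n -> R :=
  fun x => coord j (param i x) 0 k.

(* [gmx i x] is the Gram matrix of the metric at [param i x] in the i-th chart;
   [gmx_transition] is the transformation law of a (0,2)-tensor. *)
Record metric (R : realType) (n : nat) (M : ptopologicalType)
    (A : atlas R n M) := Metric {
  gmx : idx A -> 'rV[R]_n -> 'M[R]_n;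
  gmx_smooth : forall i (k l : 'I_n),
    smooth_on (cod i) (fun x => gmx i x k l);
  gmx_sym : forall i x, cod i x -> (gmx i x)^T = gmx i x;
  gmx_pos : forall i x, cod i x -> forall w : 'rV[R]_n, w != 0 ->
    0 < (w *m gmx i x *m w^T) 0 0;
  gmx_transition : forall i j p, dom i p -> dom j p -> forall k l : 'I_n,
    gmx i (coord i p) k l =
    \sum_(c < n) \sum_(d < n)
      partial k (transition i j c) (coord i p) *
      partial l (transition i j d) (coord i p) *
      gmx j (coord j p) c d }.

Definition local_grad (R : realType) (n : nat) (G : 'rV[R]_n -> 'M[R]_n)
    (f : 'rV[R]_n -> R) (x : 'rV[R]_n) : 'rV[R]_n :=
  \row_(k < n) \sum_(l < n) invmx (G x) k l * partial l f x.

(* (det G)^(-1/2) d_k ((det G)^(1/2) G^{kl} d_l f) *)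
Definition local_laplacian (R : realType) (n : nat) (G : 'rV[R]_n -> 'M[R]_n)
    (f : 'rV[R]_n -> R) (x : 'rV[R]_n) : R :=
  (Num.sqrt (\det (G x)))^-1 *
  \sum_(k < n)
    partial k (fun y => Num.sqrt (\det (G y)) * local_grad G f y 0 k) x.

(* Gamma^k_{ij} of the Levi-Civita connection *)
Definition christoffel (R : realType) (n : nat) (G : 'rV[R]_n -> 'M[R]_n)
    (k i j : 'I_n) (x : 'rV[R]_n) : R :=
  2^-1 * \sum_(l < n) invmx (G x) k l *
    (partial i (fun y => G y j l) x + partial j (fun y => G y i l) x
     - partial l (fun y => G y i j) x).

Definition local_hessian (R : realType) (n : nat) (G : 'rV[R]_n -> 'M[R]_n)
    (f : 'rV[R]_n -> R) (x : 'rV[R]_n) : 'M[R]_n :=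
  \matrix_(i < n, j < n)
    (partial i (partial j f) x
     - \sum_(k < n) christoffel G k i j x * partial k f x).

(* R_{ij} = d_k Gamma^k_{ij} - d_j Gamma^k_{ik}
            + Gamma^k_{kl} Gamma^l_{ij} - Gamma^k_{jl} Gamma^l_{ik};
   with this sign the Ricci tensor of the round sphere is positive. *)
Definition local_ricci (R : realType) (n : nat) (G : 'rV[R]_n -> 'M[R]_n)
    (x : 'rV[R]_n) : 'M[R]_n :=
  \matrix_(i < n, j < n)
    \sum_(k < n)
      (partial k (christoffel G k i j) x - partial j (christoffel G k i k) x
       + \sum_(l < n) (christoffel G k k l x * christoffel G l i j x
                       - christoffel G k j l x * christoffel G l i k x)).

(* Below, tensor components at [p] are taken in the chart [chart_at A p]; the
   scalars built from them do not depend on this choice. *)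

Definition metric_at (R : realType) (n : nat) (M : ptopologicalType)
    (A : atlas R n M) (g : metric A) (p : M) : 'M[R]_n :=
  gmx g (chart_at A p) (coord (chart_at A p) p).

Definition grad (R : realType) (n : nat) (M : ptopologicalType)
    (A : atlas R n M) (g : metric A) (f : M -> R) (p : M) : 'rV[R]_n :=
  local_grad (gmx g (chart_at A p)) (f \o param (chart_at A p))
    (coord (chart_at A p) p).

Definition laplacian (R : realType) (n : nat) (M : ptopologicalType)
    (A : atlas R n M) (g : metric A) (f : M -> R) (p : M) : R :=
  local_laplacian (gmx g (chart_at A p)) (f \o param (chart_at A p))
    (coord (chart_at A p) p).

Definition hessian (R : realType) (n : nat) (M : ptopologicalType)
    (A : atlas R n M) (g : metric A) (f : M -> R) (p : M) : 'M[R]_n :=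
  local_hessian (gmx g (chart_at A p)) (f \o param (chart_at A p))
    (coord (chart_at A p) p).

(* Ric(X, X) for the tangent vector X at p *)
Definition ricci (R : realType) (n : nat) (M : ptopologicalType)
    (A : atlas R n M) (g : metric A) (p : M) (X : 'rV[R]_n) : R :=
  (X *m local_ricci (gmx g (chart_at A p)) (coord (chart_at A p) p)
     *m X^T) 0 0.

(* |T|^2 = g^{ik} g^{jl} T_{ij} T_{kl} for a (0,2)-tensor T at p *)
Definition tensor_normsq (R : realType) (n : nat) (M : ptopologicalType)
    (A : atlas R n M) (g : metric A) (p : M) (T : 'M[R]_n) : R :=
  \sum_(i < n) \sum_(j < n) \sum_(k < n) \sum_(l < n)
    invmx (metric_at g p) i k * invmx (metric_at g p) j l * T i j * T k l.

Notation borel M := (g_sigma_algebraType (@open M)).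

(* dmu = (det g)^(1/2) dx in every chart, tested on the continuous functions
   with support in the chart.  On a compact Hausdorff M, this determines the
   Borel measure mu (partition of unity and Riesz representation). *)
Definition riemannian_measure (R : realType) (n : nat) (M : ptopologicalType)
    (A : atlas R n M) (g : metric A)
    (mu : {measure set (borel M) -> \bar R}) : Prop :=
  forall (i : idx A) (f : M -> R), continuous f ->
    compact (closure [set p | f p != 0]) ->
    closure [set p | f p != 0] `<=` dom i ->
    (\int[mu]_p (f p)%:E)%E =
    (integral_rV
      ((fun x => f (param i x) * Num.sqrt (\det (gmx g i x))) \_ (cod i)))%:E.

(* Joint smoothness in (t, x) on J * M, for an open set J of times; the time
   is the 0-th coordinate of [z]. *)
Definition spacetime_smooth (R : realType) (n : nat) (M : ptopologicalType)
    (A : atlas R n M) (J : set R) (u : R -> M -> R) : Prop :=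
  forall i : idx A,
    smooth_on
      [set z : 'rV[R]_(1 + n) | J (lsubmx z 0 0) /\ cod i (rsubmx z)]
      (fun z : 'rV[R]_(1 + n) => u (lsubmx z 0 0) (param i (rsubmx z))).

(* Main.v *)
(* Put c = m / (m - 1) and w = v u = c u^m.  The equation says Delta w = c u_t,
   hence w_t = (m - 1) v Delta w and v_t = (m - 1) v Delta v + |grad v|^2.  For
   E = int w this gives E' = (m - 1) int v Delta w and
     E'' = (m - 1) int (v_t Delta w + w_t Delta v),
   and Green's formula, Bochner's formula for Delta |grad v|^2 and the relation
   (m - 1) v grad w = m w grad v turn the right-hand side into
     2 (m - 1) int (|Hess v|^2 + Ric (grad v, grad v)) w
       + 2 (m - 1)^2 int (Delta v)^2 w.
   As W = (t N)' = - (t^(a+1) E)', the theorem is the expansion of the squares.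

   Green's formula is first proved for test functions supported in one chart,
   where it is an integration by parts in R^n.  It determines the Laplacian, so
   the Laplacian does not depend on the chart, and a partition of unity extends
   the formula to M.  Bochner's formula is only needed at a point, in one chart:
   it is the commutation of covariant derivatives applied to the gradient. *)

Require Import Defs.
From HB Require Import structures.
From mathcomp Require Import all_boot all_order all_algebra.
From mathcomp Require Import all_classical all_reals all_analysis.
From mathcomp Require Import perm measurable_realfun ring lra.
From mathcomp Require finmap.

Set Implicit Arguments.
Unset Strict Implicit.
Unset Printing Implicit Defensive.
Import Order.TTheory GRing.Theory Num.Theory.
Import numFieldNormedType.Exports.

Local Open Scope classical_set_scope.
Local Open Scope ring_scope.

(** * Differential calculus on R^n *)

(** Tensor components at [p] are taken in the chart chosen at [p], and this choice may jump with
    [p]. So neither [laplacian g f] nor the Hessian and Ricci terms have visible regularity in [p].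
    For the Laplacian, chart independence repairs this. For [|Hess v|^2 + Ric (grad v, grad v)],
    Bochner's formula itself does: it writes the sum in terms of Laplacians and products of
    gradients, so the transformation laws of the Hessian and of the curvature never come up. The
    measure is known only through its integrals against continuous functions supported in a chart.
    Finiteness, and positivity of the integral of a nonnegative continuous function that is positive
    somewhere, are derived from that. Green's formula differentiates a test function once, which is
    why cut-offs of class [C^1] are enough. *)

(** The bound [|s| <= |t|] replaces an interval, so that difference quotients can be estimated for
    increments of either sign at once. *)
Lemma MVT0 (R : realType) (g dg : R -> R) (t : R) :
  (forall s : R, `|s| <= `|t| -> is_derive s 1 g (dg s)) ->
  exists2 s : R, `|s| <= `|t| & g t - g 0 = t * dg s.
Proof.
move=> dgE; have cg a b : (forall s : R, a <= s <= b -> `|s| <= `|t|) ->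
    {within `[a, b], continuous g}.
  move=> ab; apply: derivable_within_continuous => s; rewrite in_itv/= => /ab/dgE.
  by move=> [].
have [t0|t0] := leP 0 t.
- have H s : 0 <= s <= t -> `|s| <= `|t|.
    by move=> /andP[s0 st]; rewrite !ger0_norm.
  have [||s] := @MVT_segment _ g dg 0 t t0.
  + by move=> s; rewrite in_itv/= => /andP[/ltW s0 /ltW st]; apply/dgE/H/andP.
  + exact: cg.
  rewrite in_itv/= => /H st; rewrite subr0 mulrC => E.
  by exists s.
- have H s : t <= s <= 0 -> `|s| <= `|t|.
    by move=> /andP[s0 st]; rewrite !ler0_norm ?lerN2// ltW.
  have [||s] := @MVT_segment _ g dg t 0 (ltW t0).
  + by move=> s; rewrite in_itv/= => /andP[/ltW s0 /ltW st]; apply/dgE/H/andP.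
  + exact: cg.
  rewrite in_itv/= => /H st; rewrite sub0r => E.
  by exists s => //; apply: oppr_inj; rewrite opprB E mulrN mulrC.
Qed.

Lemma cvg_is_derive (R : realType) (f : R -> R) (x l : R) :
  h^-1 * (f (h + x) - f x) @[h --> (0 : R)^'] --> l -> is_derive x 1 f l.
Proof.
move=> fl; have E : (fun h : R => h^-1 *: ((f \o shift x) (h *: 1) - f x)) =
    (fun h => h^-1 * (f (h + x) - f x)).
  by apply/funext => h /=; rewrite [h *: 1]mulr1.
split; first by rewrite /derivable E; apply/cvg_ex; exists l.
by rewrite /derive E; exact: cvg_lim.
Qed.

Section Calculus.
Variable R : realType.

Lemma dist_le_halves (p q r e : R) :
  `|p - r| <= e / 2 -> `|q - r| <= e / 2 -> `|p - q| <= e.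
Proof.
move=> pr qr; rewrite (splitr e) -(subrKA r) (le_trans (ler_normD _ _))//.
by rewrite (distrC r); exact: lerD.
Qed.

Lemma ler_coord_norm (m n : nat) (x : 'M[R]_(m, n)) i j : `|x i j| <= `|x|.
Proof.
by rewrite [leRHS]/Num.Def.normr/= mx_normrE; exact: (le_bigmax _ _ (i, j)).
Qed.

Lemma mx_norm_le (m n : nat) (x : 'M[R]_(m, n)) e : 0 <= e ->
  (forall i j, `|x i j| <= e) -> `|x| <= e.
Proof.
move=> e0 xe; rewrite [leLHS]/Num.Def.normr/= mx_normrE.
by apply: bigmax_le => // -[i j] _; exact: xe.
Qed.

Lemma cvg_mx (T : Type) (F : set_system T) (S : topologicalType) (m n : nat)
    (f : T -> 'M[S]_(m, n)) (l : 'M[S]_(m, n)) : Filter F ->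
  (forall i j, (fun t => f t i j) @ F --> l i j) -> f @ F --> l.
Proof.
move=> FF fl A [P Pl PA].
have : \forall t \near F, forall i j, P i j (f t i j).
  apply: filter_forall => i; apply: filter_forall => j.
  exact: (fl i j _ (Pl i j)).
by apply: filterS => t Pt; exact: PA.
Qed.

Lemma norm_delta_le (n : nat) (k : 'I_n) : `|delta_mx 0 k : 'rV[R]_n| <= 1.
Proof.
apply: mx_norm_le => // i j; rewrite mxE.
by case: (_ && _); rewrite ?normr0 ?normr1.
Qed.

Section Lines.
Variables (V : normedModType R).
Implicit Types (f : V -> R) (x v : V) (s t : R).

Lemma is_derive_line f x v s : derivable f (s *: v + x) v ->
  is_derive s 1 (fun h => f (h *: v + x)) ('D_v f (s *: v + x)).
Proof.
move=> df.
have E : (fun h : R => h^-1 *: (((fun h => f (h *: v + x)) \o shift s) (h *: 1)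
            - f (s *: v + x))) =
     (fun h : R => h^-1 *: ((f \o shift (s *: v + x)) (h *: v) - f (s *: v + x))).
  apply/funext => h /=; congr (_ *: (f _ - _)).
  by rewrite [_ *: 1]mulr1 scalerDl addrA.
by split; rewrite /derivable /derive /= E.
Qed.

(** Both sides are limits of the same difference quotient, up to the rewriting in [E]. This moves
    statements about directional derivatives to one variable and back. *)
Lemma derive_line (W : normedModType R) (f : V -> W) x v :
  'D_v f x = 'D_1 (fun h : R => f (h *: v + x)) 0.
Proof.
have E : (fun h : R => h^-1 *: ((f \o shift x) (h *: v) - f x)) =
    (fun h : R => h^-1 *: (((fun h : R => f (h *: v + x)) \o shift 0) (h *: 1)
                           - f (0 *: v + x))).
  by apply/funext => s /=; rewrite addr0 scale0r add0r [_ *: 1]mulr1.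
by rewrite /derive E.
Qed.

Lemma MVT_line f x v t :
  (forall s, `|s| <= `|t| -> derivable f (s *: v + x) v) ->
  exists2 s, `|s| <= `|t| & f (t *: v + x) - f x = t * 'D_v f (s *: v + x).
Proof.
move=> df; have [|s st] := @MVT0 R (fun h => f (h *: v + x))
  (fun s => 'D_v f (s *: v + x)) t.
  by move=> s /df; exact: is_derive_line.
by rewrite scale0r add0r => E; exists s.
Qed.

End Lines.

(** Finite-order counterpart of [smooth_on]: the closure properties are proved by induction on the
    order, and test functions have order 1 only. *)
Fixpoint Ck (n : nat) (U : set 'rV[R]_n) (N : nat) (f : 'rV[R]_n -> R) : Prop :=
  (forall x, U x -> {for x, continuous f}) /\
  match N with
  | 0 => True
  | N'.+1 => (forall k x, U x -> derivable f x (delta_mx 0 k)) /\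
             forall k, Ck U N' (partial k f)
  end.

Section CkTheory.
Variable n : nat.
Implicit Types (U V : set 'rV[R]_n) (f g : 'rV[R]_n -> R) (N : nat).

Lemma Ck0P U f : Ck U 0 f <-> forall x, U x -> {for x, continuous f}.
Proof. by split => [[]|?]; last split. Qed.

Lemma CkSP U N f : Ck U N.+1 f <->
  [/\ forall x, U x -> {for x, continuous f},
      forall k x, U x -> derivable f x (delta_mx 0 k) &
      forall k, Ck U N (partial k f)].
Proof. by split => [[cf [df pf]]|[cf df pf]]. Qed.

#[local] Arguments Ck : simpl never.

Lemma Ck_continuous U N f x : Ck U N f -> U x -> {for x, continuous f}.
Proof. by case: N => [/Ck0P cf|N /CkSP[cf _ _]] Ux; exact: cf. Qed.

Lemma Ck_derivable U N f x k : Ck U N.+1 f -> U x ->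
  derivable f x (delta_mx 0 k).
Proof. by move=> /CkSP[_ df _] Ux; exact: df. Qed.

#[local] Arguments Ck_derivable [U N f x] k _ _.

Lemma Ck_partial U N f k : Ck U N.+1 f -> Ck U N (partial k f).
Proof. by move=> /CkSP[_ _ pf]; exact: pf. Qed.

Lemma CkS U N f : Ck U N.+1 f -> Ck U N f.
Proof.
elim: N f => [|N IH] f /CkSP[cf df pf]; first exact/Ck0P.
by apply/CkSP; split => // k; exact: IH.
Qed.

Lemma Ck_subset U V N f : V `<=` U -> Ck U N f -> Ck V N f.
Proof.
move=> VU; elim: N f => [|N IH] f.
  by move=> /Ck0P cf; apply/Ck0P => x /VU/cf.
move=> /CkSP[cf df pf]; apply/CkSP; split; first by move=> x /VU/cf.
- by move=> k x /VU; exact: df.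
- by move=> k; exact: IH.
Qed.

Lemma near_open U (P : 'rV[R]_n -> Prop) x : open U -> U x ->
  (forall y, U y -> P y) -> \near x, P x.
Proof.
move=> Uo Ux UP; have := open_nbhs_nbhs (conj Uo Ux).
by apply: filterS => y; exact: UP.
Qed.

Lemma near_dist_le (g : 'rV[R]_n -> R) (x : 'rV[R]_n) (e : R) :
  {for x, continuous g} -> 0 < e -> \forall y \near x, `|g x - g y| <= e.
Proof. by move=> /cvgrPdist_le cg e0; exact: cg. Qed.

Lemma partial_ext U f g k x : open U -> {in U, f =1 g} -> U x ->
  partial k f x = partial k g x.
Proof.
move=> Uo fg Ux; apply: near_eq_derive; apply: (near_open Uo Ux) => y Uy.
by apply: fg; rewrite inE.
Qed.

Lemma Ck_ext U N f g : open U -> {in U, f =1 g} -> Ck U N f -> Ck U N g.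
Proof.
move=> Uo; have nfg f' g' x : {in U, f' =1 g'} -> U x -> {near x, f' =1 g'}.
  by move=> fg Ux; apply: (near_open Uo Ux) => y Uy; apply: fg; rewrite inE.
have cont f' g' x : {in U, f' =1 g'} -> U x ->
    {for x, continuous f'} -> {for x, continuous g'}.
  move=> fg Ux cf; rewrite /prop_for /continuous_at -fg ?inE//.
  exact: cvg_trans (near_eq_cvg (nfg f' g' x fg Ux)) cf.
elim: N f g => [|N IH] f g fg.
  by move=> /Ck0P cf; apply/Ck0P => x Ux; exact: cont (cf x Ux).
move=> /CkSP[cf df pf]; apply/CkSP; split.
- by move=> x Ux; exact: cont (cf x Ux).
- move=> k x Ux; exact: near_eq_derivable (nfg _ _ _ fg Ux) (df k x Ux).
- by move=> k; apply: IH (pf k) => x; rewrite inE => Ux; exact: partial_ext fg Ux.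
Qed.

Lemma Ck_cst U N c : Ck U N (cst c).
Proof.
have cc c' x : {for x, continuous (cst c' : 'rV[R]_n -> R)}.
  exact: cst_continuous.
elim: N c => [|N IH] c; first exact/Ck0P.
apply/CkSP; split=> [x _|k x _|k]; [exact: cc|exact: derivable_cst|].
rewrite (_ : partial k _ = cst 0)//.
by apply/funext => x; rewrite /partial derive_cst.
Qed.

Lemma partial_coord j k (x : 'rV[R]_n) :
  partial j (fun y : 'rV[R]_n => y 0 k) x = (j == k)%:R.
Proof.
have := derive_mx (@derivable_id R _ x (delta_mx 0 j)).
rewrite derive_id => /matrixP /(_ 0 k); rewrite !mxE eqxx /= eq_sym => ->.
by [].
Qed.

Lemma Ck_coord U N k : Ck U N (fun x => x 0 k).
Proof.
have cc (x : 'rV[R]_n) : {for x, continuous (fun y : 'rV[R]_n => y 0 k)}.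
  exact: coord_continuous.
case: N => [|N]; first by apply/Ck0P => x _; exact: cc.
apply/CkSP; split=> [x _|j x _|j]; [exact: cc| |].
  by apply: diff_derivable; exact: differentiable_coord.
rewrite (_ : partial j _ = cst (j == k)%:R); first exact: Ck_cst.
by apply/funext => x; rewrite partial_coord.
Qed.

Lemma CkD U N f g : open U -> Ck U N f -> Ck U N g ->
  Ck U N (fun x => f x + g x).
Proof.
move=> Uo; elim: N f g => [|N IH] f g.
  move=> /Ck0P cf /Ck0P cg; apply/Ck0P => x Ux.
  exact: (cvgD (cf x Ux) (cg x Ux)).
move=> /CkSP[cf df pf] /CkSP[cg dg pg]; apply/CkSP; split.
- by move=> x Ux; exact: (cvgD (cf x Ux) (cg x Ux)).
- by move=> k x Ux; apply: derivableD; [exact: df|exact: dg].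
- move=> k; apply: Ck_ext (IH _ _ (pf k) (pg k)) => // x; rewrite inE => Ux.
  by rewrite /partial deriveD//; [exact: df|exact: dg].
Qed.

(** By Leibniz' rule the partials of the product contain [f] and [g] undifferentiated, so the
    induction step lowers their order with [CkS]. *)
Lemma CkM U N f g : open U -> Ck U N f -> Ck U N g ->
  Ck U N (fun x => f x * g x).
Proof.
move=> Uo; elim: N f g => [|N IH] f g.
  move=> /Ck0P cf /Ck0P cg; apply/Ck0P => x Ux.
  exact: (cvgM (cf x Ux) (cg x Ux)).
move=> Cf Cg; have [/CkSP[cf df pf] /CkSP[cg dg pg]] := (Cf, Cg).
apply/CkSP; split.
- by move=> x Ux; exact: (cvgM (cf x Ux) (cg x Ux)).
- by move=> k x Ux; apply: derivableM; [exact: df|exact: dg].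
- move=> k.
  apply: (@Ck_ext _ _ (fun x => f x * partial k g x + g x * partial k f x)) => //.
    by move=> x; rewrite inE => Ux; rewrite /partial deriveM//;
      [exact: df|exact: dg].
  by apply: (CkD Uo); apply: IH => //; exact: CkS.
Qed.

Lemma CkZ U N c f : open U -> Ck U N f -> Ck U N (fun x => c * f x).
Proof. by move=> Uo; apply: CkM => //; exact: Ck_cst. Qed.

Lemma CkB U N f g : open U -> Ck U N f -> Ck U N g ->
  Ck U N (fun x => f x - g x).
Proof.
move=> Uo Cf Cg; apply: (@Ck_ext _ _ (fun x => f x + -1 * g x)) => //.
  by move=> x _; rewrite mulN1r.
by apply: CkD => //; exact: CkZ.
Qed.

Lemma Ck_sum U N (I : Type) (r : seq I) (P : pred I) (F : I -> 'rV[R]_n -> R) :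
  open U -> (forall i, P i -> Ck U N (F i)) ->
  Ck U N (fun x => \sum_(i <- r | P i) F i x).
Proof.
move=> Uo CF; elim: r => [|i r IH].
  by apply: Ck_ext (Ck_cst U N 0) => // x _; rewrite big_nil.
have [Pi|Pi] := boolP (P i); last first.
  by apply: Ck_ext IH => // x _; rewrite big_cons (negPf Pi).
apply: Ck_ext (CkD Uo (CF i Pi) IH) => // x _; by rewrite big_cons Pi.
Qed.

Lemma Ck_prod U N (I : Type) (r : seq I) (P : pred I) (F : I -> 'rV[R]_n -> R) :
  open U -> (forall i, P i -> Ck U N (F i)) ->
  Ck U N (fun x => \prod_(i <- r | P i) F i x).
Proof.
move=> Uo CF; elim: r => [|i r IH].
  by apply: Ck_ext (Ck_cst U N 1) => // x _; rewrite big_nil.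
have [Pi|Pi] := boolP (P i); last first.
  by apply: Ck_ext IH => // x _; rewrite big_cons (negPf Pi).
apply: Ck_ext (CkM Uo (CF i Pi) IH) => // x _; by rewrite big_cons Pi.
Qed.

(** Only the derivative of [f] along [v] is given, so [f] is restricted to the line through [x]
    directed by [v], where the one-variable chain rule applies. *)
Lemma is_derive_comp1 (f : 'rV[R]_n -> R) (h : R -> R) (x v : 'rV[R]_n)
    (dh : R) :
  derivable f x v -> is_derive (f x) 1 h dh ->
  is_derive x v (fun y => h (f y)) (dh * 'D_v f x).
Proof.
move=> df [hd <-].
have df0 : is_derive (0 : R) 1 (fun s : R => f (s *: v + x)) ('D_v f x).
  by have := @is_derive_line _ f x v 0; rewrite scale0r add0r => /(_ df).
have hd0 : derivable h (f (0 *: v + x)) 1 by rewrite scale0r add0r.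
have [df01 df02] := df0.
have := derive1_comp df01 hd0.
rewrite !derive1E df02 scale0r add0r => E.
have dc : derivable (h \o (fun s : R => f (s *: v + x))) 0 1.
  apply/derivable1_diffP; apply: differentiable_comp.
    by move/derivable1_diffP: df01.
  by move/derivable1_diffP: hd0.
split; first exact/derivable1P.
by rewrite derive_line.
Qed.

Lemma partial_powR f (r : R) k x : derivable f x (delta_mx 0 k) -> 0 < f x ->
  is_derive x (delta_mx 0 k) (fun y => f y `^ r)
    (r * f x `^ (r - 1) * partial k f x).
Proof. by move=> df fx0; exact: (is_derive_comp1 df (is_derive1_powR r fx0)). Qed.

Lemma is_derive_partial f k (x : 'rV[R]_n) d :
  is_derive x (delta_mx 0 k) f d -> partial k f x = d.
Proof. by case. Qed.

(** The induction is over all exponents, since each differentiation lowers the exponent by one. *)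
Lemma Ck_powR U N f (r : R) : open U -> Ck U N f ->
  (forall x, U x -> 0 < f x) -> Ck U N (fun x => f x `^ r).
Proof.
move=> Uo Cf f0.
have cont r' x : U x -> {for x, continuous (fun x => f x `^ r')}.
  move=> Ux.
  apply: (@continuous_comp _ _ _ f (fun s => s `^ r')).
    exact: Ck_continuous Cf Ux.
  apply: differentiable_continuous; apply/derivable1_diffP.
  by have [] := is_derive1_powR r' (f0 x Ux).
elim: N r Cf => [|N IH] r Cf; first by apply/Ck0P => x; exact: cont.
apply/CkSP; split.
- by move=> x; exact: cont.
- move=> k x Ux.
  by have [] := partial_powR r (Ck_derivable k Cf Ux) (f0 x Ux).
- move=> k; apply: (@Ck_ext _ _ (fun x => r * f x `^ (r - 1) * partial k f x)) => //.
    move=> x; rewrite inE => Ux.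
    by rewrite (is_derive_partial (partial_powR r (Ck_derivable k Cf Ux) (f0 x Ux))).
  apply: (CkM Uo); last exact: Ck_partial.
  by apply: (CkZ _ Uo); apply: IH; exact: CkS.
Qed.

Lemma smooth_on_partial U f k : smooth_on U f -> smooth_on U (partial k f).
Proof. by move=> sf s x Ux; have := sf (rcons s k) x Ux; rewrite foldr_rcons. Qed.

Lemma smooth_onP U f : smooth_on U f <-> forall N, Ck U N f.
Proof.
split=> [sf N|Cf s x Ux].
  elim: N f sf => [|N IH] f sf; first by apply/Ck0P => x /(sf [::])[].
  apply/CkSP; split.
  - by move=> x /(sf [::])[].
  - by move=> k x /(sf [::])[_]; exact.
  - by move=> k; apply: IH; exact: smooth_on_partial.
(* [foldr] applies the last letter of the word first, so words are peeled from the right. *)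
elim/last_ind: s f Cf => [|s k IH] f Cf /=.
  by split=> [|k]; [exact: Ck_continuous (Cf 0%N) Ux|
                    exact: Ck_derivable _ (Cf 1%N) Ux].
by rewrite foldr_rcons; apply: IH => N; exact: Ck_partial.
Qed.

End CkTheory.
Arguments Ck_derivable {n U N f x} k _ _.

(* The telescoping sum replaces the coordinates of [x] by those of [x + h] one
   at a time. *)
Lemma C1_differentiable n (U : set 'rV[R]_n) f x : open U -> Ck U 1 f -> U x ->
  differentiable f x /\
  forall v, 'd f x v = \sum_(k < n) v 0 k * partial k f x.
Proof.
move=> Uo Cf Ux.
pose L (v : 'rV[R]_n) := \sum_(k < n) v 0 k * partial k f x.
have Llin : linear (L : _ -> R^o).
  move=> a u v; rewrite /L scaler_sumr -big_split /=; apply: eq_bigr => k _.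
  by rewrite !mxE mulrDl -mulrA.
pose LM := GRing.isLinear.Build _ _ _ _ _ Llin.
pose LL : {linear 'rV[R]_n -> R^o} := HB.pack L LM.
pose F : 'rV[R]_n -> R^o := f.
have CL : Ck setT 0 L.
  apply: (@Ck_sum n setT 0 _ _ xpredT (fun k v => v 0 k * partial k f x)) => [|k _];
    first exact: openT.
   apply: (CkM openT).
    exact: Ck_coord.
  exact: Ck_cst.
have Lc : continuous LL by move=> y; exact: (Ck_continuous CL).
have Ldf : F \o shift x = cst (F x) + LL +o_ (0 : 'rV[R]_n) id.
  apply/eqaddoP => e e0.
  (* Each of the [n] coordinate moves may cost this much times [|v|]; the successor keeps the
     divisor nonzero in dimension 0. *)
  have en : 0 < e / n.+1%:R by rewrite divr_gt0.
  have : \forall y \near x, U y /\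
      forall k, `|partial k f x - partial k f y| <= e / n.+1%:R.
    apply: filterI; first by apply: near_open Uo Ux _.
    apply: (@filter_forall _ _ (fun k y => `|partial k f x - partial k f y| <=
      e / n.+1%:R) (nbhs x)) => k.
    have : {for x, continuous (partial k f)}.
      by apply: (@Ck_continuous _ U 0) => //; exact: Ck_partial.
    by move=> /near_dist_le; exact.
  move=> /nbhs_ballP[d /= d0 dU].
  apply/nbhs_ballP; exists d => //= v; rewrite -ball_normE /= sub0r normrN => vd.
  pose tr j : 'rV[R]_n := \row_k (if (k < j)%N then v 0 k else 0).
  have trS (k : 'I_n) : tr k.+1 = v 0 k *: delta_mx 0 k + tr k.
    apply/rowP => i; rewrite !mxE eqxx /= ltnS leq_eqVlt.
    have [->|ik] := eqVneq i k; first by rewrite ltnn eqxx mulr1 addr0.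
    by rewrite mulr0 add0r -(inj_eq val_inj) in ik *; rewrite (negPf ik).
  have tr0 : tr 0%N = 0 by apply/rowP => i; rewrite !mxE.
  have trn : tr n = v by apply/rowP => i; rewrite !mxE ltn_ord.
  have inb (k : 'I_n) s : `|s| <= `|v 0 k| ->
      ball x d (s *: delta_mx 0 k + (tr k + x)).
    move=> sv; rewrite -ball_normE /= addrA opprD addrCA subrr addr0 normrN.
    apply: le_lt_trans vd; apply: mx_norm_le => // i j; rewrite !mxE ord1 eqxx /=.
    have [->|ik] := eqVneq j k.
      by rewrite ltnn addr0 mulr1; apply: le_trans sv _; exact: ler_coord_norm.
    rewrite mulr0 add0r; case: ifP => _; first exact: ler_coord_norm.
    by rewrite normr0.
  have step (k : 'I_n) : `|f (tr k.+1 + x) - f (tr k + x) - v 0 k * partial k f x|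
      <= `|v| * (e / n.+1%:R).
    have [s /inb/dU[Us _]|s sv] := @MVT_line _ f (tr k + x) (delta_mx 0 k) (v 0 k).
      exact: Ck_derivable _ Cf Us.
    rewrite trS -[_ + tr k + x]addrA => ->; rewrite -/(partial k f _) -mulrBr normrM.
    apply: ler_pM => //; first exact: ler_coord_norm.
    by rewrite distrC; have [] := dU _ (inb _ _ sv).
  rewrite /= [X in `|X|](_ : _ =
      \sum_(k < n) (f (tr k.+1 + x) - f (tr k + x) - v 0 k * partial k f x)).
    apply: le_trans (ler_norm_sum _ _ _) _.
    apply: le_trans (ler_sum _ (fun k _ => step k)) _.
    rewrite sumr_const card_ord -mulrnAr [leRHS]mulrC ler_wpM2l//.
    by rewrite -mulr_natr mulrAC ler_pdivrMr// ler_pM2l// ler_nat.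
  rewrite sumrB -(big_mkord xpredT (fun k => f (tr k.+1 + x) - f (tr k + x))).
  by rewrite telescope_sumr// trn tr0 add0r opprD addrA.
have dL := diff_unique Lc Ldf.
split; last by move=> v; rewrite dL.
by apply/diff_locallyP; rewrite dL.
Qed.

(* The curve [h |-> phi (x + h e_k)] is differentiable at 0, so it composes with
   the Frechet differentiable [f]. *)
Lemma partial_comp n m (V : set 'rV[R]_m)
    (phi : 'rV[R]_n -> 'rV[R]_m) f (x : 'rV[R]_n) k :
  open V -> Ck V 1 f -> V (phi x) ->
  (forall c, derivable (fun y : 'rV[R]_n => phi y 0 c) x (delta_mx 0 k)) ->
  is_derive x (delta_mx 0 k) (f \o phi)
    (\sum_(c < m) partial k (fun y => phi y 0 c) x * partial c f (phi x)).
Proof.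
move=> Vo Cf Vx dphi; have [df Ef] := C1_differentiable Vo Cf Vx.
set e : 'rV[R]_n := delta_mx 0 k.
have dphie : derivable phi x e.
  by apply/derivable_mxP => i j; rewrite (ord1 i); exact: dphi.
pose gam (h : R) := phi (h *: e + x).
have gam0 : gam 0 = phi x by rewrite /gam scale0r add0r.
have dgam : is_derive (0 : R) 1 gam ('D_e phi x).
  by have /derivable1P dg := dphie; split => //; rewrite [RHS]derive_line.
have [/derivable1_diffP dg1 dg2] := dgam.
have dfg : differentiable f (gam 0) by rewrite gam0.
have dc := differentiable_comp dg1 dfg.
split.
  by apply/derivable1P/derivable1_diffP.
rewrite derive_line -[(fun h : R => _)]/(f \o gam).
rewrite (deriveE _ dc) (diff_comp dg1 dfg) /= -(deriveE _ dg1) dg2 gam0 Ef.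
by apply: eq_bigr => c _; rewrite (derive_mx dphie) mxE.
Qed.

(** The chain rule writes each partial as a finite sum of products of continuous functions. *)
Lemma C1_comp n m (U : set 'rV[R]_n) (V : set 'rV[R]_m)
    (phi : 'rV[R]_n -> 'rV[R]_m) f : open U -> open V -> Ck V 1 f ->
  (forall x, U x -> V (phi x)) -> (forall c, Ck U 1 (fun y => phi y 0 c)) ->
  Ck U 1 (f \o phi).
Proof.
move=> Uo Vo Cf UV Cphi.
have cphi x : U x -> {for x, continuous phi}.
  move=> Ux; apply: (@cvg_mx _ (nbhs x)) => i c; rewrite (ord1 i).
  exact: Ck_continuous (Cphi c) Ux.
have dphi k (x : 'rV[R]_n) : U x -> is_derive x (delta_mx 0 k) (f \o phi)
    (\sum_(c < m) partial k (fun y => phi y 0 c) x * partial c f (phi x)).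
  move=> Ux; apply: (partial_comp Vo Cf (UV _ Ux)) => c.
  exact: Ck_derivable _ (Cphi c) Ux.
have comp g x : Ck V 0 g -> U x -> {for x, continuous (g \o phi)}.
  move=> Cg Ux; apply: continuous_comp; first exact: cphi.
  exact: Ck_continuous Cg (UV _ Ux).
apply/CkSP; split.
- by move=> x; apply: comp; exact: CkS.
- by move=> k x /(dphi k)[].
- move=> k; pose s := fun x => \sum_(c < m) partial k (fun y => phi y 0 c) x *
                                  partial c f (phi x).
  apply: (@Ck_ext _ _ _ s) => //.
    by move=> x; rewrite inE => /(dphi k)/is_derive_partial->.
  apply: (@Ck_sum n U 0 _ _ xpredT (fun c x =>
    partial k (fun y => phi y 0 c) x * partial c f (phi x))) => // c _.
  apply: (CkM Uo); first exact: Ck_partial.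
  by apply/Ck0P => x; apply: comp; exact: Ck_partial.
Qed.

(* Both orders of differentiation compute the second difference quotient of
   [f] at [x], up to a perturbation of the evaluation point. *)
Lemma second_difference n (U : set 'rV[R]_n) f (x : 'rV[R]_n) i j (d : R) : Ck U 2 f ->
  (forall y : 'rV[R]_n, `|y - x| <= d -> U y) -> 0 < d ->
  exists2 y : 'rV[R]_n, `|y - x| <= d &
    f ((d / 2) *: delta_mx 0 j + ((d / 2) *: delta_mx 0 i + x))
    - f ((d / 2) *: delta_mx 0 j + x) - f ((d / 2) *: delta_mx 0 i + x) + f x
    = (d / 2) ^+ 2 * partial j (partial i f) y.
Proof.
move=> Cf dU d0; set h : R := d / 2.
have h0 : 0 < h by rewrite divr_gt0.
have Cfi : Ck U 1 (partial i f) by exact: Ck_partial.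
have Us (s t : R) : `|s| <= h -> `|t| <= h ->
    `|s *: delta_mx 0 i + (t *: delta_mx 0 j + x) - x| <= d.
  move=> sh th; rewrite addrA addrK (splitr d); apply: le_trans (ler_normD _ _) _.
  by apply: lerD; rewrite normrZ -[leRHS]mulr1; apply: ler_pM => //;
    exact: norm_delta_le.
pose g := fun y : 'rV[R]_n => f (h *: delta_mx 0 j + y) - f y.
have hh : `|h| <= h by rewrite ger0_norm// ltW.
have h00 : `|0 : R| <= h by rewrite normr0 ltW.
have dsh (s : R) : `|s| <= h -> is_derive (s *: delta_mx 0 i + x) (delta_mx 0 i) g
    (partial i f (s *: delta_mx 0 i + (h *: delta_mx 0 j + x)) -
     partial i f (s *: delta_mx 0 i + x)).
  move=> sh.
  have d1 : derivable f (s *: delta_mx 0 i + (h *: delta_mx 0 j + x)) (delta_mx 0 i).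
    by apply: (Ck_derivable i Cf); apply: dU; exact: Us.
  have d2 : derivable f (s *: delta_mx 0 i + x) (delta_mx 0 i).
    apply: (Ck_derivable i Cf); apply: dU.
    by have := Us s 0 sh h00; rewrite scale0r add0r.
  have d3 : is_derive (s *: delta_mx 0 i + x) (delta_mx 0 i)
      (fun y => f (h *: delta_mx 0 j + y))
      (partial i f (s *: delta_mx 0 i + (h *: delta_mx 0 j + x))).
    have E : (fun t : R => t^-1 *: (((fun y => f (h *: delta_mx 0 j + y)) \o
        shift (s *: delta_mx 0 i + x)) (t *: delta_mx 0 i) -
        f (h *: delta_mx 0 j + (s *: delta_mx 0 i + x)))) =
       (fun t : R => t^-1 *: ((f \o shift (s *: delta_mx 0 i + (h *: delta_mx 0 j + x)))
         (t *: delta_mx 0 i) - f (s *: delta_mx 0 i + (h *: delta_mx 0 j + x)))).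
      apply/funext => t /=; congr (_ *: (f _ - f _)); last by rewrite addrCA.
      by rewrite addrCA; congr (_ + _); rewrite addrCA.
    by split; rewrite /derivable /partial /derive /= E.
  by apply: is_deriveB; exact: DeriveDef.
have [|s] := @MVT_line _ g x (delta_mx 0 i) h.
  by move=> s; rewrite (ger0_norm (ltW h0)) => /dsh[].
rewrite (ger0_norm (ltW h0)) => sh.
have [_ ->] := dsh s sh => Eg.
have [|t] := @MVT_line _ (partial i f) (s *: delta_mx 0 i + x) (delta_mx 0 j) h.
  move=> t; rewrite (ger0_norm (ltW h0)) => th.
  apply: (Ck_derivable j Cfi); apply: dU.
  by rewrite addrCA; exact: Us.
rewrite (ger0_norm (ltW h0)) => th Ep.
exists (t *: delta_mx 0 j + (s *: delta_mx 0 i + x)); first by rewrite addrCA; exact: Us.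
rewrite /partial expr2 -mulrA -/(partial i f) -Ep.
rewrite [h *: _ + (s *: _ + x)]addrCA -Eg /g; ring.
Qed.

#[local] Opaque derive.

(** The two orders of differentiation give points [y] and [z] at which the mixed partials are equal.
    Both points are close to [x], and continuity carries each value back to [x] up to [e / 2]. *)
Lemma partialC n (U : set 'rV[R]_n) f x i j : open U -> Ck U 2 f -> U x ->
  partial i (partial j f) x = partial j (partial i f) x.
Proof.
move=> Uo Cf Ux; apply/eqP; rewrite -subr_eq0 -normr_eq0; apply/eqP/le_anti.
rewrite normr_ge0 andbT; apply/ler_addgt0Pl => e e0; rewrite addr0.
have e2 : 0 < e / 2 by rewrite divr_gt0.
have : \forall y \near x, [/\ U y,
    `|partial i (partial j f) x - partial i (partial j f) y| <= e / 2 &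
    `|partial j (partial i f) x - partial j (partial i f) y| <= e / 2].
  have cc a b : {for x, continuous (partial a (partial b f))}.
    by apply: (@Ck_continuous _ U 0) => //; do 2 apply: Ck_partial.
  have H1 := near_dist_le (cc i j) e2.
  have H2 := near_dist_le (cc j i) e2.
  by apply: filterS3 (near_open Uo Ux (fun _ => id)) H1 H2 => y; split.
move=> /nbhs_ballP[d /= d0 dU].
have dU' y : `|y - x| <= d / 2 -> ball x d y.
  move=> yd; rewrite -ball_normE /= distrC; apply: le_lt_trans yd _.
  by rewrite ltr_pdivrMr// ltr_pMr// ltr1n.
have d20 : 0 < d / 2 by rewrite divr_gt0.
have dU2 y : `|y - x| <= d / 2 -> U y by move=> /dU'/dU[].
have [y /dU'/dU[_ _ yP] Ey] := @second_difference _ U f x i j _ Cf dU2 d20.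
have [z /dU'/dU[_ zP _] Ez] := @second_difference _ U f x j i _ Cf dU2 d20.
have yz : partial i (partial j f) z = partial j (partial i f) y.
  apply: (@mulfI _ ((d / 2 / 2) ^+ 2)); first by rewrite expf_neq0// gt_eqF// divr_gt0.
  apply: etrans (esym Ez) (etrans _ Ey); move: (d / 2 / 2) => h.
  by rewrite [h *: _ + (h *: _ + x)]addrCA; congr (_ + f x); rewrite addrAC.
rewrite yz in zP; exact: dist_le_halves zP yP.
Qed.

End Calculus.

(** * Integration of compactly supported continuous functions *)

Section LineIntegral.
Variable R : realType.
Notation leb := (@lebesgue_measure R).
Implicit Types (f g df : R -> R) (r B : R).

Let supp1 r f := forall x, r < `|x| -> f x = 0.

Let restr r f : supp1 r f -> f = f \_ `[- r, r].
Proof.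
move=> sf; apply/funext => x; rewrite patchE; case: ifPn => //.
rewrite notin_setE /= in_itv /= => /negP; rewrite -ler_norml -ltNge.
exact: sf.
Qed.

Lemma csupp_integrable r f : continuous f -> supp1 r f ->
  leb.-integrable setT (EFin \o f).
Proof.
move=> cf sf; rewrite (restr sf) -restrict_EFin.
apply: (proj1 (integrable_mkcond _ _)); first exact: measurable_itv.
apply: continuous_compact_integrable; first exact: segment_compact.
exact: continuous_subspaceT.
Qed.

Lemma line_integral_bound r f B : 0 <= r -> continuous f -> supp1 r f ->
  (forall x, `|f x| <= B) -> `|\int[leb]_x f x| <= 2 * r * B.
Proof.
move=> r0 cf sf fB.
have If := csupp_integrable cf sf.
have mI : measurable `[- r, r]%classic by exact: measurable_itv.
have IA : leb.-integrable `[- r, r] (EFin \o f).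
  by apply: (integrableS measurableT).
have E : fine (leb `[- r, r]%classic) = 2 * r.
  rewrite lebesgue_measure_itv /= lte_fin; case: ltP => [_|rr] /=; first ring.
  lra.
rewrite {1}(restr sf) -(Rintegral_mkcond leb `[- r, r] f).
apply: le_trans (le_normr_Rintegral _ IA) _ => //.
rewrite -E mulrC -Rintegral_cst//; apply: le_Rintegral => //;
  apply: continuous_compact_integrable; try exact: segment_compact;
  apply: continuous_subspaceT => x; last exact: cvg_cst.
exact: (cvg_norm (cf x)).
Qed.

Lemma line_integral_gt0 r f x : continuous f -> supp1 r f ->
  (forall y, 0 <= f y) -> 0 < f x -> 0 < \int[leb]_y f y.
Proof.
move=> cf sf f0 fx.
have If := csupp_integrable cf sf.
have fx2 : f x / 2 < f x by rewrite ltr_pdivrMr// ltr_pMr// ltr1n.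
have : \forall y \near x, f x / 2 <= f y.
  by near do apply: ltW; exact: (cvgr_gt (f x) (cf x)).
move=> /nbhs_ballP[d /= d0 dP].
have d2 : 0 < d / 2 by rewrite divr_gt0.
pose A := `[x - d / 2, x + d / 2]%classic : set R.
have mA : measurable A by exact: measurable_itv.
have IA : leb.-integrable A (EFin \o f) by exact: (integrableS measurableT).
have Ap y : A y -> f x / 2 <= f y.
  rewrite /A /= in_itv /= => /andP[y1 y2]; apply: dP; rewrite /ball /= ltr_distl.
  by apply/andP; split; lra.
apply: (@lt_le_trans _ _ (\int[leb]_(y in A) f y)); last first.
  rewrite Rintegral_mkcond; apply: le_Rintegral => //.
    by rewrite -restrict_EFin; apply: (proj1 (integrable_mkcond _ _)).
  by move=> y _; rewrite patchE; case: ifP.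
have EA : fine (leb A) = d.
  by rewrite lebesgue_measure_itv /= lte_fin; case: ltP => [_|?] /=; lra.
apply: (@lt_le_trans _ _ (\int[leb]_(y in A) (f x / 2))).
  by rewrite Rintegral_cst// EA mulr_gt0// divr_gt0.
apply: le_Rintegral => //.
apply: continuous_compact_integrable; first exact: segment_compact.
by apply: continuous_subspaceT => y; exact: cvg_cst.
Unshelve. all: by end_near. Qed.

Lemma line_integral_derivative r f df : 0 <= r -> supp1 r f -> continuous df ->
  (forall x : R, is_derive x 1 f (df x)) -> \int[leb]_x df x = 0.
Proof.
move=> r0 sf cdf fdf.
have f1 (x : R) : r < `|x| -> df x = 0.
  move=> rx; have [_ <-] := fdf x.
  rewrite (@near_eq_derive _ _ _ f (cst 0)) ?derive_cst//.
  near=> y; apply: sf; near: y.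
  by apply: (cvgr_gt `|x|) => //; apply: cvg_norm; exact: cvg_id.
(* [supp1] says nothing directly about [|x| = r]; on the widened interval [f] vanishes at both
   endpoints, and the fundamental theorem gives 0. *)
pose a := r + 1.
have a0 : - a < a by rewrite /a; lra.
have fa : f a = 0 by apply: sf; rewrite ger0_norm /a; lra.
have fNa : f (- a) = 0 by apply: sf; rewrite normrN ger0_norm /a; lra.
have sa : supp1 a df by move=> x ax; apply: f1; apply: lt_trans ax; rewrite /a; lra.
rewrite (restr sa) -(Rintegral_mkcond leb `[- a, a] df) /Rintegral.
rewrite (continuous_FTC2 (F := f))//.
- by rewrite fa fNa subee.
- exact: continuous_subspaceT.
- split=> [x _||]; first by have [] := fdf x.
  + by apply: cvg_at_right_filter; apply: differentiable_continuous;
      apply/derivable1_diffP; have [] := fdf (- a).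
  + by apply: cvg_at_left_filter; apply: differentiable_continuous;
      apply/derivable1_diffP; have [] := fdf a.
- by move=> x _; rewrite derive1E; have [] := fdf x.
Unshelve. all: by end_near. Qed.

End LineIntegral.

(** * Iterated integrals over R^n *)

Section SpaceIntegral.
Variable R : realType.
Notation leb := (@lebesgue_measure R).

(** This is the argument of [f] in [integral_rV], so unfolding the integral once yields the slices
    [F (row0 x y)] by conversion. The same splitting later separates time from space. *)
Definition row0 (n : nat) (x : R) (y : 'rV[R]_n) : 'rV[R]_(1 + n) :=
  row_mx (const_mx x : 'rV[R]_1) y.

Lemma row0K n (z : 'rV[R]_(1 + n)) : row0 (lsubmx z 0 0) (rsubmx z) = z.
Proof.
rewrite -[RHS]hsubmxK /row0; congr row_mx; apply/rowP => i.
by rewrite mxE (ord1 i).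
Qed.

Lemma row0_lsub n x (y : 'rV[R]_n) : lsubmx (row0 x y) 0 0 = x.
Proof. by rewrite row_mxKl mxE. Qed.

Lemma row0_rsub n x (y : 'rV[R]_n) : rsubmx (row0 x y) = y.
Proof. by rewrite row_mxKr. Qed.

Lemma row0El n x (y : 'rV[R]_n) : row0 x y 0 (lshift n 0) = x.
Proof. by rewrite row_mxEl mxE. Qed.

Lemma row0Er n x (y : 'rV[R]_n) k : row0 x y 0 (rshift 1 k) = y 0 k.
Proof. by rewrite row_mxEr. Qed.

Lemma norm_row0l n x (y : 'rV[R]_n) : `|x| <= `|row0 x y|.
Proof.
by have := ler_coord_norm (row0 x y) 0 (lshift n 0); rewrite row_mxEl mxE.
Qed.

Lemma norm_row0r n x (y : 'rV[R]_n) : `|y| <= `|row0 x y|.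
Proof.
apply: mx_norm_le => // i j; rewrite (ord1 i).
by have := ler_coord_norm (row0 x y) 0 (rshift 1 j); rewrite row_mxEr.
Qed.

Lemma row0_continuous n (x : R) (y : 'rV[R]_n) :
  (fun p : 'rV[R]_n * R => row0 p.2 p.1) p @[p --> (y, x)] --> row0 x y.
Proof.
apply: (@cvg_mx _ (nbhs (y, x))) => i j; rewrite (ord1 i).
case: (split_ordP j) => k -> /=.
  rewrite (ord1 k) row0El; under eq_fun do rewrite row0El.
  exact: cvg_snd.
rewrite row0Er; under eq_fun do rewrite row0Er.
have := @coord_continuous R 1 n 0 k y; apply: cvg_comp; exact: cvg_fst.
Qed.

Lemma row0r_continuous n (x : R) (y : 'rV[R]_n) :
  row0 x y' @[y' --> y] --> row0 x y.
Proof.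
apply: (@cvg_mx _ (nbhs y)) => i j; rewrite (ord1 i).
case: (split_ordP j) => k -> /=.
  by rewrite (ord1 k) row0El; under eq_fun do rewrite row0El; exact: cvg_cst.
rewrite row0Er; under eq_fun do rewrite row0Er.
exact: (@coord_continuous R 1 n 0 k y).
Qed.

Lemma row0_shiftl n h x (y : 'rV[R]_n) :
  h *: delta_mx 0 (lshift n 0) + row0 x y = row0 (h + x) y.
Proof.
apply/rowP => j; case: (split_ordP j) => k ->.
  by rewrite (ord1 k) mxE !row0El mxE mxE !eqxx mulr1.
rewrite mxE !row0Er mxE mxE (_ : rshift 1 k == lshift n 0 = false).
  by rewrite mulr0 add0r.
by rewrite eq_rlshift.
Qed.

Lemma row0_shiftr n h k x (y : 'rV[R]_n) :
  h *: delta_mx 0 (rshift 1 k) + row0 x y = row0 x (h *: delta_mx 0 k + y).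
Proof.
apply/rowP => j; case: (split_ordP j) => i ->.
  by rewrite (ord1 i) mxE !row0El mxE mxE eq_lrshift mulr0 add0r.
by rewrite mxE !row0Er !mxE !eqxx /= eq_rshift.
Qed.

Lemma partial_row0r n (F : 'rV[R]_(1 + n) -> R) j x (y : 'rV[R]_n) :
  partial (rshift 1 j) F (row0 x y) = partial j (fun y => F (row0 x y)) y.
Proof.
rewrite /partial derive_line [RHS]derive_line.
by congr (derive _ (0 : R) (1 : R)); apply/funext => h; rewrite row0_shiftr.
Qed.

Lemma partial_row0l n (F : 'rV[R]_(1 + n) -> R) x (y : 'rV[R]_n) :
  partial (lshift n 0) F (row0 x y) = 'D_1 (fun s => F (row0 s y)) x.
Proof.
rewrite /partial derive_line [RHS]derive_line.
congr (derive _ (0 : R) (1 : R)); apply/funext => h.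
by rewrite row0_shiftl [h *: 1]mulr1.
Qed.

Lemma derivable_row0l n (F : 'rV[R]_(1 + n) -> R) (x : R) (y : 'rV[R]_n) :
  derivable F (row0 x y) (delta_mx 0 (lshift n 0)) ->
  derivable (fun s => F (row0 s y)) x 1.
Proof.
move=> /derivable1P dF; apply/derivable1P; move: dF.
congr (derivable _ (0 : R) (1 : R)); apply/funext => h.
by rewrite row0_shiftl [h *: 1]mulr1.
Qed.

Lemma contT n (F : 'rV[R]_n -> R) : continuous F <-> Ck setT 0 F.
Proof. by split=> [cF|/Ck0P cF x]; [apply/Ck0P => x _; exact: cF|exact: cF]. Qed.

(** The radius is explicit because slices and linear combinations keep it, and because it gives the
    volume factor [(2 * r) ^+ n] in the bound of the integral. *)
Definition csupp n (r : R) (F : 'rV[R]_n -> R) : Prop :=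
  continuous F /\ forall x, r < `|x| -> F x = 0.

Lemma csupp_slice n r (F : 'rV[R]_(1 + n) -> R) x : csupp r F ->
  csupp r (fun y => F (row0 x y)).
Proof.
move=> [cF sF]; split.
  move=> y; apply: (@cvg_comp _ _ _ (row0 x) F _ (nbhs (row0 x y))).
    exact: row0r_continuous.
  exact: cF.
by move=> y ry; apply: sF; apply: lt_le_trans ry _; exact: norm_row0r.
Qed.

Lemma csupp_lin n r a (F G : 'rV[R]_n -> R) : csupp r F -> csupp r G ->
  csupp r (fun x => a * F x + G x).
Proof.
move=> [cF sF] [cG sG]; split=> [x|x rx]; last by rewrite sF// sG// mulr0 addr0.
move/contT in cF; move/contT in cG; apply: (@Ck_continuous _ _ setT 0) => //.
by apply: (CkD openT) => //; exact: (CkZ _ openT).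
Qed.

Lemma ball0_compact n r : compact [set y : 'rV[R]_n | `|y| <= r].
Proof.
apply: bounded_closed_compact.
  exists r; split; first exact: num_real.
  by move=> M rM y /= yr; apply: le_trans yr _; exact: ltW.
apply: (@preimage_closed _ _ (fun y : 'rV[R]_n => `|y|) [set x | x <= r]).
  by move=> y _; exact: norm_continuous.
exact: closed_le.
Qed.

(* Uniform continuity of [F] in the 0-th variable, by compactness of the
   support in the others. *)
Lemma csupp_unif n r (F : 'rV[R]_(1 + n) -> R) x e : csupp r F -> 0 < e ->
  \forall x' \near x, forall y, `|F (row0 x y) - F (row0 x' y)| <= e.
Proof.
move=> [cF sF] e0.
have cK := @ball0_compact n r.
have : \forall x' \near x, [set y : 'rV[R]_n | `|y| <= r] `<=`
    (fun y => `|F (row0 x y) - F (row0 x' y)| <= e).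
  apply: ((compact_near_coveringP _).1 cK R (nbhs x)
    (fun x' y => `|F (row0 x y) - F (row0 x' y)| <= e)).
  move=> y _.
  have e2 : 0 < e / 2 by rewrite divr_gt0.
  have cy : (fun p : 'rV[R]_n * R => F (row0 p.2 p.1)) p @[p --> (y, x)]
      --> F (row0 x y).
    exact: continuous_comp (@row0_continuous _ x y) (cF _).
  have /cvgrPdist_le /(_ _ e2) H1 := cy.
  have H2 : \forall y' \near y, `|F (row0 x y) - F (row0 x y')| <= e / 2.
    exact: near_dist_le ((csupp_slice x (conj cF sF)).1 y) e2.
  have H2' : \forall p \near (y, x), `|F (row0 x y) - F (row0 x p.1)| <= e / 2.
    exact: (cvg_fst (G := nbhs x) H2).
  apply: filterS2 H1 H2' => -[y' x'] /= h1 h2.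
  by apply: dist_le_halves; rewrite distrC; [exact: h2|exact: h1].
apply: filterS => x' H y; have [yr|yr] := leP `|y| r; first exact: H.
by rewrite !sF ?subr0 ?normr0 ?ltW//; apply: lt_le_trans yr _; exact: norm_row0r.
Qed.

Lemma csupp_le n r r' (F : 'rV[R]_n -> R) : r <= r' -> csupp r F -> csupp r' F.
Proof.
by move=> rr' [cF sF]; split => // x r'x; apply: sF; exact: le_lt_trans r'x.
Qed.

Lemma csupp_cst0 n r : csupp r (fun _ : 'rV[R]_n => 0).
Proof. by split => // x; exact: (@cst_continuous _ _ _ x). Qed.

Let lin n := forall r a (F G : 'rV[R]_n -> R), csupp r F -> csupp r G ->
  integral_rV (fun x => a * F x + G x) = a * integral_rV F + integral_rV G.

Let bnd n := forall (r B : R) (F : 'rV[R]_n -> R), 0 <= r -> csupp r F ->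
  (forall x, `|F x| <= B) -> `|integral_rV F| <= (2 * r) ^+ n * B.

Let lin_inner n : lin n -> bnd n -> forall (r : R) (F : 'rV[R]_(1 + n) -> R),
  0 <= r -> csupp r F ->
  continuous (fun x => integral_rV (fun y => F (row0 x y))) /\
  forall x, r < `|x| -> integral_rV (fun y => F (row0 x y)) = 0.
Proof.
move=> linn bndn r F r0 cF; split=> [x|x rx].
  apply/cvgrPdist_le => e e0.
  (* The added 1 keeps the divisor positive when [r = 0]. *)
  have c0 : 0 < (2 * r) ^+ n + 1 by rewrite ltr_wpDl// exprn_ge0// mulr_ge0.
  have e'0 : 0 < e / ((2 * r) ^+ n + 1) by rewrite divr_gt0.
  apply: filterS (csupp_unif x cF e'0) => x' H.
  have sx z := csupp_slice z cF.
  have E : integral_rV (fun y => F (row0 x y)) - integral_rV (fun y => F (row0 x' y))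
      = integral_rV (fun y => -1 * F (row0 x' y) + F (row0 x y)).
    by rewrite (linn r _ _ _ (sx x') (sx x)) mulN1r addrC.
  rewrite E; apply: le_trans (bndn r (e / ((2 * r) ^+ n + 1)) _ r0
    (csupp_lin (-1) (sx x') (sx x)) _) _.
    by move=> y; rewrite mulN1r addrC; exact: H.
  by rewrite mulrCA ler_piMr ?(ltW e0)// ler_pdivrMr// mul1r lerDl.
(* Here linearity is what is known of the inner integral; applied to the zero function in this form
   it gives [- I + I = 0]. *)
have -> : (fun y => F (row0 x y)) = (fun y => -1 * 0 + 0).
  apply/funext => y; have [_ ->//] := cF; first by rewrite mulr0 addr0.
  by apply: lt_le_trans rx _; exact: norm_row0l.
rewrite (linn r _ _ _ (csupp_cst0 n r) (csupp_cst0 n r)).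
by rewrite mulN1r addNr.
Qed.

(* Linearity in dimension [n] gives continuity of the inner integral, hence the
   integrability needed for linearity in dimension [n + 1]. *)
Let lin_bnd n : lin n /\ bnd n.
Proof.
elim: n => [|n [linn bndn]].
  by split=> [//|r B F r0 cF FB]; rewrite expr0 mul1r; exact: FB.
have inner := lin_inner linn bndn.
split=> [r a F G cF cG|r B F r0 cF FB].
(* Linearity is claimed for every [r], but the bound behind [inner] wants a nonnegative radius. *)
- have r0 : 0 <= Num.max r 0 by rewrite le_max lexx orbT.
  have rr : r <= Num.max r 0 by rewrite le_max lexx.
  have [cf sf] := inner _ _ r0 (csupp_le rr cF).
  have [cg sg] := inner _ _ r0 (csupp_le rr cG).
  have iF := csupp_integrable cf sf; have iG := csupp_integrable cg sg.
  transitivity (\int[leb]_x (a * integral_rV (fun y => F (row0 x y)) +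
                              integral_rV (fun y => G (row0 x y)))).
    apply: eq_Rintegral => x _.
    exact: (linn r a _ _ (csupp_slice x cF) (csupp_slice x cG)).
  rewrite RintegralD//; last by have := integrableZl measurableT a iF.
  by rewrite RintegralZl.
- have [cf sf] := inner _ _ r0 cF.
  rewrite exprS -mulrA; apply: (line_integral_bound r0 cf sf).
  by move=> x; apply: (bndn r B) => //; exact: csupp_slice.
Qed.

Lemma integral_rV_lin n r a (F G : 'rV[R]_n -> R) : csupp r F -> csupp r G ->
  integral_rV (fun x => a * F x + G x) = a * integral_rV F + integral_rV G.
Proof. exact: (lin_bnd n).1. Qed.

Lemma integral_rV_bound n (r B : R) (F : 'rV[R]_n -> R) : 0 <= r -> csupp r F ->
  (forall x, `|F x| <= B) -> `|integral_rV F| <= (2 * r) ^+ n * B.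
Proof. exact: (lin_bnd n).2. Qed.

Lemma csupp_inner n (r : R) (F : 'rV[R]_(1 + n) -> R) : 0 <= r -> csupp r F ->
  continuous (fun x => integral_rV (fun y => F (row0 x y))) /\
  forall x, r < `|x| -> integral_rV (fun y => F (row0 x y)) = 0.
Proof. exact: (lin_inner (lin_bnd n).1 (lin_bnd n).2). Qed.

Lemma integral_rV0 n : integral_rV (fun _ : 'rV[R]_n => 0 : R) = 0.
Proof.
have := integral_rV_lin (-1) (csupp_cst0 n 0) (csupp_cst0 n 0).
by under eq_fun do rewrite mulr0 addr0; rewrite mulN1r addNr.
Qed.

(** By induction the inner integral is positive at the first coordinate of [x]. It is nonnegative
    and continuous elsewhere, so the one-dimensional case applies. *)
Lemma integral_rV_gt0 n r (F : 'rV[R]_n -> R) x : 0 <= r -> csupp r F ->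
  (forall y, 0 <= F y) -> 0 < F x -> 0 < integral_rV F.
Proof.
move=> r0; have ge0 : forall n (F : 'rV[R]_n -> R),
    (forall y, 0 <= F y) -> 0 <= integral_rV F.
  by elim=> [|m IH] G G0 //=; apply: Rintegral_ge0 => y _; exact: IH.
elim: n F x => [|n IH] F x cF F0 Fx; first by rewrite /= (_ : 0 = x)// thinmx0.
have [cf sf] := csupp_inner r0 cF.
apply: (@line_integral_gt0 _ r _ (lsubmx (x : 'rV_(1 + n)) 0 0) cf sf) => [y|].
  by apply: ge0.
apply: (IH _ (rsubmx (x : 'rV_(1 + n)))) => //; first exact: csupp_slice.
by rewrite row0K.
Qed.

Lemma csupp_partial n r (F : 'rV[R]_n -> R) k : csupp r F -> Ck setT 1 F ->
  csupp r (partial k F).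
Proof.
move=> [cF sF] CF; split; first by apply/contT; exact: Ck_partial.
move=> x rx; rewrite /partial (@near_eq_derive _ _ _ _ (cst 0)) ?derive_cst//.
near=> y; apply: sF; near: y.
by apply: (cvgr_gt `|x|) => //; exact: norm_continuous.
Unshelve. all: by end_near. Qed.

(** In direction 0, differentiation under the inner integral shows that the integrand over the line
    is a derivative of a compactly supported function. In the other directions each slice already
    integrates to zero by induction. *)
Lemma integral_rV_partial n r (F : 'rV[R]_n -> R) k : 0 <= r -> csupp r F ->
  Ck setT 1 F -> integral_rV (partial k F) = 0.
Proof.
move=> r0; elim: n F k => [|n IH] F k cF CF; first by case: k.
have cpF j := csupp_partial j cF CF.
case: (@split_ordP 1 n k) => j ->.
  rewrite (ord1 j); set k0 : 'I_(1 + n) := lshift n 0.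
  have [cf sf] := csupp_inner r0 cF.
  have [cdf _] := csupp_inner r0 (cpF k0).
  apply: (line_integral_derivative r0 sf cdf) => x.
  apply: cvg_is_derive; apply/cvgrPdist_le => e e0.
  have c0 : 0 < (2 * r) ^+ n + 1 by rewrite ltr_wpDl// exprn_ge0// mulr_ge0.
  have e'0 : 0 < e / ((2 * r) ^+ n + 1) by rewrite divr_gt0.
  have /nbhs_ballP[d /= d0 dH] := csupp_unif x (cpF k0) e'0.
  apply/nbhs_ballP; exists d => //= h; rewrite /ball /= sub0r normrN => hd h0.
  have sF z := csupp_slice z cF.
  have sp := csupp_slice x (cpF k0).
  (* [G] is the partial derivative minus the difference quotient, bounded through the mean value
     theorem by the uniform continuity of the partial. It is nested as [a * F + G] to fit
     [csupp_lin] and [integral_rV_lin]. *)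
  pose G y := - h^-1 * F (row0 (h + x) y) +
    (h^-1 * F (row0 x y) + partial k0 F (row0 x y)).
  have cG : csupp r G by apply: csupp_lin (sF _) (csupp_lin _ (sF _) sp).
  have GB y : `|G y| <= e / ((2 * r) ^+ n + 1).
    have [s _|s sh] := @MVT_line _ _ F (row0 x y) (delta_mx 0 k0) h.
      exact: Ck_derivable CF _.
    rewrite row0_shiftl row0_shiftl -/(partial k0 F _) => E.
    have -> : G y = partial k0 F (row0 x y) - partial k0 F (row0 (s + x) y).
      have alg (q p1 p2 p3 : R) : - q * p1 + (q * p2 + p3) = p3 - q * (p1 - p2).
        ring.
      by rewrite /G alg E mulKf.
    apply: dH; rewrite /ball /= opprD addrCA subrr addr0 normrN.
    exact: le_lt_trans hd.
  have EG : integral_rV G = integral_rV (fun y => partial k0 F (row0 x y)) -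
      h^-1 * (integral_rV (fun y => F (row0 (h + x) y)) -
              integral_rV (fun y => F (row0 x y))).
    rewrite (integral_rV_lin _ (sF _) (csupp_lin _ (sF _) sp)).
    by rewrite (integral_rV_lin _ (sF _) sp); ring.
  rewrite -EG; apply: le_trans (integral_rV_bound r0 cG GB) _.
  by rewrite mulrCA ler_piMr ?(ltW e0)// ler_pdivrMr// mul1r lerDl.
have E x : integral_rV (fun y => partial (rshift 1 j) F (row0 x y)) = 0.
  under eq_fun do rewrite partial_row0r.
  apply: IH; first exact: csupp_slice.
  apply: (@C1_comp _ _ _ setT setT (row0 x) F) => //; [exact: openT|exact: openT|].
  move=> c; case: (split_ordP c) => i ->.
    by rewrite (ord1 i); under eq_fun do rewrite row0El; exact: Ck_cst.
  by under eq_fun do rewrite row0Er; exact: Ck_coord.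
transitivity (\int[leb]_x (0 : R)); first by apply: eq_Rintegral => x _; exact: E.
by rewrite Rintegral_cst// mul0r.
Qed.

End SpaceIntegral.

(** * Riemannian geometry in a chart *)

Section BochnerAlgebra.
Variables (K : comPzRingType) (n : nat).
Implicit Types (F : 'I_n -> 'I_n -> 'I_n -> K).

Lemma sum3_rot F : \sum_i \sum_j \sum_k F i j k = \sum_k \sum_i \sum_j F i j k.
Proof. by under eq_bigr do rewrite exchange_big; rewrite exchange_big. Qed.

(* The commutation of covariant derivatives [div (nabla_X X) - X (div X) =
   tr ((nabla X)^2) + Ric (X, X)] for a torsion-free connection, at a point:
   [dx j k], [d2 j k i], [dc m k i j] stand for the derivatives of the field [x]
   and of the connection coefficients [c]. *)
Lemma div_commutation (A dx : 'I_n -> 'I_n -> K) (x : 'I_n -> K)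
    (c d2 : 'I_n -> 'I_n -> 'I_n -> K) (dc : 'I_n -> 'I_n -> 'I_n -> 'I_n -> K)
    (dA : 'I_n -> 'I_n -> 'I_n -> K) :
  (forall k i j, c k i j = c k j i) ->
  (forall m k i j, dc m k i j = dc m k j i) ->
  (forall j k i, d2 j k i = d2 k j i) ->
  (forall k i, A k i = dx i k + \sum_l c k i l * x l) ->
  (forall j i k, dA j i k = d2 j k i + \sum_l (dc j i k l * x l + c i k l * dx j l)) ->
  \sum_j \sum_k (dA j j k * x k + A j k * dx j k)
    + \sum_j (\sum_l c l l j) * (\sum_k A j k * x k)
    - \sum_k x k * \sum_j dA k j j =
  \sum_j \sum_k A j k * A k j +
  \sum_i \sum_j x i * x j * \sum_k (dc k k i j - dc j k i k
      + \sum_l (c k k l * c l i j - c k j l * c l i k)).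
Proof.
move=> csym dcsym d2sym HA HdA.
(* Substituting [dx = A - c x] reduces both sides to sums of the types [A A], [c A x], [d2 x],
   [dc x x] and [c c x x]. [E1] to [E5] carry out the expansion; [C1] to [C6] match the sums by
   renaming indices and by the symmetries of [c], [dc] and [d2]. *)
have dxE j k : dx j k = A k j - \sum_l c k j l * x l by rewrite HA addrK.
have E1 : \sum_j \sum_k A j k * dx j k = \sum_j \sum_k A j k * A k j
    - \sum_j \sum_k \sum_l A j k * c k j l * x l.
  rewrite -sumrB; apply: eq_bigr => j _; rewrite -sumrB; apply: eq_bigr => k _.
  rewrite dxE mulrBr mulr_sumr; congr (_ - _); apply: eq_bigr => l _; ring.
have E2 : \sum_j \sum_k dA j j k * x k = \sum_j \sum_k d2 j k j * x k
    + \sum_j \sum_k \sum_l dc j j k l * x l * x k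
    + (\sum_j \sum_k \sum_l c j k l * A l j * x k
       - \sum_j \sum_k \sum_l \sum_m c j k l * c l j m * x m * x k).
  rewrite -sumrB -!big_split; apply: eq_bigr => j _.
  rewrite -sumrB -!big_split; apply: eq_bigr => k _ /=.
  rewrite HdA mulrDl mulr_suml -addrA; congr (_ + _).
  rewrite -sumrB -big_split; apply: eq_bigr => l _ /=.
  rewrite dxE mulrDl; congr (_ + _); rewrite mulrBr mulrBl; congr (_ - _).
  by rewrite mulr_sumr mulr_suml; apply: eq_bigr => m _; ring.
have E3 : \sum_k x k * \sum_j dA k j j = \sum_k \sum_j d2 k j j * x k
    + \sum_k \sum_j \sum_l dc k j j l * x l * x k
    + (\sum_k \sum_j \sum_l c j j l * A l k * x k
       - \sum_k \sum_j \sum_l \sum_m c j j l * c l k m * x m * x k).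
  rewrite -sumrB -!big_split; apply: eq_bigr => k _.
  rewrite mulr_sumr -sumrB -!big_split; apply: eq_bigr => j _ /=.
  rewrite HdA mulrC mulrDl mulr_suml -addrA; congr (_ + _).
  rewrite -sumrB -big_split; apply: eq_bigr => l _ /=.
  rewrite dxE mulrDl; congr (_ + _); rewrite mulrBr mulrBl; congr (_ - _).
  by rewrite mulr_sumr mulr_suml; apply: eq_bigr => m _; ring.
have E4 : \sum_i \sum_j x i * x j * \sum_k (dc k k i j - dc j k i k
      + \sum_l (c k k l * c l i j - c k j l * c l i k)) =
    \sum_i \sum_j \sum_k dc k k i j * x j * x i
    - \sum_i \sum_j \sum_k dc j k i k * x j * x i
    + (\sum_i \sum_j \sum_k \sum_l c k k l * c l i j * x j * x i
       - \sum_i \sum_j \sum_k \sum_l c k j l * c l i k * x j * x i).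
  rewrite -!sumrB -big_split; apply: eq_bigr => i _.
  rewrite -!sumrB -big_split; apply: eq_bigr => j _ /=.
  rewrite mulr_sumr -!sumrB -big_split; apply: eq_bigr => k _ /=.
  rewrite -!sumrB mulrDr mulr_sumr; congr (_ + _); first ring.
  by apply: eq_bigr => l _; ring.
have E5 : \sum_j (\sum_l c l l j) * (\sum_k A j k * x k) =
    \sum_k \sum_j \sum_l c j j l * A l k * x k.
  rewrite [RHS]exchange_big; rewrite [RHS]sum3_rot; apply: eq_bigr => j _.
  rewrite mulr_suml; apply: eq_bigr => l _.
  by rewrite mulr_sumr; apply: eq_bigr => k _; ring.
have C1 : \sum_j \sum_k \sum_l A j k * c k j l * x l =
    \sum_j \sum_k \sum_l c j k l * A l j * x k.
  rewrite [RHS]sum3_rot; do 3 (apply: eq_bigr => ? _).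
  by rewrite csym; ring.
have C2 : \sum_k \sum_j d2 k j j * x k = \sum_j \sum_k d2 j k j * x k.
  rewrite exchange_big; apply: eq_bigr => j _; apply: eq_bigr => k _.
  by rewrite d2sym.
have C3 : \sum_j \sum_k \sum_l dc j j k l * x l * x k =
    \sum_i \sum_j \sum_k dc k k i j * x j * x i by rewrite [RHS]sum3_rot.
have C4 : \sum_k \sum_j \sum_l dc k j j l * x l * x k =
    \sum_i \sum_j \sum_k dc j k i k * x j * x i.
  rewrite [LHS]sum3_rot; do 3 (apply: eq_bigr => ? _).
  by rewrite dcsym; ring.
have C5 : \sum_j \sum_k \sum_l \sum_m c j k l * c l j m * x m * x k =
    \sum_i \sum_j \sum_k \sum_l c k j l * c l i k * x j * x i.
  rewrite exchange_big; under eq_bigr do rewrite sum3_rot.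
  rewrite exchange_big; do 4 (apply: eq_bigr => ? _).
  by rewrite [X in _ * X * _ * _]csym; ring.
have C6 : \sum_k \sum_j \sum_l \sum_m c j j l * c l k m * x m * x k =
    \sum_i \sum_j \sum_k \sum_l c k k l * c l i j * x j * x i.
  by apply: eq_bigr => k _; rewrite sum3_rot.
rewrite E3 E4 E5; under eq_bigr do rewrite big_split.
rewrite big_split /= E1 E2 C1 C2 C3 C4 C5 C6; ring.
Qed.

End BochnerAlgebra.

(** * Positive definite matrices *)

Section MatrixFacts.
Variable R : realType.

Lemma posdef_unitmx n (A : 'M[R]_n) :
  (forall w : 'rV[R]_n, w != 0 -> 0 < (w *m A *m w^T) 0 0) -> A \in unitmx.
Proof.
move=> A0; rewrite -row_free_unit -kermx_eq0; apply/negPn/negP => /rowV0Pn[w].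
move=> /sub_kermxP wA /A0; rewrite wA mul0mx mxE ltxx.
by [].
Qed.

(** On the segment from the identity to [A] all matrices are positive definite, hence invertible.
    Along it the determinant is a polynomial in [t], equal to 1 at 0 and without root in [0, 1], so
    the intermediate value theorem fixes its sign at 1. *)
Lemma posdef_det_gt0 n (A : 'M[R]_n) :
  (forall w : 'rV[R]_n, w != 0 -> 0 < (w *m A *m w^T) 0 0) -> 0 < \det A.
Proof.
move=> A0.
pose P : 'M[{poly R}]_n := \matrix_(i, j)
  ((1%:M i j)%:P + ((A i j - 1%:M i j)%:P) * 'X).
have PE t : (\det P).[t] = \det (1%:M + t *: (A - 1%:M)).
  rewrite -horner_evalE -det_map_mx; congr (\det _).
  by apply/matrixP => i j; rewrite !mxE /= horner_evalE !hornerE mulrC.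
have Pn0 t : 0 <= t <= 1 -> (\det P).[t] != 0.
  move=> /andP[t0 t1]; rewrite PE -unitfE -unitmxE; apply: posdef_unitmx => w w0.
  have ww : 0 < (w *m w^T) 0 0.
    rewrite mxE; have [i wi] : exists i, w 0 i != 0.
      apply/existsP; apply: contraNT w0; rewrite negb_exists => /forallP w0.
      by apply/eqP/rowP => i; rewrite mxE; apply/eqP; have := w0 i; rewrite negbK.
    rewrite (bigD1 i)//= mxE ltr_pwDl//.
      by rewrite -expr2 lt_neqAle eq_sym sqrf_eq0 wi sqr_ge0.
    by apply: sumr_ge0 => j _; rewrite mxE -expr2 sqr_ge0.
  rewrite (_ : _ *m w^T = (1 - t) *: (w *m w^T) + t *: (w *m A *m w^T)); last first.
    rewrite mulmxDr mulmx1 -scalemxAr mulmxBr mulmx1 mulmxDl -scalemxAl mulmxBl.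
    by rewrite scalerBl scale1r scalerBr addrAC addrA.
  rewrite mxE [X in X + _]mxE [X in _ + X]mxE.
  have [->|tn0] := eqVneq t 0; first by rewrite subr0 mul1r mul0r addr0.
  by rewrite ltr_wpDl ?mulr_ge0 ?subr_ge0 ?(ltW ww)// mulr_gt0 ?A0// lt_neqAle eq_sym tn0.
have P0 : (\det P).[0] = 1 by rewrite PE scale0r addr0 det1.
have P1 : (\det P).[1] = \det A by rewrite PE scale1r addrC subrK.
rewrite -P1 ltNge; apply/negP => P1le.
have [||t t01 /eqP] := @poly_ivt _ (- \det P) 0 1.
- exact: ler01.
- by rewrite !hornerN P0 oppr_le0 ler01 oppr_ge0 P1le.
- by rewrite hornerN => /eqP; rewrite oppr_eq0; apply/negP/Pn0.
Qed.

End MatrixFacts.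

#[local] Opaque smooth_on.

(** * Rules for smooth functions and partial derivatives *)

Section SmoothRules.
Variables (R : realType) (n : nat) (U : set 'rV[R]_n).
Hypothesis Uo : open U.
Implicit Types (f g : 'rV[R]_n -> R) (x : 'rV[R]_n) (k : 'I_n).

Lemma smooth_on_C1 f : smooth_on U f -> Ck U 1 f.
Proof. by move/smooth_onP. Qed.

Lemma smooth_on_derivable f x k : smooth_on U f -> U x ->
  derivable f x (delta_mx 0 k).
Proof. by move=> /smooth_onP /(_ 1%N) Cf Ux; exact: Ck_derivable Cf Ux. Qed.

Lemma smooth_on_ext f g : {in U, f =1 g} -> smooth_on U f -> smooth_on U g.
Proof. by move=> fg /smooth_onP Cf; apply/smooth_onP => N; exact: Ck_ext fg (Cf N). Qed.

Lemma smooth_on_cst c : smooth_on U (fun=> c).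
Proof. by apply/smooth_onP => N; exact: Ck_cst. Qed.

Lemma smooth_onD f g : smooth_on U f -> smooth_on U g ->
  smooth_on U (fun x => f x + g x).
Proof.
by move=> /smooth_onP Cf /smooth_onP Cg; apply/smooth_onP => N; exact: CkD.
Qed.

Lemma smooth_onM f g : smooth_on U f -> smooth_on U g ->
  smooth_on U (fun x => f x * g x).
Proof.
by move=> /smooth_onP Cf /smooth_onP Cg; apply/smooth_onP => N; exact: CkM.
Qed.

Lemma smooth_onZ c f : smooth_on U f -> smooth_on U (fun x => c * f x).
Proof. by apply: smooth_onM; exact: smooth_on_cst. Qed.

Lemma smooth_onB f g : smooth_on U f -> smooth_on U g ->
  smooth_on U (fun x => f x - g x).
Proof.
by move=> /smooth_onP Cf /smooth_onP Cg; apply/smooth_onP => N; exact: CkB.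
Qed.

Lemma smooth_on_sum (I : Type) (r : seq I) (P : pred I) (F : I -> 'rV[R]_n -> R) :
  (forall i, P i -> smooth_on U (F i)) ->
  smooth_on U (fun x => \sum_(i <- r | P i) F i x).
Proof.
move=> CF; apply/smooth_onP => N; apply: Ck_sum => // i /CF/smooth_onP; exact.
Qed.

Lemma smooth_on_prod (I : Type) (r : seq I) (P : pred I) (F : I -> 'rV[R]_n -> R) :
  (forall i, P i -> smooth_on U (F i)) ->
  smooth_on U (fun x => \prod_(i <- r | P i) F i x).
Proof.
move=> CF; apply/smooth_onP => N; apply: Ck_prod => // i /CF/smooth_onP; exact.
Qed.

Lemma smooth_on_powR f (r : R) : smooth_on U f -> (forall x, U x -> 0 < f x) ->
  smooth_on U (fun x => f x `^ r).
Proof.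
by move=> /smooth_onP Cf f0; apply/smooth_onP => N; exact: Ck_powR.
Qed.

Lemma smooth_on_det m (A : 'rV[R]_n -> 'M[R]_m) :
  (forall i j, smooth_on U (fun x => A x i j)) -> smooth_on U (fun x => \det (A x)).
Proof.
move=> sA; apply: smooth_on_sum => s _; apply: smooth_onZ.
by apply: smooth_on_prod => i _; exact: sA.
Qed.

End SmoothRules.
Arguments smooth_on_derivable {R n U f x} k _ _.

Section PartialRules.
Variables (R : realType) (n : nat).
Implicit Types (f g : 'rV[R]_n -> R) (x : 'rV[R]_n) (k : 'I_n).
Notation dv f x k := (derivable f x (delta_mx 0 k)).

Lemma partialD f g x k : dv f x k -> dv g x k ->
  partial k (fun y => f y + g y) x = partial k f x + partial k g x.
Proof. by move=> df dg; rewrite /partial -deriveD. Qed.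

Lemma derivable_mul f g x k : dv f x k -> dv g x k -> dv (fun y => f y * g y) x k.
Proof. exact: derivableM. Qed.

Lemma partialM f g x k : dv f x k -> dv g x k ->
  partial k (fun y => f y * g y) x = f x * partial k g x + g x * partial k f x.
Proof. by move=> df dg; exact: deriveM. Qed.

Lemma partial_cst c x k : partial k (fun _ => c) x = 0.
Proof. exact: derive_cst. Qed.

Lemma partialZ c f x k : dv f x k -> partial k (fun y => c * f y) x = c * partial k f x.
Proof.
move=> df; rewrite (partialM (f := fun=> c) _ df); last exact: derivable_cst.
by rewrite partial_cst mulr0 addr0.
Qed.

Lemma derivable_bigsum (I : Type) (r : seq I) (F : I -> 'rV[R]_n -> R) x k :
  (forall i, dv (F i) x k) ->
  dv (fun y => \sum_(i <- r) F i y) x k /\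
  partial k (fun y => \sum_(i <- r) F i y) x = \sum_(i <- r) partial k (F i) x.
Proof.
move=> dF; elim: r => [|i r [IH1 IH2]].
  rewrite big_nil; under eq_fun do rewrite big_nil.
  by split; [exact: derivable_cst|exact: partial_cst].
rewrite big_cons; under eq_fun do rewrite big_cons.
split; first by apply: derivableD.
by rewrite (partialD (dF i) IH1) IH2.
Qed.

Lemma partial_sum (I : Type) (r : seq I) (F : I -> 'rV[R]_n -> R) x k :
  (forall i, dv (F i) x k) ->
  partial k (fun y => \sum_(i <- r) F i y) x = \sum_(i <- r) partial k (F i) x.
Proof. by move=> dF; exact: (derivable_bigsum r dF).2. Qed.

(** Keeping each product over the whole list, with one factor replaced, lets [partial_det] recognise
    a determinant with one differentiated row. Uniqueness in [r] ensures that the test [j == i]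
    selects a single factor. *)
Lemma derivable_bigprod (I : eqType) (r : seq I) (F : I -> 'rV[R]_n -> R) x k :
  uniq r -> (forall i, dv (F i) x k) ->
  dv (fun y => \prod_(i <- r) F i y) x k /\
  partial k (fun y => \prod_(i <- r) F i y) x =
    \sum_(i <- r) \prod_(j <- r) (if j == i then partial k (F j) x else F j x).
Proof.
move=> + dF; elim: r => [|a r IH] /=.
  rewrite big_nil; under eq_fun do rewrite big_nil.
  by split; [exact: derivable_cst|exact: partial_cst].
move=> /andP[ar /IH[IH1 IH2]].
have -> : (fun y => \prod_(i <- a :: r) F i y) =
    (fun y => F a y * \prod_(i <- r) F i y).
  by apply/funext => y; rewrite big_cons.
split; first exact: derivable_mul.
rewrite (partialM (dF a) IH1) IH2 big_cons big_cons eqxx addrC; congr (_ + _).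
  rewrite mulrC; congr (_ * _); apply: eq_big_seq => j jr.
  by case: eqP => // ja; rewrite -ja jr in ar.
rewrite mulr_sumr; apply: eq_big_seq => i ir; rewrite big_cons.
by case: eqP => // ai; rewrite ai ir in ar.
Qed.

(** Jacobi's formula: Leibniz' rule gives the sum over [i] of the determinants with row [i]
    differentiated, and the expansion along that row produces the cofactors. *)
Lemma partial_det m (A : 'rV[R]_n -> 'M[R]_m) x k :
  (forall i j, dv (fun y => A y i j) x k) ->
  partial k (fun y => \det (A y)) x =
  \tr ((\matrix_(i, j) partial k (fun y => A y i j) x) *m \adj (A x)).
Proof.
move=> dA; pose dM : 'M[R]_m := \matrix_(i, j) partial k (fun y => A y i j) x.
have dprod (s : {perm 'I_m}) := @derivable_bigprod _ (index_enum 'I_m)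
  (fun i y => A y i (s i)) x k (index_enum_uniq _) (fun i => dA i (s i)).
rewrite /determinant partial_sum; last first.
  by move=> s; apply: derivable_mul; [exact: derivable_cst|exact: (dprod s).1].
pose M i : 'M[R]_m := \matrix_(a, b) if a == i then dM a b else A x a b.
transitivity (\sum_i \det (M i)).
  rewrite exchange_big; apply: eq_bigr => s _.
  rewrite partialZ; last exact: (dprod s).1.
  rewrite (dprod s).2 mulr_sumr; apply: eq_bigr => i _; congr (_ * _).
  by apply: eq_bigr => j _; rewrite !mxE.
apply: eq_bigr => i _; rewrite (expand_det_row _ i) mxE.
apply: eq_bigr => j _; rewrite !mxE eqxx; congr (_ * _).
rewrite /cofactor; congr (_ * \det _); apply/matrixP => a b; rewrite !mxE.
by rewrite eq_sym (negPf (neq_lift _ _)).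
Qed.

End PartialRules.

#[local] Opaque partial.

(** * Levi-Civita calculus of a metric on an open set of R^n *)

Section ChartGeometry.
Variables (R : realType) (n : nat) (U : set 'rV[R]_n) (G : 'rV[R]_n -> 'M[R]_n).
Hypothesis Uo : open U.
Hypothesis Gs : forall i j, smooth_on U (fun x => G x i j).
Hypothesis Gsym : forall x, U x -> (G x)^T = G x.
Hypothesis Gpos : forall x, U x -> forall w : 'rV[R]_n, w != 0 ->
  0 < (w *m G x *m w^T) 0 0.

Lemma detG_gt0 x : U x -> 0 < \det (G x).
Proof. by move=> Ux; apply: posdef_det_gt0; exact: Gpos. Qed.

Lemma unitG x : U x -> G x \in unitmx.
Proof. by move=> Ux; apply: posdef_unitmx; exact: Gpos. Qed.

Lemma invG_sym x : U x -> (invmx (G x))^T = invmx (G x).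
Proof. by move=> Ux; rewrite trmx_inv Gsym. Qed.

(** Cramer's rule, with the inverse of the determinant written as a real power so that
    [smooth_on_powR] covers it. *)
Lemma invG_smooth i j : smooth_on U (fun x => invmx (G x) i j).
Proof.
apply: (@smooth_on_ext _ _ _ Uo (fun x => (\det (G x)) `^ (-1) * cofactor (G x) j i)).
  move=> x; rewrite inE => Ux.
  by rewrite /invmx unitG// !mxE powR_inv1// ltW// detG_gt0.
apply: smooth_onM => //.
  by apply: smooth_on_powR => //; [exact: smooth_on_det|exact: detG_gt0].
rewrite /cofactor; apply: smooth_onZ => //; apply: smooth_on_det => // a b.
by under eq_fun do rewrite !mxE; exact: Gs.
Qed.

Lemma sqrtG_powR x : U x -> Num.sqrt (\det (G x)) = (\det (G x)) `^ (2^-1).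
Proof. by move=> Ux; rewrite powR12_sqrt// ltW// detG_gt0. Qed.

Lemma sqrtG_gt0 x : U x -> 0 < Num.sqrt (\det (G x)).
Proof. by move=> Ux; rewrite sqrtr_gt0 detG_gt0. Qed.

Lemma sqrtG_smooth : smooth_on U (fun x => Num.sqrt (\det (G x))).
Proof.
apply: (@smooth_on_ext _ _ _ Uo (fun x => (\det (G x)) `^ (2^-1))).
  by move=> x; rewrite inE => /sqrtG_powR.
by apply: smooth_on_powR => //; [exact: smooth_on_det|exact: detG_gt0].
Qed.

Lemma christoffel_smooth k i j : smooth_on U (christoffel G k i j).
Proof.
apply: smooth_onZ => //; apply: smooth_on_sum => // l _.
apply: smooth_onM => //; first exact: invG_smooth.
by apply: smooth_onB => //; [apply: smooth_onD => //|]; exact: smooth_on_partial.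
Qed.

Lemma G_sym_entry x i j : U x -> G x i j = G x j i.
Proof. by move=> Ux; rewrite -[in RHS]Gsym// mxE. Qed.

Lemma partialG_sym x k i j : U x ->
  partial k (fun y => G y i j) x = partial k (fun y => G y j i) x.
Proof.
by move=> Ux; apply: (partial_ext k Uo) => // y; rewrite inE => Uy; exact: G_sym_entry.
Qed.

Lemma christoffel_sym x k i j : U x -> christoffel G k i j x = christoffel G k j i x.
Proof.
move=> Ux; congr (_ * _); apply: eq_bigr => l _; congr (_ * (_ - _)).
  by rewrite addrC.
exact: partialG_sym.
Qed.

Definition partial_mx (A : 'rV[R]_n -> 'M[R]_n) k x : 'M[R]_n :=
  \matrix_(i, j) partial k (fun y => A y i j) x.

Definition christoffel_mx k x : 'M[R]_n := \matrix_(m, i) christoffel G m k i x.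

Local Notation H x := (invmx (G x)).
Local Notation C := christoffel_mx.
Local Notation dG := (partial_mx G).
Local Notation dH := (partial_mx (fun y => H y)).

(** Christoffel symbols of the first kind. The last two terms are antisymmetric in [m] and [i], so
    they cancel in [L + L^T]. *)
Definition christoffel_low k x : 'M[R]_n := \matrix_(m, i) (2^-1 * (partial k (fun y => G y i m) x
  + partial i (fun y => G y k m) x - partial m (fun y => G y k i) x)).

Local Notation L := christoffel_low.

Lemma christoffel_mxE k x : C k x = H x *m L k x.
Proof.
apply/matrixP => m i; rewrite !mxE /christoffel mulr_sumr.
by apply: eq_bigr => l _; rewrite !mxE mulrCA.
Qed.

Lemma christoffel_low_sym k x : U x -> L k x + (L k x)^T = dG k x.
Proof.
move=> Ux; apply/matrixP => i j; rewrite !mxE (partialG_sym k j i Ux).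
by field.
Qed.

(* Metric compatibility, on the inverse metric. *)
Lemma partial_invG k x : U x -> dH k x = - (C k x *m H x) - H x *m (C k x)^T.
Proof.
move=> Ux.
have E : dG k x *m H x + G x *m dH k x = 0.
  apply/matrixP => i j; rewrite !mxE -big_split /=.
  have := partial_cst (1%:M i j) x k : partial k (fun _ => 1%:M i j : R) x = 0.
  rewrite (@partial_ext _ _ U _ (fun y => \sum_l G y i l * invmx (G y) l j))//; last first.
    move=> y; rewrite inE => Uy; rewrite -(mulmxV (unitG Uy)) mxE.
    by [].
  rewrite partial_sum; last first.
    move=> l; apply: derivable_mul.
      exact: smooth_on_derivable _ (Gs _ _) Ux.
    exact: smooth_on_derivable _ (invG_smooth _ _) Ux.
  move=> E0; rewrite -[RHS]E0; apply: eq_bigr => l _; rewrite partialM.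
  - by rewrite !mxE addrC [X in _ + X]mulrC.
  - exact: smooth_on_derivable _ (Gs _ _) Ux.
  - exact: smooth_on_derivable _ (invG_smooth _ _) Ux.
have -> : dH k x = - (H x *m dG k x *m H x).
  rewrite -(mulKmx (unitG Ux) (dH k x)) -mulmxA -mulmxN; congr (_ *m _).
  by apply/eqP; rewrite -addr_eq0 addrC E.
rewrite -christoffel_low_sym// christoffel_mxE trmx_mul invG_sym// mulmxDr mulmxDl opprD.
by rewrite !mulmxA.
Qed.

Lemma tr_christoffel k x : U x -> \tr (C k x) = 2^-1 * \tr (dG k x *m H x).
Proof.
move=> Ux; rewrite -christoffel_low_sym// mulmxDl mxtraceD christoffel_mxE.
rewrite -[\tr ((L k x)^T *m _)]mxtrace_tr trmx_mul trmxK invG_sym//.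
by rewrite [\tr (L k x *m _)]mxtrace_mulC; field.
Qed.

(** Jacobi's formula gives half of [\tr (dG *m H)] as logarithmic derivative, which [tr_christoffel]
    turns into the contracted Christoffel symbol. This links the divergence form of the Laplacian to
    covariant derivatives. *)
Lemma partial_sqrtG k x : U x -> partial k (fun y => Num.sqrt (\det (G y))) x =
  Num.sqrt (\det (G x)) * \tr (C k x).
Proof.
move=> Ux; have d0 := detG_gt0 Ux.
have dd : derivable (fun y => \det (G y)) x (delta_mx 0 k).
  exact: smooth_on_derivable _ (smooth_on_det Uo Gs) Ux.
rewrite (@partial_ext _ _ U _ (fun y => \det (G y) `^ 2^-1))//; last first.
  by move=> y; rewrite inE => /sqrtG_powR.
rewrite (is_derive_partial (partial_powR 2^-1 dd d0)) partial_det; last first.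
  by move=> i j; exact: smooth_on_derivable _ (Gs _ _) Ux.
have -> : \adj (G x) = \det (G x) *: H x.
  by rewrite /invmx unitG// scalerA divff ?gt_eqF// scale1r.
rewrite -scalemxAr mxtraceZ tr_christoffel// -/(dG k x) sqrtG_powR//.
have -> : \det (G x) `^ 2^-1 = \det (G x) `^ (2^-1 - 1) * \det (G x).
  rewrite -[X in _ * X]powRr1 ?(ltW d0)// -powRD ?subrK//.
  by apply/implyP => _; rewrite gt_eqF.
ring.
Qed.

Section Function.
Variable f : 'rV[R]_n -> R.
Hypothesis fs : smooth_on U f.

Lemma gradE x k : local_grad G f x 0 k = \sum_l H x k l * partial l f x.
Proof. by rewrite mxE. Qed.

Lemma grad_smooth k : smooth_on U (fun x => local_grad G f x 0 k).
Proof.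
under eq_fun do rewrite gradE; apply: (smooth_on_sum Uo) => l _.
by apply: (smooth_onM Uo); [exact: invG_smooth|exact: smooth_on_partial].
Qed.

(* [covgrad j k] is the component X^j_{;k} of the covariant derivative of the
   gradient X of [f]. *)
Definition covgrad j k x := partial k (fun y => local_grad G f y 0 j) x
  + \sum_l christoffel G j k l x * local_grad G f x 0 l.

Lemma covgrad_smooth j k : smooth_on U (covgrad j k).
Proof.
apply: (smooth_onD Uo); first exact: smooth_on_partial (grad_smooth j).
apply: (smooth_on_sum Uo) => l _.
by apply: (smooth_onM Uo); [exact: christoffel_smooth|exact: grad_smooth].
Qed.

Lemma local_laplacian_div x : U x -> local_laplacian G f x =
  \sum_k (partial k (fun y => local_grad G f y 0 k) x
          + \tr (C k x) * local_grad G f x 0 k).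
Proof.
move=> Ux; rewrite /local_laplacian mulr_sumr; apply: eq_bigr => k _.
rewrite partialM.
- rewrite partial_sqrtG//; have := sqrtG_gt0 Ux; move: (Num.sqrt _) => q q0.
  by field; rewrite gt_eqF.
- exact: smooth_on_derivable _ sqrtG_smooth Ux.
- exact: smooth_on_derivable _ (grad_smooth k) Ux.
Qed.

Lemma local_laplacian_covgrad x : U x -> local_laplacian G f x = \sum_j covgrad j j x.
Proof.
move=> Ux; rewrite local_laplacian_div// !big_split /=; congr (_ + _).
under eq_bigr do rewrite mulr_suml.
rewrite exchange_big; apply: eq_bigr => j _; apply: eq_bigr => l _.
by rewrite mxE christoffel_sym.
Qed.

Lemma partial_grad j k x : U x ->
  partial k (fun y => local_grad G f y 0 j) x =
  \sum_l (H x j l * partial k (partial l f) x + partial l f x * dH k x j l).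
Proof.
move=> Ux; under [X in partial _ X]eq_fun do rewrite gradE.
have dh l := smooth_on_derivable k (invG_smooth j l) Ux.
have df l := smooth_on_derivable k (smooth_on_partial l fs) Ux.
rewrite partial_sum; last by move=> l; apply: derivable_mul.
by apply: eq_bigr => l _; rewrite partialM// mxE.
Qed.

(** Raising an index commutes with covariant differentiation. Of the two terms of [partial_invG],
    one cancels the Christoffel term of the gradient ([E1]) and the other becomes that of the
    Hessian ([E2]). *)
Lemma covgrad_hessian x j k : U x ->
  covgrad j k x = \sum_l H x j l * local_hessian G f x k l.
Proof.
move=> Ux; rewrite /covgrad partial_grad// partial_invG// big_split -addrA /=.
have E1 : \sum_l christoffel G j k l x * local_grad G f x 0 l =
    \sum_l partial l f x * (C k x *m H x) j l.
  under eq_bigr do rewrite gradE mulr_sumr.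
  under [RHS]eq_bigr do rewrite mxE mulr_sumr.
  rewrite exchange_big; apply: eq_bigr => l _; apply: eq_bigr => m _.
  by rewrite mxE; ring.
have E2 : \sum_l partial l f x * (H x *m (C k x)^T) j l =
    \sum_l H x j l * \sum_m christoffel G m k l x * partial m f x.
  under eq_bigr do rewrite mxE mulr_sumr.
  under [RHS]eq_bigr do rewrite mulr_sumr.
  rewrite exchange_big; apply: eq_bigr => l _; apply: eq_bigr => m _.
  by rewrite !mxE; ring.
rewrite E1 -big_split /=.
transitivity (\sum_l H x j l * partial k (partial l f) x -
    \sum_l partial l f x * (H x *m (C k x)^T) j l).
  congr (_ + _); rewrite -sumrN; apply: eq_bigr => l _.
  by rewrite mxE [(- (C k x *m H x)) j l]mxE [(- (H x *m _)) j l]mxE; ring.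
rewrite E2 -sumrB; apply: eq_bigr => l _.
by rewrite mxE mulrBr.
Qed.

Lemma hessian_sym x : U x -> (local_hessian G f x)^T = local_hessian G f x.
Proof.
move=> Ux; apply/matrixP => i j; rewrite mxE [LHS]mxE [RHS]mxE.
rewrite (@partialC _ _ U _ _ _ _ Uo _ Ux); last by have /smooth_onP := fs; exact.
by congr (_ - _); apply: eq_bigr => k _; rewrite christoffel_sym.
Qed.

Lemma local_laplacian_tr x : U x ->
  local_laplacian G f x = \tr (H x *m local_hessian G f x).
Proof.
move=> Ux; rewrite local_laplacian_covgrad//; apply: eq_bigr => j _.
rewrite covgrad_hessian// mxE; apply: eq_bigr => l _; congr (_ * _).
by rewrite -[in LHS]hessian_sym// mxE.
Qed.

End Function.

Definition local_normsq x (T : 'M[R]_n) := \sum_(i < n) \sum_(j < n)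
  \sum_(k < n) \sum_(l < n) H x i k * H x j l * T i j * T k l.

(** For symmetric [T] the norm is the trace of the square of the endomorphism [H *m T]; both the
    Bochner term and the shift by the metric are computed in this form. *)
Lemma local_normsq_tr (T : 'M[R]_n) x : U x -> T^T = T ->
  local_normsq x T = \tr ((H x *m T) *m (H x *m T)).
Proof.
move=> Ux Tsym; rewrite /local_normsq sum3_rot; apply: eq_bigr => a _.
rewrite mxE exchange_big; apply: eq_bigr => b _.
rewrite mxE [X in _ * X]mxE mulr_suml; apply: eq_bigr => c _.
rewrite mulr_sumr; apply: eq_bigr => d _.
have Hs i j : H x i j = H x j i by rewrite -[in LHS]invG_sym// mxE.
have Ts i j : T i j = T j i by rewrite -[in LHS]Tsym mxE.
rewrite (Hs c a) (Ts a d); ring.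
Qed.

(** Adding [c *: G] adds [c] times the identity to [H *m Hess], so this is the expansion of the
    trace of a square; the cross term is the Laplacian and the trace of the identity is [n]. *)
Lemma local_normsq_shift f (c : R) x : smooth_on U f -> U x ->
  local_normsq x (local_hessian G f x + c *: G x) =
  local_normsq x (local_hessian G f x) + 2 * c * local_laplacian G f x
    + n%:R * c ^+ 2.
Proof.
move=> fs Ux; have hs := hessian_sym fs Ux.
rewrite local_normsq_tr//; last by rewrite linearD linearZ /= hs Gsym.
rewrite local_normsq_tr// local_laplacian_tr// mulmxDr -scalemxAr mulVmx ?unitG//.
move: (H x *m _) => A.
rewrite mulmxDl !mulmxDr -scalemxAl -!scalemxAr mul1mx !mulmx1.
by rewrite !mxtraceD !mxtraceZ mxtrace1; ring.
Qed.

Definition local_inner f g x := \sum_k local_grad G f x 0 k * partial k g x.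

Lemma local_inner_smooth f g : smooth_on U f -> smooth_on U g ->
  smooth_on U (local_inner f g).
Proof.
move=> fs gs; apply: (smooth_on_sum Uo) => k _.
by apply: (smooth_onM Uo); [exact: grad_smooth|exact: smooth_on_partial].
Qed.

Lemma local_innerC f g x : U x -> local_inner f g x = local_inner g f x.
Proof.
move=> Ux; rewrite /local_inner; under eq_bigr do rewrite gradE mulr_suml.
rewrite exchange_big; apply: eq_bigr => l _; rewrite gradE mulr_suml.
apply: eq_bigr => k _; rewrite -[in H x k l]invG_sym// mxE; ring.
Qed.

(** Passing to the covariant derivative in one factor and to the Hessian in the other introduces the
    same Christoffel sum with opposite signs ([E2]). What remains are two equal halves ([E1]). *)
Lemma partial_local_inner f x l : smooth_on U f -> U x ->
  partial l (local_inner f f) x =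
  2 * \sum_k local_hessian G f x l k * local_grad G f x 0 k.
Proof.
move=> fs Ux.
have dX k := smooth_on_derivable l (grad_smooth fs k) Ux.
have df k := smooth_on_derivable l (smooth_on_partial k fs) Ux.
rewrite /local_inner partial_sum; last by move=> k; apply: derivable_mul.
have E1 : \sum_k partial k f x * covgrad f k l x =
    \sum_k local_hessian G f x l k * local_grad G f x 0 k.
  under eq_bigr do rewrite covgrad_hessian// mulr_sumr.
  under [RHS]eq_bigr do rewrite gradE mulr_sumr.
  rewrite exchange_big; apply: eq_bigr => k _; apply: eq_bigr => i _.
  by rewrite -[in H x i k]invG_sym// mxE; ring.
have E2 : \sum_k partial k f x *
      \sum_m christoffel G k l m x * local_grad G f x 0 m =
    \sum_k (\sum_m christoffel G m l k x * partial m f x) * local_grad G f x 0 k.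
  under eq_bigr do rewrite mulr_sumr.
  under [RHS]eq_bigr do rewrite mulr_suml.
  rewrite exchange_big; apply: eq_bigr => k _; apply: eq_bigr => i _; ring.
transitivity (\sum_k local_grad G f x 0 k * partial l (partial k f) x +
   (\sum_k partial k f x * covgrad f k l x - \sum_k partial k f x *
      \sum_m christoffel G k l m x * local_grad G f x 0 m)).
  rewrite -sumrB -big_split; apply: eq_bigr => k _ /=.
  by rewrite partialM// /covgrad mulrDr addrK.
rewrite E2 [RHS]mulrC mulr_natr mulr2n -[in X in _ = X + _]E1.
rewrite addrCA; congr (_ + _); rewrite -sumrB; apply: eq_bigr => k _.
by rewrite [local_hessian _ _ _ _ _]mxE; ring.
Qed.

Lemma grad_local_inner f x j : smooth_on U f -> U x ->
  local_grad G (local_inner f f) x 0 j =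
  2 * \sum_k covgrad f j k x * local_grad G f x 0 k.
Proof.
move=> fs Ux; rewrite gradE mulr_sumr.
under eq_bigr do rewrite partial_local_inner// mulrCA mulr_sumr mulr_sumr.
rewrite exchange_big; apply: eq_bigr => k _.
rewrite covgrad_hessian// mulr_suml mulr_sumr; apply: eq_bigr => l _.
by rewrite -[in local_hessian G f x l k]hessian_sym// mxE; ring.
Qed.

Lemma local_laplacian_smooth f : smooth_on U f -> smooth_on U (local_laplacian G f).
Proof.
move=> fs; apply: (@smooth_on_ext _ _ _ Uo (fun x => \sum_j covgrad f j j x)).
  by move=> x; rewrite inE => Ux; rewrite (local_laplacian_covgrad fs Ux).
by apply: (smooth_on_sum Uo) => j _; exact: covgrad_smooth.
Qed.

(** By [grad_local_inner], half the gradient of [|X|^2] is [nabla_X X], for [X] the gradient of [f].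
    Its divergence is handled by [div_commutation], where [div X] is the Laplacian and
    [tr ((nabla X)^2)] is the squared norm of the Hessian by symmetry. *)
Lemma local_bochner f x : smooth_on U f -> U x ->
  local_laplacian G (local_inner f f) x =
  2 * (local_normsq x (local_hessian G f x)
       + (local_grad G f x *m local_ricci G x *m (local_grad G f x)^T) 0 0)
  + 2 * local_inner f (local_laplacian G f) x.
Proof.
move=> fs Ux.
pose A j k := covgrad f j k x.
pose X k y := local_grad G f y 0 k.
pose dx j k := partial j (X k) x.
pose c k i j := christoffel G k i j x.
pose d2 j k i := partial j (partial k (X i)) x.
pose dc m k i j := partial m (christoffel G k i j) x.
pose dA j i k := partial j (covgrad f i k) x.
have sX k : smooth_on U (X k) := grad_smooth fs k.
have csym k i j : c k i j = c k j i := christoffel_sym k i j Ux.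
have dcsym m k i j : dc m k i j = dc m k j i.
  apply: (partial_ext m Uo _ Ux) => y; rewrite inE => Uy.
  exact: christoffel_sym.
have d2sym j k i : d2 j k i = d2 k j i.
  have /smooth_onP C2 := sX i.
  exact: (partialC j k Uo (C2 2%N) Ux).
have dX j k := smooth_on_derivable j (sX k) Ux.
have dG j k i m := smooth_on_derivable j (christoffel_smooth k i m) Ux.
have HdA j i k : dA j i k = d2 j k i + \sum_l (dc j i k l * X l x + c i k l * dx j l).
  have dp := smooth_on_derivable j (smooth_on_partial k (sX i)) Ux.
  have dm l := derivable_mul (dG j i k l) (dX j l).
  rewrite /dA /covgrad (partialD dp (derivable_bigsum _ dm).1) (partial_sum _ dm).
  congr (_ + _); apply: eq_bigr => l _.
  by rewrite (partialM (dG j i k l) (dX j l)) addrC mulrC.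
have := @div_commutation R n A dx (X^~ x) c d2 dc dA csym dcsym d2sym _ HdA.
have E1 : local_laplacian G (local_inner f f) x =
    2 * (\sum_j \sum_k (dA j j k * X k x + A j k * dx j k)
         + \sum_j (\sum_l c l l j) * (\sum_k A j k * X k x)).
  have dAX j k := smooth_on_derivable j (covgrad_smooth fs j k) Ux.
  have dm j k := derivable_mul (dAX j k) (dX j k).
  have P1 j : partial j (fun y => local_grad G (local_inner f f) y 0 j) x =
      2 * \sum_k (dA j j k * X k x + A j k * dx j k).
    rewrite (@partial_ext _ _ U _
      (fun y => 2 * \sum_k covgrad f j k y * X k y) _ _ Uo _ Ux); last first.
      by move=> y; rewrite inE => Uy; exact: (@grad_local_inner f y j fs Uy).
    rewrite (partialZ 2 (derivable_bigsum _ (dm j)).1) (partial_sum _ (dm j)).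
    congr (_ * _); apply: eq_bigr => k _.
    by rewrite (partialM (dAX j k) (dX j k)) addrC [X in X + _]mulrC.
  have P2 j : \tr (C j x) * local_grad G (local_inner f f) x 0 j =
      2 * ((\sum_l c l l j) * \sum_k A j k * X k x).
    rewrite (@grad_local_inner f x j fs Ux) mulrCA; congr (_ * (_ * _)).
    by apply: eq_bigr => l _; rewrite mxE csym.
  rewrite (local_laplacian_div (local_inner_smooth fs fs) Ux) -big_split mulr_sumr.
  apply: eq_bigr => j _.
  exact: etrans (congr2 +%R (P1 j) (P2 j)) (esym (mulrDr _ _ _)).
have E2 : local_inner f (local_laplacian G f) x =
    \sum_k X k x * \sum_j dA k j j.
  apply: eq_bigr => k _; congr (_ * _).
  rewrite (@partial_ext _ _ U _ (fun y => \sum_j covgrad f j j y) _ _ Uo _ Ux).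
    rewrite partial_sum// => j; exact: smooth_on_derivable (covgrad_smooth fs j j) Ux.
  by move=> y; rewrite inE => Uy; rewrite (local_laplacian_covgrad fs Uy).
have E3 : local_normsq x (local_hessian G f x) = \sum_j \sum_k A j k * A k j.
  have AE j k : A j k = (H x *m local_hessian G f x) j k.
    rewrite /A covgrad_hessian// mxE; apply: eq_bigr => l _; congr (_ * _).
    by rewrite -[in LHS]hessian_sym// mxE.
  rewrite local_normsq_tr//; last exact: hessian_sym.
  rewrite /mxtrace; apply: eq_bigr => j _; rewrite mxE; apply: eq_bigr => k _.
  by rewrite -!AE.
have E4 : (local_grad G f x *m local_ricci G x *m (local_grad G f x)^T) 0 0 =
    \sum_i \sum_j X i x * X j x * \sum_k (dc k k i j - dc j k i k
      + \sum_l (c k k l * c l i j - c k j l * c l i k)).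
  rewrite mxE exchange_big; apply: eq_bigr => j _.
  rewrite mxE mulr_suml; apply: eq_bigr => i _.
  by rewrite [X in _ * X]mxE [X in _ * X * _]mxE mulrAC.
rewrite E1 E2 E3 E4 => <- //; ring.
Qed.

End ChartGeometry.

Section ChartLaplacian.
Variables (R : realType) (n : nat) (U : set 'rV[R]_n) (G : 'rV[R]_n -> 'M[R]_n).
Hypothesis Uo : open U.
Hypothesis Gs : forall i j, smooth_on U (fun x => G x i j).
Hypothesis Gsym : forall x, U x -> (G x)^T = G x.
Hypothesis Gpos : forall x, U x -> forall w : 'rV[R]_n, w != 0 ->
  0 < (w *m G x *m w^T) 0 0.
Variables (f : 'rV[R]_n -> R) (c r : R).
Hypothesis fs : smooth_on U f.
Hypothesis f0 : forall x, U x -> 0 < f x.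

(** One family covers [u^m], the pressure and the product of the pressure with [u]. *)
Let p y := c * f y `^ r.

Lemma partial_cpowR x k : U x ->
  partial k p x = c * (r * f x `^ (r - 1)) * partial k f x.
Proof.
move=> Ux; have df := smooth_on_derivable k fs Ux.
have dp := partial_powR r df (f0 Ux).
by rewrite /p (partialZ c (dp.(ex_derive))) (is_derive_partial dp) mulrA.
Qed.

Lemma grad_cpowR x k : U x ->
  local_grad G p x 0 k = c * (r * f x `^ (r - 1)) * local_grad G f x 0 k.
Proof.
move=> Ux; rewrite !gradE mulr_sumr; apply: eq_bigr => l _.
by rewrite partial_cpowR// mulrCA.
Qed.

Lemma local_inner_cpowR g x : U x ->
  local_inner G p g x = c * (r * f x `^ (r - 1)) * local_inner G f g x.
Proof.
move=> Ux; rewrite /local_inner mulr_sumr; apply: eq_bigr => k _.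
by rewrite (grad_cpowR _ Ux) [RHS]mulrA.
Qed.

Lemma cpowR_smooth : smooth_on U p.
Proof. by apply: (smooth_onZ Uo); exact: (smooth_on_powR Uo). Qed.

Lemma local_laplacian_cpowR x : U x ->
  local_laplacian G p x = c * (r * f x `^ (r - 1)) * local_laplacian G f x
    + c * (r * (r - 1) * f x `^ (r - 1 - 1)) * local_inner G f f x.
Proof.
move=> Ux.
rewrite (local_laplacian_div Uo Gs Gsym Gpos cpowR_smooth Ux).
rewrite (local_laplacian_div Uo Gs Gsym Gpos fs Ux) /local_inner !mulr_sumr.
rewrite -big_split; apply: eq_bigr => k _ /=.
have df := smooth_on_derivable k fs Ux.
have dp := partial_powR (r - 1) df (f0 Ux).
have dX := smooth_on_derivable k (grad_smooth Uo Gs Gpos fs k) Ux.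
have P : partial k (fun y => local_grad G p y 0 k) x =
    c * (r * f x `^ (r - 1)) * partial k (fun y => local_grad G f y 0 k) x +
    c * (r * (r - 1) * f x `^ (r - 1 - 1)) *
      (local_grad G f x 0 k * partial k f x).
  rewrite (@partial_ext _ _ U _
    (fun y => (c * r) * (f y `^ (r - 1) * local_grad G f y 0 k)) _ _ Uo _ Ux).
    have dq := dp.(ex_derive).
    rewrite (partialZ _ (derivable_mul dq dX)) (partialM dq dX).
    by rewrite (is_derive_partial dp); ring.
  by move=> y; rewrite inE => Uy; rewrite (grad_cpowR _ Uy); ring.
by rewrite P (grad_cpowR _ Ux); ring.
Qed.

End ChartLaplacian.

(** * Extension by zero, and Green's formula in a chart *)

Section ZeroExtension.
Variables (R : realType) (n : nat) (U K : set 'rV[R]_n).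
Hypotheses (Uo : open U) (Kc : closed K) (KU : K `<=` U).

(** A point outside [U], even on its boundary, has a neighbourhood avoiding the closed set [K], and
    there the extension vanishes. Hence extending by zero creates no singularity. *)
Lemma near_zero_ext (phi : 'rV[R]_n -> R) x :
  (forall y, U y -> ~ K y -> phi y = 0) -> ~ U x ->
  \forall y \near x, (phi \_ U) y = 0.
Proof.
move=> phi0 Ux; have Kx : (~` K) x by move=> /KU.
have : \forall y \near x, (~` K) y.
  by apply: open_nbhs_nbhs; split => //; exact: closed_openC.
apply: filterS => y Ky; rewrite patchE; case: ifPn => //.
by rewrite inE => Uy; exact: phi0.
Qed.

Lemma near_patch (phi : 'rV[R]_n -> R) x : U x ->
  \forall y \near x, phi y = (phi \_ U) y.
Proof.
by move=> Ux; apply: (near_open Uo Ux) => y Uy; rewrite patchE mem_set.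
Qed.

Lemma partial_zero_ext (phi : 'rV[R]_n -> R) k :
  (forall y, U y -> ~ K y -> phi y = 0) ->
  partial k (phi \_ U) = (partial k phi) \_ U.
Proof.
move=> phi0; apply/funext => x; rewrite [RHS]patchE; case: ifPn.
  by rewrite inE => Ux; apply: near_eq_derive; apply: filterS (near_patch phi Ux) => y ->.
rewrite notin_setE => Ux.
rewrite -[RHS](partial_cst (0 : R) x k); apply: near_eq_derive.
exact: near_zero_ext.
Qed.

Lemma Ck_zero_ext N (phi : 'rV[R]_n -> R) : Ck U N phi ->
  (forall y, U y -> ~ K y -> phi y = 0) -> Ck setT N (phi \_ U).
Proof.
have cont (f : 'rV[R]_n -> R) : (forall y, U y -> ~ K y -> f y = 0) ->
    (forall x, U x -> {for x, continuous f}) ->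
    forall x, {for x, continuous (f \_ U)}.
  move=> f0 cf x; have [Ux|Ux] := pselect (U x).
    have E := near_patch f Ux.
    rewrite /prop_for /continuous_at -(nbhs_singleton E).
    exact: cvg_trans (near_eq_cvg E) (cf x Ux).
  have E := near_zero_ext f0 Ux.
  rewrite /prop_for /continuous_at (nbhs_singleton E).
  have E' : {near x, (fun=> 0) =1 f \_ U} by apply: filterS E => y ->.
  exact: cvg_trans (near_eq_cvg E') (cvg_cst _).
elim: N phi => [|N IH] phi Cphi phi0.
  by apply/Ck0P => x _; apply: cont => // y; exact: Ck_continuous Cphi.
have [cphi dphi pphi] := (CkSP _ _ _).1 Cphi.
apply/CkSP; split.
- by move=> x _; exact: cont.
- move=> k x _; have [Ux|Ux] := pselect (U x).
    exact: near_eq_derivable (near_patch phi Ux) (dphi k x Ux).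
  have E := near_zero_ext phi0 Ux.
  have E' : {near x, (fun=> 0) =1 phi \_ U} by apply: filterS E => y ->.
  exact: near_eq_derivable E' (derivable_cst _ _ _).
(* The complement of [K] in [U] is open, so the partials vanish there too and the induction
   hypothesis applies to them. *)
- move=> k; rewrite partial_zero_ext//; apply: IH => // y Uy Ky.
  rewrite -(partial_cst 0 y k); apply: near_eq_derive.
  have : \forall z \near y, (U `&` ~` K) z.
    apply: open_nbhs_nbhs; split => //.
    by apply: openI => //; exact: closed_openC.
  by apply: filterS => z [Uz Kz]; exact: phi0.
Qed.

Lemma csupp_zero_ext r (phi : 'rV[R]_n -> R) : Ck U 0 phi ->
  (forall y, U y -> ~ K y -> phi y = 0) -> (forall x, K x -> `|x| <= r) ->
  csupp r (phi \_ U).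
Proof.
move=> Cphi phi0 Kr; split; first by apply/contT; exact: Ck_zero_ext.
move=> x rx; rewrite patchE; case: ifPn => //; rewrite inE => Ux.
by apply: phi0 => // /Kr; rewrite leNgt rx.
Qed.

End ZeroExtension.

Lemma integral_rV_sum (R : realType) n r (I : Type) (s : seq I)
    (F : I -> 'rV[R]_n -> R) : (forall i, csupp r (F i)) ->
  csupp r (fun x => \sum_(i <- s) F i x) /\
  integral_rV (fun x => \sum_(i <- s) F i x) = \sum_(i <- s) integral_rV (F i).
Proof.
move=> cF; elim: s => [|i s [IH1 IH2]].
  rewrite big_nil; under eq_fun do rewrite big_nil.
  by split; [exact: csupp_cst0|exact: integral_rV0].
have E : (fun x => \sum_(j <- i :: s) F j x) =
    (fun x => 1 * F i x + \sum_(j <- s) F j x).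
  by apply/funext => x; rewrite big_cons mul1r.
rewrite E big_cons; split; first exact: csupp_lin.
by rewrite (integral_rV_lin 1 (cF i) IH1) IH2 mul1r.
Qed.

Section ChartGreen.
Variables (R : realType) (n : nat) (U : set 'rV[R]_n) (G : 'rV[R]_n -> 'M[R]_n).
Hypothesis Uo : open U.
Hypothesis Gs : forall i j, smooth_on U (fun x => G x i j).
Hypothesis Gsym : forall x, U x -> (G x)^T = G x.
Hypothesis Gpos : forall x, U x -> forall w : 'rV[R]_n, w != 0 ->
  0 < (w *m G x *m w^T) 0 0.

(** Multiplied by the density, the integrand is the sum of the partials of [h * sqrt (det G) * X^k],
    with [X] the gradient of [f]; these fields are extended by zero to R^n. *)
Lemma green_chart K (f h : 'rV[R]_n -> R) : compact K -> K `<=` U ->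
  smooth_on U f -> Ck U 1 h -> (forall y, U y -> ~ K y -> h y = 0) ->
  integral_rV ((fun x => (h x * local_laplacian G f x + local_inner G f h x)
                  * Num.sqrt (\det (G x))) \_ U) = 0.
Proof.
move=> cK KU fs Ch h0.
have Kcl : closed K by apply: compact_closed => //; exact: norm_hausdorff.
have [r [r0 Kr]] : exists r, 0 <= r /\ forall x, K x -> `|x| <= r.
  have [M [_ KM]] := compact_bounded cK.
  exists (`|M| + 1); split; first by rewrite addr_ge0.
  by move=> x Kx; apply: (KM _ _ x Kx); rewrite ltr_pwDr// ler_norm.
pose q x := Num.sqrt (\det (G x)).
have qs : smooth_on U q := sqrtG_smooth Uo Gs Gpos.
pose X k x := local_grad G f x 0 k.
have Xs k : smooth_on U (X k) := grad_smooth Uo Gs Gpos fs k.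
have qXs k : smooth_on U (fun x => q x * X k x) := smooth_onM Uo qs (Xs k).
pose F k x := h x * (q x * X k x).
have CF k : Ck U 1 (F k) := CkM Uo Ch (smooth_on_C1 (qXs k)).
have F0 k y : U y -> ~ K y -> F k y = 0.
  by move=> Uy Ky; rewrite /F h0// mul0r.
have cFU k : csupp r (F k \_ U) := csupp_zero_ext Uo Kcl KU (CkS (CF k)) (F0 k) Kr.
have CFU k : Ck setT 1 (F k \_ U) := Ck_zero_ext Uo Kcl KU (CF k) (F0 k).
have -> : (fun x => (h x * local_laplacian G f x + local_inner G f h x) * q x) \_ U
    = (fun x => \sum_k partial k (F k \_ U) x).
  have PZ k := @partial_zero_ext R n U K Uo Kcl KU (F k) k (F0 k).
  apply/funext => x; under eq_bigr do rewrite PZ patchE.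
  rewrite patchE; case: ifPn => [|_]; last by rewrite big1.
  rewrite inE => Ux.
  have dF k := partialM (Ck_derivable (k := k) Ch Ux) (smooth_on_derivable k (qXs k) Ux).
  under eq_bigr do rewrite dF.
  have q0 : 0 < q x := sqrtG_gt0 Gpos Ux.
  rewrite big_split -mulr_sumr mulrDl; congr (_ + _).
    rewrite -mulrA; congr (_ * _); rewrite /local_laplacian -/(q x) mulrAC mulVf ?mul1r//.
    by rewrite gt_eqF.
  by rewrite /local_inner mulr_suml; apply: eq_bigr => k _; rewrite -/(X k x); ring.
rewrite (integral_rV_sum _ (fun k => csupp_partial k (cFU k) (CFU k))).2.
by rewrite big1// => k _; exact: integral_rV_partial (cFU k) (CFU k).
Qed.

End ChartGreen.

(** * Functions on the manifold *)

Local Notation coord := Defs.coord.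

(** * Cut-off functions and partitions of unity *)

Section Bump.
Variable R : realType.

(** The squared positive part is the source of all cut-offs: its derivative, twice the positive
    part, is continuous. At 0 the difference quotient is at most [|h|] in absolute value. *)
Lemma is_derive_sqr_pos (t : R) :
  is_derive t 1 (fun s : R => Num.max 0 s ^+ 2) (2 * Num.max 0 t).
Proof.
have [t0|t0|->] := ltgtP t 0.
- apply: (@near_eq_is_derive _ _ _ (fun=> 0)).
    near=> s; rewrite max_l ?expr0n//; apply: ltW; near: s; exact: lt_nbhsl.
  by rewrite mulr0; exact: is_derive_cst.
- apply: (@near_eq_is_derive _ _ _ (fun s : R => s ^+ 2)).
    near=> s; rewrite max_r//; apply: ltW; near: s; exact: lt_nbhsr.
  split; first exact: exprn_derivable.
  by rewrite exp_derive expr1 [_ *: 1]mulr1.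
- rewrite mulr0; apply: cvg_is_derive.
  apply/cvgrPdist_le => e e0; near=> h.
  rewrite addr0 maxxx expr0n subr0 sub0r normrN normrM.
  have h0 : h != 0 by near: h; exact: nbhs_dnbhs_neq.
  have he : `|h| <= e by near: h; exact: dnbhs0_le.
  have [hle|hgt] := leP h 0; first by rewrite expr0n normr0 mulr0 ltW.
  by rewrite expr2 normrM mulrA -normrM mulVf// normr1 mul1r.
Unshelve. all: by end_near. Qed.

Variable n : nat.

Lemma C1_sqr_pos (U : set 'rV[R]_n) f : open U -> Ck U 1 f ->
  Ck U 1 (fun y => Num.max 0 (f y) ^+ 2).
Proof.
move=> Uo Cf.
have D k y : U y -> is_derive y (delta_mx 0 k) (fun y => Num.max 0 (f y) ^+ 2)
    (2 * Num.max 0 (f y) * partial k f y).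
  move=> Uy.
  exact: (is_derive_comp1 (Ck_derivable (k := k) Cf Uy) (is_derive_sqr_pos (f y))).
have C0 : Ck U 0 (fun y => Num.max 0 (f y)).
  apply/Ck0P => y Uy; apply: (@continuous_comp _ _ _ f (fun s => Num.max 0 s)).
    exact: Ck_continuous Cf Uy.
  by apply: continuous_max; [exact: cvg_cst|exact: cvg_id].
apply/CkSP; split.
- by move=> y Uy; exact: (Ck_continuous (CkM Uo C0 C0) Uy).
- by move=> k y /(D k)[].
- move=> k; apply: (@Ck_ext _ _ _ _ (fun y => 2 * Num.max 0 (f y) * partial k f y)) => //.
    by move=> y; rewrite inE => /(D k)/is_derive_partial->.
  by apply: (CkM Uo); [exact: CkZ|exact: Ck_partial].
Qed.

(** The norm on rows is the sup norm, which is not smooth. [q] uses the Euclidean square instead,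
    which dominates the square of the sup norm, so [q] is negative beyond sup distance [d]. *)
Lemma bump_rV (x0 : 'rV[R]_n) (d : R) : 0 < d ->
  exists b : 'rV[R]_n -> R, [/\ Ck setT 1 b, forall y, 0 <= b y, 0 < b x0 &
    forall y, d < `|y - x0| -> b y = 0].
Proof.
move=> d0; pose q (y : 'rV[R]_n) := d ^+ 2 - \sum_k (y 0 k - x0 0 k) * (y 0 k - x0 0 k).
have Cq : Ck setT 1 q.
  apply: (CkB openT); first exact: Ck_cst.
  apply: (@Ck_sum R n setT 1 _ _ xpredT
    (fun k y => (y 0 k - x0 0 k) * (y 0 k - x0 0 k))) => [|k _]; first exact: openT.
  by apply: (CkM openT); apply: (CkB openT); [exact: Ck_coord|exact: Ck_cst|
    exact: Ck_coord|exact: Ck_cst].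
exists (fun y => Num.max 0 (q y) ^+ 2); split.
- exact: C1_sqr_pos openT Cq.
- by move=> y; exact: sqr_ge0.
- rewrite /q big1 ?subr0; last by move=> k _; rewrite subrr mul0r.
  by rewrite max_r ?exprn_gt0// ltW// exprn_gt0.
- move=> y dy; rewrite max_l ?expr0n//.
  have [k dk] : exists k, d < `|(y - x0) 0 k|.
    apply/existsP; move: dy; apply: contraTT => /existsPn dk; rewrite -leNgt.
    by apply: mx_norm_le; [exact: ltW|move=> i j; rewrite (ord1 i) leNgt; exact: dk].
  rewrite /q subr_le0 (bigD1 k)//= -expr2 -[in leRHS]real_normK ?num_real//.
  rewrite ler_wpDr//; first by apply: sumr_ge0 => j _; rewrite -expr2 sqr_ge0.
  by rewrite ler_sqr ?nnegrE ?normr_ge0 ?(ltW d0)//; apply: ltW; move: dk; rewrite !mxE.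
Qed.

Lemma Ck_local (U : set 'rV[R]_n) N f :
  (forall x, U x -> exists V, [/\ open V, V x & Ck V N f]) -> Ck U N f.
Proof.
elim: N f => [|N IH] f H.
  by apply/Ck0P => x /H[V [_ Vx Cf]]; exact: Ck_continuous Cf Vx.
apply/CkSP; split.
- by move=> x /H[V [_ Vx Cf]]; exact: Ck_continuous Cf Vx.
- by move=> k x /H[V [_ Vx Cf]]; exact: Ck_derivable Cf Vx.
- move=> k; apply: IH => x /H[V [Vo Vx Cf]]; exists V; split => //.
  exact: Ck_partial.
Qed.

End Bump.

Section Manifold.
Variables (R : realType) (n : nat) (M : ptopologicalType).
Hypotheses (M_hausdorff : hausdorff_space M) (M_compact : compact [set: M]).
Variable A : atlas R n M.
Implicit Types (i j : idx A) (f h : M -> R) (p q : M).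

Lemma cod_coord i p : dom i p -> cod i (coord i p).
Proof. by move=> ip; exists p. Qed.

Lemma dom_param i x : cod i x -> dom i (param i x).
Proof. by move=> [p ip <-]; rewrite coordK. Qed.

Lemma paramK i x : cod i x -> coord i (param i x) = x.
Proof. by move=> [p ip <-]; rewrite coordK. Qed.

Lemma cod_isopen i : open (cod i).
Proof. exact: cod_open. Qed.

Definition cod_pre i (V : set M) : set 'rV[R]_n := [set x | cod i x /\ V (param i x)].

Lemma cod_pre_open i V : open V -> open (cod_pre i V).
Proof.
move=> Vo; rewrite openE => x [ix Vx]; apply: filterI.
  by apply: open_nbhs_nbhs; split => //; exact: cod_isopen.
by apply: (param_continuous ix); apply: open_nbhs_nbhs.
Qed.

Lemma cod_preE i V : V `<=` dom i -> coord i @` V = cod_pre i V.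
Proof.
move=> Vi; apply/seteqP; split => [_ [p Vp <-]|x [ix Vx]].
  by split; [exact: cod_coord (Vi _ Vp)|rewrite coordK//; exact: Vi].
by exists (param i x) => //; exact: paramK.
Qed.

Definition CkA N f := forall i, Ck (cod i) N (f \o param i).

Lemma CkA_continuous f : CkA 0 f -> continuous f.
Proof.
move=> Cf p; pose i := chart_at A p; have ip : dom i p := dom_chart_at A p.
have cf : {for p, continuous (f \o param i \o coord i)}.
  apply: continuous_comp; first exact: Defs.coord_continuous ip.
  exact: Ck_continuous (Cf i) (cod_coord ip).
have E : {near p, f \o param i \o coord i =1 f}.
  have : \forall q \near p, dom i q.
    by apply: open_nbhs_nbhs; split => //; exact: dom_open.
  by apply: filterS => q iq /=; rewrite coordK.
rewrite /continuous_at -(nbhs_singleton E).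
exact: cvg_trans (near_eq_cvg E) cf.
Qed.

Definition overlap i j := coord i @` (dom i `&` dom j).

Lemma overlapE i j : overlap i j = cod_pre i (dom i `&` dom j).
Proof. by rewrite /overlap cod_preE// => p []. Qed.

Lemma overlap_open i j : open (overlap i j).
Proof. by rewrite overlapE; apply: cod_pre_open; apply: openI; exact: dom_open. Qed.

Lemma overlapP i j x : overlap i j x <-> cod i x /\ dom j (param i x).
Proof.
rewrite overlapE; split => [[ix []]//|[ix jx]].
by split => //; split => //; exact: dom_param.
Qed.

Lemma transition_Ck N i j k :
  Ck (overlap i j) N (fun x => coord j (param i x) 0 k).
Proof. by move: N; apply/smooth_onP; exact: transition_smooth. Qed.

Lemma C1_transition i j (b : 'rV[R]_n -> R) : Ck (cod j) 1 b ->
  Ck (overlap i j) 1 (fun x => b (coord j (param i x))).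
Proof.
move=> Cb; apply: (@C1_comp _ _ _ _ (cod j) (fun x => coord j (param i x)) b) => //.
- exact: overlap_open.
- exact: cod_isopen.
- by move=> x /overlapP[_ jx]; exact: cod_coord.
- by move=> c; exact: transition_Ck.
Qed.

(** A bump in the coordinates of chart [i] is extended by zero. Seen from another chart, a point
    either lies in the overlap, where a transition map intervenes, or has a neighbourhood off [K]:
    the compact set [K] is closed because [M] is Hausdorff. *)
Lemma bump_exists i p (V : set M) : open V -> V `<=` dom i -> V p ->
  exists r : M -> R, [/\ CkA 1 r, forall q, 0 <= r q, 0 < r p &
    exists K, [/\ compact K, K `<=` V & forall q, ~ K q -> r q = 0]].
Proof.
move=> Vo Vi Vp; set x0 := coord i p; have ip : dom i p := Vi p Vp.
have /nbhs_ballP[d /= d0 dV] : nbhs x0 (cod_pre i V).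
  apply: open_nbhs_nbhs; split; first exact: cod_pre_open.
  by split; [exact: cod_coord|rewrite coordK].
have d2 : 0 < d / 2 by rewrite divr_gt0.
have [b [Cb b0 bx b1]] := bump_rV x0 d2.
pose Kb := [set y : 'rV[R]_n | `|y - x0| <= d / 2].
have KbV y : Kb y -> cod_pre i V y.
  move=> yd; apply: dV; rewrite -ball_normE /= distrC; apply: le_lt_trans yd _.
  by rewrite ltr_pdivrMr// ltr_pMr// ltr1n.
have cKb : compact Kb.
  apply: bounded_closed_compact.
    exists (d / 2 + `|x0|); split; first exact: num_real.
    move=> N dN y /= yd; apply: le_trans (ltW dN).
    by rewrite -[y](subrK x0) (le_trans (ler_normD _ _))// lerD2r.
  apply: (@preimage_closed _ _ (fun y : 'rV[R]_n => `|y - x0|) [set t | t <= d / 2]).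
    move=> y _.
    have c1 : (fun z : 'rV[R]_n => z) z @[z --> y] --> y by exact: cvg_id.
    have c2 : (fun _ : 'rV[R]_n => x0) z @[z --> y] --> x0.
      exact: (@cst_continuous _ _ x0 y).
    exact: (cvg_norm (cvgB c1 c2)).
  exact: closed_le.
pose K := param i @` Kb.
have cK : compact K.
  apply: continuous_compact cKb; apply: continuous_in_subspaceT => y.
  by rewrite inE => /KbV[iy _]; exact: param_continuous.
have KV : K `<=` V by move=> _ [y /KbV[_ Vy] <-].
have Kcl : closed K by exact: compact_closed.
pose r := (fun q => b (coord i q)) \_ (dom i).
have rK q : ~ K q -> r q = 0.
  move=> Kq; rewrite /r patchE; case: ifPn => //; rewrite inE => iq.
  apply: b1; rewrite ltNge; apply/negP => yd; apply: Kq.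
  by exists (coord i q) => //; rewrite coordK.
exists r; split.
- move=> j; apply: Ck_local => x jx.
  have [ix|ix] := pselect (dom i (param j x)).
    exists (overlap j i); split; [exact: overlap_open|exact/overlapP|].
    have CT : Ck (overlap j i) 1 (fun y => b (coord i (param j y))).
      by apply: C1_transition; exact: Ck_subset Cb.
    apply: (Ck_ext (@overlap_open j i) _ CT).
    by move=> y; rewrite inE => /overlapP[_ iy] /=; rewrite /r patchE mem_set.
  exists (cod_pre j (~` K)); split.
  + by apply: cod_pre_open; exact: closed_openC.
  + by split => // /KV/Vi.
  + apply: Ck_ext (Ck_cst _ _ 0).
      by apply: cod_pre_open; exact: closed_openC.
    by move=> y; rewrite inE => -[_ Ky] /=; rewrite rK.
- by move=> q; rewrite /r patchE; case: ifP.
- by rewrite /r patchE mem_set.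
- by exists K.
Qed.

Lemma CkA_open_gt0 f : CkA 0 f -> open [set q | 0 < f q].
Proof.
move=> /CkA_continuous cf.
by apply: (open_comp (f := f) (D := [set t : R | 0 < t])); [move=> q _; exact: cf|exact: open_gt].
Qed.

(** A compact [K] stands in for the closure of the nonzero set: multiplying by another function
    keeps the same [K], and [supported_closure] recovers the closure. *)
Definition supported_in f (V : set M) :=
  exists K, [/\ compact K, K `<=` V & forall q, ~ K q -> f q = 0].

(** The finite sum [sg] is positive everywhere by compactness. All bumps are divided by it,
    including those whose index is not in [s], so regularity and support hold for every index. *)
Lemma partition_of_unity : exists (s : seq M) (th : M -> M -> R),
  (forall p, [/\ CkA 1 (th p), forall q, 0 <= th p q &
                supported_in (th p) (dom (chart_at A p))]) /\
  (forall q, \sum_(p <- s) th p q = 1).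
Proof.
have bp p : exists r : M -> R, [/\ CkA 1 r, forall q, 0 <= r q, 0 < r p &
    supported_in r (dom (chart_at A p))].
  exact: (bump_exists (dom_open _) (fun q => id) (dom_chart_at A p)).
have [rho rhoP] := choice bp.
have := M_compact; rewrite compact_cover => /(_ M setT (fun p => [set q | 0 < rho p q])).
case.
- by move=> p _; apply: CkA_open_gt0 => i; have [Cr _ _ _] := rhoP p; exact: CkS.
- by move=> p _; exists p => //; have [_ _ + _] := rhoP p.
move=> D _ Dcov; pose s := finmap.enum_fset D.
pose sg q := \sum_(p <- s) rho p q.
have sg0 q : 0 < sg q.
  have [p /= pD pq] := Dcov q I.
  rewrite /sg (big_rem p)//= ltr_wpDr//.
  by apply: sumr_ge0 => p' _; have [_ + _ _] := rhoP p'; exact.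
exists s, (fun p q => rho p q * sg q `^ (-1)); split=> [p|q].
- have [Cr r0 _ [K [cK Ki rK]]] := rhoP p; split.
  + move=> i; apply: (CkM (@cod_isopen i)); first exact: Cr.
    apply: (Ck_powR _ (@cod_isopen i)); last by move=> x _; exact: sg0.
    apply: (@Ck_sum _ _ (cod i) 1 _ _ xpredT (fun p' x => rho p' (param i x))) => [|p' _].
      exact: cod_isopen.
    by have [+ _ _ _] := rhoP p'; exact.
  + by move=> q; rewrite mulr_ge0// powR_ge0.
  + by exists K; split => // q /rK->; rewrite mul0r.
- by rewrite -mulr_suml -/(sg q) powR_inv1 ?(ltW (sg0 q))// mulfV// gt_eqF.
Qed.

End Manifold.

(** * Products of gradients on the manifold *)

Section Inner.
Variables (R : realType) (n : nat) (M : ptopologicalType).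
Variables (A : atlas R n M) (g : metric A).
Implicit Types (i j : idx A) (f h : M -> R) (p q : M).

Definition gradrow (f : 'rV[R]_n -> R) x : 'rV[R]_n := \row_k partial k f x.

Lemma local_inner_mx (G : 'rV[R]_n -> 'M[R]_n) (f h : 'rV[R]_n -> R) x :
  local_inner G f h x = (gradrow h x *m invmx (G x) *m (gradrow f x)^T) 0 0.
Proof.
rewrite mxE /local_inner.
under eq_bigr do rewrite gradE mulr_suml.
rewrite exchange_big; apply: eq_bigr => l _; rewrite !mxE mulr_suml.
by apply: eq_bigr => k _; rewrite !mxE; ring.
Qed.

Definition jacobian_mx i j x : 'M[R]_n :=
  \matrix_(k, c) partial k (transition i j c) x.

Lemma gradrow_transition f i j x : Ck (cod j) 1 (f \o param j) ->
  overlap i j x -> gradrow (f \o param i) x =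
    gradrow (f \o param j) (coord j (param i x)) *m (jacobian_mx i j x)^T.
Proof.
move=> Cf ox; have /overlapP[ix jx] := ox.
apply/rowP => k; rewrite mxE [RHS]mxE.
have D := @partial_comp R n n (cod j) (fun y => coord j (param i y))
  (f \o param j) x k (@cod_isopen _ _ _ A j) Cf (cod_coord jx)
  (fun c => Ck_derivable (transition_Ck 1 i j c) ox).
rewrite (@partial_ext _ _ (overlap i j) _
  ((f \o param j) \o (fun y => coord j (param i y))) _ _ _ _ ox); last 2 first.
- exact: overlap_open.
- by move=> y; rewrite inE => /overlapP[_ jy] /=; rewrite coordK.
rewrite (is_derive_partial D); apply: eq_bigr => c _.
by rewrite !mxE mulrC.
Qed.

Lemma gmx_jacobian i j p : dom i p -> dom j p ->
  gmx g i (coord i p) = jacobian_mx i j (coord i p) *m gmx g j (coord j p) *m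
    (jacobian_mx i j (coord i p))^T.
Proof.
move=> ip jp; apply/matrixP => k l; rewrite (gmx_transition g ip jp) exchange_big mxE.
apply: eq_bigr => d _; rewrite mxE mulr_suml; apply: eq_bigr => c _.
by rewrite !mxE; ring.
Qed.

Lemma gmx_unit i x : cod i x -> gmx g i x \in unitmx.
Proof. by move=> ix; apply: posdef_unitmx; exact: gmx_pos. Qed.

(** The invertibility of the Jacobian [J] is read off from that of the congruent Gram matrix,
    without the reverse transition map. *)
Lemma congruence_inverse (J B : 'M[R]_n) : B \in unitmx ->
  J *m B *m J^T \in unitmx -> J^T *m invmx (J *m B *m J^T) *m J = invmx B.
Proof.
move=> uB uJBJ; have := uJBJ; rewrite !unitmx_mul => /andP[/andP[uJ _] _].
apply: (can_inj (mulKmx uB)); rewrite mulmxV//.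
apply: (can_inj (mulKmx uJ)); rewrite mulmx1 !mulmxA.
by rewrite mulmxV// mul1mx.
Qed.

Lemma local_inner_transition f h i j p : CkA A 1 f -> CkA A 1 h ->
  dom i p -> dom j p ->
  local_inner (gmx g i) (f \o param i) (h \o param i) (coord i p) =
  local_inner (gmx g j) (f \o param j) (h \o param j) (coord j p).
Proof.
move=> Cf Ch ip jp; have ox : overlap i j (coord i p) by exists p.
rewrite !local_inner_mx (gradrow_transition (Cf j) ox) (gradrow_transition (Ch j) ox).
rewrite coordK// (gmx_jacobian ip jp) trmx_mul trmxK.
rewrite -[invmx (gmx g j (coord j p))](@congruence_inverse (jacobian_mx i j (coord i p))).
- by rewrite !mulmxA.
- exact: gmx_unit (cod_coord jp).
- rewrite -gmx_jacobian//; exact: gmx_unit (cod_coord ip).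
Qed.

Definition inner f h p := local_inner (gmx g (chart_at A p))
  (f \o param (chart_at A p)) (h \o param (chart_at A p)) (coord (chart_at A p) p).

Lemma inner_chart f h i p : CkA A 1 f -> CkA A 1 h -> dom i p ->
  inner f h p = local_inner (gmx g i) (f \o param i) (h \o param i) (coord i p).
Proof. by move=> Cf Ch ip; apply: local_inner_transition => //; exact: dom_chart_at. Qed.

Lemma inner_param f h i x : CkA A 1 f -> CkA A 1 h -> cod i x ->
  inner f h (param i x) = local_inner (gmx g i) (f \o param i) (h \o param i) x.
Proof.
by move=> Cf Ch ix; rewrite (inner_chart Cf Ch (dom_param ix)) paramK.
Qed.

Definition smoothM f := forall i, smooth_on (cod i) (f \o param i).

Lemma smoothM_Ck N f : smoothM f -> CkA A N f.
Proof. by move=> sf i; move: N; apply/smooth_onP; exact: sf. Qed.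

Lemma smoothM_continuous f : smoothM f -> continuous f.
Proof. by move=> /(@smoothM_Ck 0)/CkA_continuous. Qed.

Lemma smoothM_inner f h : smoothM f -> smoothM h -> smoothM (inner f h).
Proof.
move=> sf sh i.
apply: (@smooth_on_ext _ _ _ (@cod_isopen _ _ _ A i)
  (local_inner (gmx g i) (f \o param i) (h \o param i))).
  by move=> x; rewrite inE => ix /=; rewrite inner_param//; exact: smoothM_Ck.
apply: (local_inner_smooth (@cod_isopen _ _ _ A i) _ _ (sf i) (sh i)).
- exact: gmx_smooth.
- exact: gmx_pos.
Qed.

Lemma innerC f h p : CkA A 1 f -> CkA A 1 h -> inner f h p = inner h f p.
Proof.
move=> Cf Ch; apply: (@local_innerC _ _ (cod (chart_at A p))).
  by move=> x; exact: gmx_sym.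
exact: cod_coord (dom_chart_at A p).
Qed.

Lemma innerM f h1 h2 p : CkA A 1 h1 -> CkA A 1 h2 ->
  inner f (fun q => h1 q * h2 q) p = h1 p * inner f h2 p + h2 p * inner f h1 p.
Proof.
move=> C1 C2; rewrite /inner /local_inner !mulr_sumr -big_split.
apply: eq_bigr => k _ /=; set i := chart_at A p.
have ix : cod i (coord i p) := cod_coord (dom_chart_at A p).
have P := partialM (Ck_derivable (k := k) (C1 i) ix) (Ck_derivable (k := k) (C2 i) ix).
rewrite [X in _ * X]P /= coordK; last exact: dom_chart_at.
ring.
Qed.

Lemma inner_sum f (I : Type) (s : seq I) (h : I -> M -> R) p :
  (forall a, CkA A 1 (h a)) ->
  inner f (fun q => \sum_(a <- s) h a q) p = \sum_(a <- s) inner f (h a) p.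
Proof.
move=> Ch; rewrite /inner /local_inner exchange_big; apply: eq_bigr => k _ /=.
set i := chart_at A p.
have ix : cod i (coord i p) := cod_coord (dom_chart_at A p).
have dh a := Ck_derivable (k := k) (Ch a i) ix.
by rewrite [X in _ * X](partial_sum s dh) mulr_sumr.
Qed.

End Inner.

(** * Integration against the Riemannian measure *)

Section Functional.
Variables (R : realType) (n : nat) (M : ptopologicalType).
Hypotheses (M_hausdorff : hausdorff_space M) (M_compact : compact [set: M]).
Variables (A : atlas R n M) (g : metric A).
Variables (mu : {measure set (borel M) -> \bar R}) (mu_g : riemannian_measure g mu).
Implicit Types (i j : idx A) (f h : M -> R) (p q : M).

Definition L f := \int[mu]_p f p.

Lemma continuous_measurableM f : continuous f ->
  measurable_fun [set: borel M] (f : borel M -> R).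
Proof.
move=> /continuousP cf; apply: (measurability _ (RGenOpens.measurableE R)).
move=> _ [_ [a [b ->] <-]]; rewrite setTI; apply: sub_sigma_algebra.
exact/cf/interval_open.
Qed.

Lemma supported_closure f i : supported_in f (dom i) ->
  compact (closure [set p | f p != 0]) /\ closure [set p | f p != 0] `<=` dom i.
Proof.
move=> [K [cK Ki fK]].
have Kcl : closed K by exact: compact_closed.
have sK : closure [set p | f p != 0] `<=` K.
  rewrite [X in _ `<=` X]((closure_id K).1 Kcl); apply: closure_subset => p /= fp.
  by apply: contrapT => /fK fp0; rewrite fp0 eqxx in fp.
split; last by move=> p /sK/Ki.
by apply: subclosed_compact cK sK; exact: closed_closure.
Qed.

Lemma mu_chart f i : continuous f -> supported_in f (dom i) ->
  (\int[mu]_p (f p)%:E)%E = (integral_rV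
    ((fun x => f (param i x) * Num.sqrt (\det (gmx g i x))) \_ (cod i)))%:E.
Proof. by move=> cf /supported_closure[c1 c2]; exact: mu_g. Qed.

(** The total mass is the sum of the integrals of a partition of unity, each a real number by the
    chart formula. Nonnegativity allows exchanging sum and integral before any integrability is
    known. *)
Lemma mu_finite : (mu [set: borel M] < +oo)%E.
Proof.
have [s [th [thP th1]]] := partition_of_unity M_hausdorff M_compact A.
rewrite -[mu _]mul1e -integral_cst//.
rewrite (_ : (\int[mu]_p 1)%E = (\int[mu]_p (\sum_(a <- s) (th a p)%:E))%E); last first.
  by apply: eq_integral => p _; rewrite sumEFin th1.
rewrite ge0_integral_sum//.
- apply: lte_sum_pinfty => a _; have [C1 _ sup] := thP a.
  rewrite (@mu_chart _ (chart_at A a))// ?ltry//.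
  by apply: (@CkA_continuous _ _ _ A) => i; exact: CkS (C1 i).
- move=> a; have [C1 _ _] := thP a.
  have cth : continuous (th a).
    by apply: (@CkA_continuous _ _ _ A) => i; exact: CkS (C1 i).
  by have /measurable_EFinP := continuous_measurableM cth.
- by move=> a p _; rewrite lee_fin; have [_ + _] := thP a.
Qed.

Lemma continuous_bounded f : continuous f -> exists B, forall p, `|f p| <= B.
Proof.
move=> cf; have cK : compact (f @` setT).
  by apply: continuous_compact M_compact; exact: continuous_subspaceT.
have [N [_ BN]] := compact_bounded cK.
exists (`|N| + 1) => p; apply: (BN (`|N| + 1)); last by exists p.
by rewrite ltr_pwDr// ler_norm.
Qed.

Lemma continuous_integrable f : continuous f -> mu.-integrable setT (EFin \o f).
Proof.
move=> cf; apply: measurable_bounded_integrable => //.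
- exact: mu_finite.
- exact: continuous_measurableM.
- have [B fB] := continuous_bounded cf.
  exists B; split; first exact: num_real.
  by move=> N BN p _; apply: le_trans (fB p) _; exact: ltW.
Qed.

Lemma L_ext f h : f =1 h -> L f = L h.
Proof. by move=> fh; apply: eq_Rintegral => p _; exact: fh. Qed.

Lemma LD f h : continuous f -> continuous h -> L (fun p => f p + h p) = L f + L h.
Proof. by move=> cf ch; apply: RintegralD => //; exact: continuous_integrable. Qed.

Lemma LZ c f : continuous f -> L (fun p => c * f p) = c * L f.
Proof. by move=> cf; apply: RintegralZl => //; exact: continuous_integrable. Qed.

Lemma L_sum (I : Type) (s : seq I) (f : I -> M -> R) : (forall a, continuous (f a)) ->
  continuous (fun p => \sum_(a <- s) f a p) /\
  L (fun p => \sum_(a <- s) f a p) = \sum_(a <- s) L (f a).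
Proof.
move=> cf; elim: s => [|a s [IH1 IH2]].
  have E : (fun p => \sum_(a <- [::]) f a p) = (fun=> 0).
    by apply/funext => p; rewrite big_nil.
  have c0 : continuous (fun _ : M => 0 : R) by move=> p; exact: cvg_cst.
  rewrite E big_nil; split => //.
  by rewrite /L Rintegral_cst// mul0r.
have E : (fun p => \sum_(b <- a :: s) f b p) = (fun p => f a p + \sum_(b <- s) f b p).
  by apply/funext => p; rewrite big_cons.
rewrite E big_cons; split; last by rewrite LD// IH2.
by move=> p; exact: (cvgD (cf a p) (IH1 p)).
Qed.

Lemma L_bound f B : continuous f -> (forall p, `|f p| <= B) ->
  `|L f| <= B * fine (mu setT).
Proof.
move=> cf fB; apply: le_trans (le_normr_Rintegral _ (continuous_integrable cf)) _ => //.
rewrite -Rintegral_cst//; apply: le_Rintegral => //.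
- have := integrable_norm (continuous_integrable cf); apply: eq_integrable => //.
- exact: (continuous_integrable (f := fun=> B) (fun p => cvg_cst _)).
Qed.

Lemma L_chart f i : continuous f -> supported_in f (dom i) ->
  L f = integral_rV
    ((fun x => f (param i x) * Num.sqrt (\det (gmx g i x))) \_ (cod i)).
Proof. by move=> cf sf; rewrite /L /Rintegral (mu_chart cf sf). Qed.

Lemma compact_coord i K : compact K -> K `<=` dom i -> compact (coord i @` K).
Proof.
move=> cK Ki; apply: continuous_compact cK; apply: continuous_in_subspaceT => p.
by rewrite inE => /Ki; exact: Defs.coord_continuous.
Qed.

Lemma not_coord_image i (K : set M) x : cod i x -> ~ (coord i @` K) x -> ~ K (param i x).
Proof. by move=> ix Kx Kp; apply: Kx; exists (param i x) => //; exact: paramK. Qed.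

Lemma chart_integral_gt0 f i p : continuous f -> supported_in f (dom i) ->
  (forall q, 0 <= f q) -> dom i p -> 0 < f p -> 0 < L f.
Proof.
move=> cf sf f0 ip fp; rewrite (L_chart cf sf); have [K [cK Ki fK]] := sf.
have io := @cod_isopen _ _ _ A i.
pose q x := Num.sqrt (\det (gmx g i x)).
have q0 x : cod i x -> 0 < q x.
  by move=> ix; apply: (@sqrtG_gt0 _ _ (cod i)) => // y; exact: gmx_pos.
pose phi x := f (param i x) * q x.
have Cphi : Ck (cod i) 0 phi.
  apply: (CkM io).
    apply/Ck0P => x ix; apply: (@continuous_comp _ _ _ (param i) f).
      exact: param_continuous ix.
    exact: cf.
  have sq : smooth_on (cod i) q.
    by apply: (sqrtG_smooth io); [exact: gmx_smooth|exact: gmx_pos].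
  exact: CkS (smooth_on_C1 sq).
have cK' := compact_coord cK Ki.
have Kcl : closed (coord i @` K).
  by apply: compact_closed => //; exact: norm_hausdorff.
have KU : coord i @` K `<=` cod i by move=> _ [x /Ki ix <-]; exact: cod_coord.
have phi0 y : cod i y -> ~ (coord i @` K) y -> phi y = 0.
  by move=> iy /(not_coord_image iy)/fK fy; rewrite /phi fy mul0r.
have [N [_ BN]] := compact_bounded cK'.
have r0 : 0 <= `|N| + 1 by rewrite addr_ge0.
apply: (integral_rV_gt0 (r := `|N| + 1) (x := coord i p)) => //.
- apply: (csupp_zero_ext io Kcl KU Cphi phi0) => x Kx.
  by apply: (BN (`|N| + 1)) => //; rewrite ltr_pwDr// ler_norm.
- move=> y; rewrite patchE; case: ifPn => //; rewrite inE => iy.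
  by rewrite mulr_ge0// sqrtr_ge0.
- rewrite patchE mem_set; last exact: cod_coord.
  by rewrite coordK// mulr_gt0// q0//; exact: cod_coord.
Qed.

(** Localise: with a bump [r] at [p] bounded by [B], the product [r * f] is supported in a chart and
    has positive integral, which is at most [B * L f]. *)
Lemma L_gt0 f p : continuous f -> (forall q, 0 <= f q) -> 0 < f p -> 0 < L f.
Proof.
move=> cf f0 fp; pose i := chart_at A p; have ip : dom i p := dom_chart_at A p.
have [r [Cr r0 rp sr]] := bump_exists M_hausdorff (dom_open i) (fun q => id) ip.
have cr : continuous r by apply: (@CkA_continuous _ _ _ A) => j; exact: CkS (Cr j).
have [B rB] := continuous_bounded cr.
have crf : continuous (fun q => r q * f q) by move=> q; exact: (cvgM (cr q) (cf q)).
have cBf : continuous (fun q => B * f q) by move=> q; exact: (cvgM (cvg_cst B) (cf q)).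
have Lrf : 0 < L (fun q => r q * f q).
  apply: (@chart_integral_gt0 _ i p) => //.
  - have [K [cK Ki rK]] := sr; exists K; split => // q /rK->.
    by rewrite mul0r.
  - by move=> q; rewrite mulr_ge0.
  - by rewrite mulr_gt0.
have : L (fun q => r q * f q) <= L (fun q => B * f q).
  apply: le_Rintegral => //; [exact: continuous_integrable|exact: continuous_integrable|].
  by move=> q _; rewrite ler_wpM2r// (le_trans (ler_norm _)).
have B0 : 0 < B by apply: lt_le_trans rp (le_trans (ler_norm _) (rB p)).
by move=> /(lt_le_trans Lrf); rewrite LZ// pmulr_rgt0.
Qed.

End Functional.

Lemma continuous_zero_ext (R : realType) (M : topologicalType) (K V : set M)
    (f : M -> R) : open V -> closed K -> K `<=` V ->
  (forall q, V q -> {for q, continuous f}) -> (forall q, ~ K q -> f q = 0) ->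
  continuous f.
Proof.
move=> Vo Kc KV cf fK q; have [Vq|Vq] := pselect (V q); first exact: cf.
have Kq : ~ K q by move=> /KV.
have E : {near q, (fun=> 0) =1 f}.
  have : \forall q' \near q, (~` K) q'.
    by apply: open_nbhs_nbhs; split => //; exact: closed_openC.
  by apply: filterS => q' /fK ->.
rewrite /continuous_at fK//; exact: cvg_trans (near_eq_cvg E) (cvg_cst _).
Qed.

Lemma local_laplacian_ext (R : realType) n (U : set 'rV[R]_n)
    (G : 'rV[R]_n -> 'M[R]_n) (f h : 'rV[R]_n -> R) x : open U -> {in U, f =1 h} ->
  U x -> local_laplacian G f x = local_laplacian G h x.
Proof.
move=> Uo fh Ux; rewrite /local_laplacian; apply: congr1; apply: eq_bigr => k _.
apply: (partial_ext k Uo _ Ux) => y; rewrite inE => Uy; congr (_ * _).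
by rewrite !gradE; apply: eq_bigr => l _; rewrite (partial_ext l Uo fh Uy).
Qed.

(** * Green's formula and the Laplacian on the manifold *)

Section Green.
Variables (R : realType) (n : nat) (M : ptopologicalType).
Hypotheses (M_hausdorff : hausdorff_space M) (M_compact : compact [set: M]).
Variables (A : atlas R n M) (g : metric A).
Variables (mu : {measure set (borel M) -> \bar R}) (mu_g : riemannian_measure g mu).
Implicit Types (i j : idx A) (f h : M -> R) (p q : M).

Local Notation inner := (inner g).
Local Notation L := (L mu).
Local Notation smoothM := (smoothM A).
Local Notation LD := (LD M_hausdorff M_compact mu_g).
Local Notation LZ := (LZ M_hausdorff M_compact mu_g).

Let io i : open (cod i).
Proof. exact: cod_isopen. Qed.

Let gs i k l : smooth_on (cod i) (fun x => gmx g i x k l).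
Proof. exact: gmx_smooth. Qed.

Let gsym i x : cod i x -> (gmx g i x)^T = gmx g i x.
Proof. exact: gmx_sym. Qed.

Let gpos i x : cod i x -> forall w : 'rV[R]_n, w != 0 ->
  0 < (w *m gmx g i x *m w^T) 0 0.
Proof. exact: gmx_pos. Qed.

Lemma inner_continuous f h : smoothM f -> CkA A 1 h -> continuous (inner f h).
Proof.
move=> sf Ch; apply: (@CkA_continuous _ _ _ A) => i.
have E : {in cod i, local_inner (gmx g i) (f \o param i) (h \o param i) =1
    inner f h \o param i}.
  by move=> x; rewrite inE => ix /=; rewrite inner_param//; exact: smoothM_Ck.
apply: (Ck_ext (@io i) E); apply: (@Ck_sum _ _ (cod i) 0 _ _ xpredT (fun k x =>
  local_grad (gmx g i) (f \o param i) x 0 k * partial k (h \o param i) x)) => [|k _].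
  exact: io.
apply: (CkM (@io i)); last exact: Ck_partial.
exact: CkS (smooth_on_C1 (grad_smooth (@io i) (@gs i) (@gpos i) (sf i) k)).
Qed.

(** The chart is fixed, whereas in [laplacian] it varies with the point; only the fixed version is
    visibly continuous. *)
Definition chart_laplacian i f p :=
  local_laplacian (gmx g i) (f \o param i) (coord i p).

Lemma chart_laplacian_continuous i f p : smoothM f -> dom i p ->
  {for p, continuous (chart_laplacian i f)}.
Proof.
move=> sf ip; apply: (@continuous_comp _ _ _ (coord i)
  (local_laplacian (gmx g i) (f \o param i))).
  exact: Defs.coord_continuous ip.
have sl := local_laplacian_smooth (@io i) (@gs i) (@gsym i) (@gpos i) (sf i).
exact: Ck_continuous (smooth_on_C1 sl) (cod_coord ip).
Qed.

Lemma inner_support f h K q : closed K -> (forall q, ~ K q -> h q = 0) ->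
  ~ K q -> inner f h q = 0.
Proof.
move=> Kcl hK Kq; apply: big1 => k _; set i := chart_at A q.
have iq : dom i q := dom_chart_at A q.
have E : partial k (h \o param i) (coord i q) = partial k (fun=> 0) (coord i q).
  apply: (@partial_ext _ _ (cod_pre i (~` K))).
  - by apply: cod_pre_open; exact: closed_openC.
  - by move=> x; rewrite inE => -[_ Kx] /=; exact: hK.
  - by split; [exact: cod_coord|rewrite coordK].
by rewrite [X in _ * X]E partial_cst mulr0.
Qed.

(** Stated with the Laplacian of chart [i], because the chart independence of [laplacian] is deduced
    from this very formula. *)
Lemma green_supported i f h : smoothM f -> CkA A 1 h -> supported_in h (dom i) ->
  continuous (fun q => h q * chart_laplacian i f q) /\
  L (fun q => h q * chart_laplacian i f q) + L (inner f h) = 0.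
Proof.
move=> sf Ch [K [cK Ki hK]].
have Kcl : closed K by exact: compact_closed.
have ch : continuous h by apply: (@CkA_continuous _ _ _ A) => j; exact: CkS (Ch j).
have c1 : continuous (fun q => h q * chart_laplacian i f q).
  apply: (continuous_zero_ext (dom_open i) Kcl Ki).
    move=> q iq; exact: (cvgM (ch q) (chart_laplacian_continuous sf iq)).
  by move=> q /hK->; rewrite mul0r.
have c2 := inner_continuous sf Ch.
split => //; rewrite -LD//.
rewrite (@L_chart _ _ _ M_hausdorff _ _ _ mu_g _ i); last 2 first.
- by move=> q; exact: (cvgD (c1 q) (c2 q)).
- by exists K; split => // q Kq; rewrite hK// mul0r add0r; exact: (inner_support f Kcl hK Kq).
have cK' := compact_coord cK Ki.
have KU : coord i @` K `<=` cod i by move=> _ [x /Ki ix <-]; exact: cod_coord.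
have h0 y : cod i y -> ~ (coord i @` K) y -> (h \o param i) y = 0.
  by move=> iy /(not_coord_image iy)/hK.
have := green_chart (@io i) (@gs i) (@gpos i) cK' KU
  (sf i) (Ch i) h0.
move=> <-; congr integral_rV; apply/funext => x; rewrite !patchE; case: ifPn => //.
rewrite inE => ix; rewrite /chart_laplacian paramK//.
by rewrite inner_param//; exact: smoothM_Ck.
Qed.

Let chart_laplacian_le i j f p : smoothM f -> dom i p -> dom j p ->
  chart_laplacian i f p <= chart_laplacian j f p.
Proof.
move=> sf ip jp; rewrite leNgt; apply/negP => lt_ji.
pose d q := chart_laplacian i f q - chart_laplacian j f q.
have dp : 0 < d p by rewrite subr_gt0.
have dc q : dom i q -> dom j q -> {for q, continuous d}.
  move=> iq jq.
  exact: (cvgB (chart_laplacian_continuous sf iq) (chart_laplacian_continuous sf jq)).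
have : \forall q \near p, [/\ dom i q, dom j q & 0 < d q].
  have N1 : \forall q \near p, dom i q.
    by apply: open_nbhs_nbhs; split => //; exact: dom_open.
  have N2 : \forall q \near p, dom j q.
    by apply: open_nbhs_nbhs; split => //; exact: dom_open.
  have N3 : \forall q \near p, 0 < d q by exact: (cvgr_gt (d p) (dc p ip jp)).
  by apply: filterS3 N1 N2 N3 => q; split.
move=> N4; move: (N4 : nbhs p _); rewrite nbhsE => -[V [Vo Vp] VP].
(* The bump lives where both charts are defined and [d > 0]. The integral of [h * d] is then
   positive, while Green's formula in both charts makes it 0. *)
have [h [Ch h0 hp [K [cK KV hK]]]] :=
  bump_exists M_hausdorff Vo (fun q Vq => let: And3 iq _ _ := VP q Vq in iq) Vp.
have sup (k : idx A) : V `<=` dom k -> supported_in h (dom k).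
  by move=> Vk; exists K; split => // q /KV/Vk.
have [ci gi] := green_supported sf Ch (sup i (fun q Vq => let: And3 iq _ _ := VP q Vq in iq)).
have [cj gj] := green_supported sf Ch (sup j (fun q Vq => let: And3 _ jq _ := VP q Vq in jq)).
have E : L (fun q => h q * d q) = 0.
  transitivity (L (fun q => h q * chart_laplacian i f q +
      -1 * (h q * chart_laplacian j f q))).
    by apply: L_ext => q; rewrite /d mulrBr mulN1r.
  have cNj : continuous (fun q => -1 * (h q * chart_laplacian j f q)).
    by move=> q; exact: (@cvgM _ _ _ _ (fun=> -1 : R) _ _ _ (cvg_cst _) (cj q)).
  have cancel (x y z : R) : x + z = 0 -> y + z = 0 -> x + -1 * y = 0.
    by move=> xz yz; rewrite mulN1r -(addrK z x) -(addrK z y) xz yz subrr.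
  rewrite LD// LZ//; exact: (cancel _ _ _ gi gj).
have : 0 < L (fun q => h q * d q).
  apply: (L_gt0 M_hausdorff M_compact mu_g (p := p)).
  - apply: (continuous_zero_ext Vo (compact_closed M_hausdorff cK) KV).
      move=> q /VP[iq jq _].
      have ch : continuous h by apply: (@CkA_continuous _ _ _ A) => k; exact: CkS (Ch k).
      exact: (cvgM (ch q) (dc q iq jq)).
    by move=> q /hK->; rewrite mul0r.
  - move=> q; have [/KV/VP[_ _ dq]|/hK->] := pselect (K q); last by rewrite mul0r.
    exact: (mulr_ge0 (h0 q) (ltW dq)).
  - exact: (mulr_gt0 hp dp).
by rewrite E ltxx.
Qed.

(* The Laplacians of two charts have the same integral against every test
   function supported in both, hence agree: no change of variables in the
   divergence is needed. *)
Lemma chart_laplacian_indep i j f p : smoothM f -> dom i p -> dom j p ->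
  chart_laplacian i f p = chart_laplacian j f p.
Proof. by move=> sf ip jp; apply/le_anti/andP; split; exact: chart_laplacian_le. Qed.

Lemma laplacian_chart f i p : smoothM f -> dom i p ->
  laplacian g f p = chart_laplacian i f p.
Proof. by move=> sf; apply: chart_laplacian_indep => //; exact: dom_chart_at. Qed.

Lemma laplacian_param f i x : smoothM f -> cod i x ->
  laplacian g f (param i x) = local_laplacian (gmx g i) (f \o param i) x.
Proof.
move=> sf ix; rewrite (laplacian_chart sf (dom_param ix)) /chart_laplacian paramK//.
Qed.

Lemma smoothM_laplacian f : smoothM f -> smoothM (laplacian g f).
Proof.
move=> sf i.
have E : {in cod i, local_laplacian (gmx g i) (f \o param i) =1
    laplacian g f \o param i}.
  by move=> x; rewrite inE => ix /=; rewrite laplacian_param.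
apply: (smooth_on_ext (@io i) E).
exact: (local_laplacian_smooth (@io i) (@gs i) (@gsym i) (@gpos i) (sf i)).
Qed.

Lemma green f h : smoothM f -> CkA A 1 h ->
  L (fun q => h q * laplacian g f q) = - L (inner f h).
Proof.
move=> sf Ch; have [s [th [thP th1]]] := partition_of_unity M_hausdorff M_compact A.
pose k a q := h q * th a q.
have Ck_ a : CkA A 1 (k a).
  by have [C1 _ _] := thP a => i; apply: (@CkM _ _ (cod i) 1 (h \o param i) (th a \o param i)).
have kE q : h q = \sum_(a <- s) k a q by rewrite -mulr_sumr th1 mulr1.
have sup a : supported_in (k a) (dom (chart_at A a)).
  have [_ _ [K [cK Ki tK]]] := thP a; exists K; split => // q /tK tq.
  by rewrite /k tq mulr0.
have G a := green_supported sf (Ck_ a) (sup a).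
have E a q : k a q * laplacian g f q = k a q * chart_laplacian (chart_at A a) f q.
  have [K [_ Ki kK]] := sup a.
  have [/Ki aq|/kK k0] := pselect (K q).
    by apply: congr1; exact: laplacian_chart.
  by rewrite k0; rewrite [LHS]mul0r [RHS]mul0r.
have cL a : continuous (fun q => k a q * laplacian g f q).
  have Ea : (fun q => k a q * laplacian g f q) =
      (fun q => k a q * chart_laplacian (chart_at A a) f q) by apply/funext => q; exact: E.
  by rewrite Ea; exact: (G a).1.
have -> : L (fun q => h q * laplacian g f q) =
    L (fun q => \sum_(a <- s) k a q * laplacian g f q).
  by apply: L_ext => q; rewrite -mulr_suml -kE.
have -> : L (inner f h) = L (fun q => \sum_(a <- s) inner f (k a) q).
  apply: L_ext => q; rewrite -inner_sum//; congr (inner f _ q).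
  by apply/funext => q'; exact: kE.
rewrite (L_sum M_hausdorff M_compact mu_g s cL).2.
rewrite (L_sum M_hausdorff M_compact mu_g s (fun a => inner_continuous sf (Ck_ a))).2.
rewrite -sumrN; apply: eq_bigr => a _.
rewrite (L_ext _ (E a)); apply/eqP; rewrite -addr_eq0; apply/eqP.
exact: (G a).2.
Qed.

Lemma inner_cpowR f h c r p : smoothM f -> (forall q, 0 < f q) ->
  inner (fun q => c * f q `^ r) h p = c * (r * f p `^ (r - 1)) * inner f h p.
Proof.
move=> sf f0; set i := chart_at A p; have ip : dom i p := dom_chart_at A p.
have := @local_inner_cpowR _ _ (cod i) (gmx g i) (f \o param i) c r (sf i)
  (fun x _ => f0 (param i x)) (h \o param i) _ (cod_coord ip).
by rewrite /= coordK.
Qed.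

Lemma smoothM_cpowR f c r : smoothM f -> (forall q, 0 < f q) ->
  smoothM (fun q => c * f q `^ r).
Proof. by move=> sf f0 i; exact: (cpowR_smooth (@io i) c r (sf i) (fun x _ => f0 _)). Qed.

Lemma laplacian_cpowR f c r p : smoothM f -> (forall q, 0 < f q) ->
  laplacian g (fun q => c * f q `^ r) p =
  c * (r * f p `^ (r - 1)) * laplacian g f p
  + c * (r * (r - 1) * f p `^ (r - 1 - 1)) * inner f f p.
Proof.
move=> sf f0; set i := chart_at A p; have ip : dom i p := dom_chart_at A p.
have := @local_laplacian_cpowR _ _ (cod i) (gmx g i) (@io i) (@gs i) (@gsym i)
  (@gpos i) (f \o param i) c r (sf i) (fun x _ => f0 (param i x)) _ (cod_coord ip).
by rewrite /= coordK.
Qed.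

Lemma bochner f p : smoothM f ->
  laplacian g (inner f f) p =
  2 * (tensor_normsq g p (hessian g f p) + ricci g p (grad g f p))
  + 2 * inner f (laplacian g f) p.
Proof.
move=> sf; set i := chart_at A p; have ip : dom i p := dom_chart_at A p.
have ix := cod_coord ip.
have B := local_bochner (@io i) (@gs i) (@gsym i) (@gpos i) (sf i) ix.
rewrite (laplacian_chart (smoothM_inner g sf sf) ip) /chart_laplacian.
rewrite (@local_laplacian_ext _ _ (cod i) _ _
  (local_inner (gmx g i) (f \o param i) (f \o param i)) _ (@io i) _ ix); last first.
  by move=> x; rewrite inE => jx /=; rewrite inner_param//; exact: smoothM_Ck.
have E : local_inner (gmx g i) (f \o param i)
    (local_laplacian (gmx g i) (f \o param i)) (coord i p) = inner f (laplacian g f) p.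
  apply: eq_bigr => k _; apply: congr1.
  apply: (partial_ext k (@io i) _ ix) => x; rewrite inE => jx.
  by rewrite /= laplacian_param.
by rewrite -E; exact: B.
Qed.

Lemma tensor_normsq_shift f c p : smoothM f ->
  tensor_normsq g p (hessian g f p + c *: metric_at g p) =
  tensor_normsq g p (hessian g f p) + 2 * c * laplacian g f p + n%:R * c ^+ 2.
Proof.
move=> sf; set i := chart_at A p; have ip : dom i p := dom_chart_at A p.
exact: (local_normsq_shift (@io i) (@gs i) (@gsym i) (@gpos i) c (sf i)
  (cod_coord ip)).
Qed.

End Green.

(** * Functions of time and space *)

Section TimeDependent.
Variables (R : realType) (M : topologicalType) (J : set R).
Implicit Types (f h : R -> M -> R).

Definition jcont f := forall t p, J t -> {for (t, p), continuous (fun z => f z.1 z.2)}.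

(** Joint continuity of the derivative is bundled in: with [M] compact it gives the uniformity that
    differentiation under the integral requires. *)
Definition has_dt f f' := [/\ jcont f, jcont f' &
  forall t p, J t -> is_derive t 1 (fun s => f s p) (f' t p)].

Lemma jcont_slice f t : jcont f -> J t -> continuous (f t).
Proof.
move=> cf Jt p.
apply: (@continuous_comp _ _ _ (fun q => (t, q)) (fun z => f z.1 z.2)); last exact: cf.
exact: (@cvg_pair _ _ _ _ (nbhs t) (nbhs p) _ _ _ (fun=> t) id (cvg_cst t) cvg_id).
Qed.

Lemma jcont_const (f : M -> R) : continuous f -> jcont (fun=> f).
Proof.
move=> cf t p _.
by apply: (@continuous_comp _ _ _ snd f); [exact: cvg_snd|exact: cf].
Qed.

Lemma jcontD f h : jcont f -> jcont h -> jcont (fun s p => f s p + h s p).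
Proof. by move=> cf ch t p Jt; exact: cvgD (cf t p Jt) (ch t p Jt). Qed.

Lemma jcontM f h : jcont f -> jcont h -> jcont (fun s p => f s p * h s p).
Proof. by move=> cf ch t p Jt; exact: cvgM (cf t p Jt) (ch t p Jt). Qed.

Lemma jcont_powR f r : jcont f -> (forall t p, J t -> 0 < f t p) ->
  jcont (fun s p => f s p `^ r).
Proof.
move=> cf f0 t p Jt.
apply: (@continuous_comp _ _ _ (fun z => f z.1 z.2) (fun s => s `^ r)); first exact: cf.
apply: differentiable_continuous; apply/derivable1_diffP.
by have [] := is_derive1_powR r (f0 t p Jt).
Qed.

Lemma has_dt_const (f : M -> R) : continuous f -> has_dt (fun=> f) (fun _ _ => 0).
Proof.
move=> cf; split; [exact: jcont_const| |by move=> t p _; exact: is_derive_cst].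
by apply: jcont_const => q; exact: cvg_cst.
Qed.

Lemma has_dtD f f' h h' : has_dt f f' -> has_dt h h' ->
  has_dt (fun s p => f s p + h s p) (fun s p => f' s p + h' s p).
Proof.
move=> [cf cf' df] [ch ch' dh]; split; [exact: jcontD|exact: jcontD|].
by move=> t p Jt; have := is_deriveD (df t p Jt) (dh t p Jt).
Qed.

Lemma has_dtM f f' h h' : has_dt f f' -> has_dt h h' ->
  has_dt (fun s p => f s p * h s p) (fun s p => f' s p * h s p + f s p * h' s p).
Proof.
move=> [cf cf' df] [ch ch' dh]; split.
- exact: jcontM.
- by apply: jcontD; exact: jcontM.
- move=> t p Jt; have := is_deriveM (df t p Jt) (dh t p Jt).
  by move=> D; apply: (is_derive_eq D); rewrite addrC; congr (_ + _); exact: mulrC.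
Qed.

Lemma has_dtZ c f f' : has_dt f f' -> has_dt (fun s p => c * f s p) (fun s p => c * f' s p).
Proof.
move=> df; have cc : continuous (fun _ : M => c) by move=> q; exact: cvg_cst.
have := has_dtM (has_dt_const cc) df.
have -> // : (fun s p => 0 * f s p + c * f' s p) = (fun s p => c * f' s p).
by apply/funext => s; apply/funext => p; rewrite mul0r add0r.
Qed.

Lemma has_dt_powR f f' r : has_dt f f' -> (forall t p, J t -> 0 < f t p) ->
  has_dt (fun s p => f s p `^ r) (fun s p => r * f s p `^ (r - 1) * f' s p).
Proof.
move=> [cf cf' df] f0; split.
- exact: jcont_powR.
- apply: jcontM => //; apply: jcontM; last exact: jcont_powR.
  by apply: jcont_const => q; exact: cvg_cst.
- move=> t p Jt.
  exact: (is_derive1_comp (is_derive1_powR r (f0 t p Jt)) (df t p Jt)).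
Qed.

End TimeDependent.

(** * Differentiation under the integral over the manifold *)

Section Leibniz.
Variables (R : realType) (n : nat) (M : ptopologicalType).
Hypotheses (M_hausdorff : hausdorff_space M) (M_compact : compact [set: M]).
Variables (A : atlas R n M) (g : metric A).
Variables (mu : {measure set (borel M) -> \bar R}) (mu_g : riemannian_measure g mu).

Local Notation L := (L mu).
Local Notation LD := (LD M_hausdorff M_compact mu_g).
Local Notation LZ := (LZ M_hausdorff M_compact mu_g).

Lemma jcont_unif (J : set R) (f : R -> M -> R) t e : jcont J f -> J t -> 0 < e ->
  \forall s \near t, forall p, `|f t p - f s p| <= e.
Proof.
move=> cf Jt e0.
have : \forall s \near t, [set: M] `<=` (fun p => `|f t p - f s p| <= e).
  apply: ((compact_near_coveringP _).1 M_compact R (nbhs t)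
    (fun s p => `|f t p - f s p| <= e)).
  move=> p _; have e2 : 0 < e / 2 by rewrite divr_gt0.
  have cs : (fun z : M * R => f z.2 z.1) z @[z --> (p, t)] --> f t p.
    apply: (cvg_comp (fun z : M * R => (z.2, z.1)) (fun z => f z.1 z.2) _ (cf t p Jt)).
    exact: (cvg_pair cvg_snd cvg_fst).
  have /cvgrPdist_le /(_ _ e2) H1 := cs.
  have cs2 := jcont_slice cf Jt.
  have /cvgrPdist_le /(_ _ e2) H2 := cs2 p.
  have H2' : \forall z \near (p, t), `|f t p - f t z.1| <= e / 2.
    exact: (cvg_fst (G := nbhs t) H2).
  apply: filterS2 H1 H2' => -[q s] /= h1 h2.
  by apply: dist_le_halves; rewrite distrC; [exact: h2|exact: h1].
by apply: filterS => s H p; exact: H.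
Qed.

(** By the mean value theorem the error of the difference quotient at each point is a difference of
    two values of [f'] at nearby times. It is small uniformly on [M], and the total mass is
    finite. *)
Lemma L_derive (J : set R) f f' t : open J -> has_dt J f f' -> J t ->
  is_derive t 1 (fun s => L (f s)) (L (f' t)).
Proof.
move=> Jo [cf cf' df] Jt.
apply: cvg_is_derive; apply/cvgrPdist_le => e e0.
have mu0 : 0 <= fine (mu [set: borel M]) by exact: fine_ge0.
have c0 : 0 < fine (mu [set: borel M]) + 1 by rewrite ltr_wpDl.
have e'0 : 0 < e / (fine (mu [set: borel M]) + 1) by rewrite divr_gt0.
have /nbhs_ballP[d1 /= d10 dJ] : nbhs t J by exact: open_nbhs_nbhs.
have /nbhs_ballP[d2 /= d20 dH] := jcont_unif cf' Jt e'0.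
apply/nbhs_ballP; exists (Num.min d1 d2); first by rewrite /= lt_min d10.
move=> h; rewrite /ball /= sub0r normrN lt_min => /andP[hd1 hd2] h0.
have Jh s : `|s| <= `|h| -> J (s + t).
  move=> sh; apply: dJ; rewrite /ball /= opprD addrCA subrr addr0 normrN.
  exact: le_lt_trans hd1.
pose G q := - h^-1 * f (h + t) q + (h^-1 * f t q + f' t q).
have c1 := jcont_slice cf (Jh h (lexx _)).
have c2 := jcont_slice cf Jt.
have c3 := jcont_slice cf' Jt.
have cZ c (k : M -> R) : continuous k -> continuous (fun q => c * k q).
  by move=> ck q; exact: (@cvgM _ _ _ _ (fun=> c) _ _ _ (cvg_cst _) (ck q)).
have cD (k1 k2 : M -> R) : continuous k1 -> continuous k2 ->
    continuous (fun q => k1 q + k2 q).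
  by move=> ck1 ck2 q; exact: cvgD (ck1 q) (ck2 q).
have c4 := cD _ _ (cZ h^-1 _ c2) c3.
have cG : continuous G := cD _ _ (cZ (- h^-1) _ c1) c4.
have GB q : `|G q| <= e / (fine (mu [set: borel M]) + 1).
  have [s sh] : exists2 s, `|s| <= `|h| & f (h + t) q - f t q = h * f' (s + t) q.
    have [|s sh] := @MVT0 _ (fun s : R => f (s + t) q) (fun s : R => f' (s + t) q) h.
      move=> s sh; have := df (s + t) q (Jh s sh).
      move/(is_derive1_comp (g := fun s : R => s + t)).
      by move=> /(_ 1); rewrite mulr1; apply; exact: is_derive_shift.
    by rewrite add0r; exists s.
  move=> E.
  have -> : G q = f' t q - f' (s + t) q.
    have alg (x p1 p2 p3 : R) : - x * p1 + (x * p2 + p3) = p3 - x * (p1 - p2) by ring.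
    by rewrite /G alg E mulKf.
  apply: dH; rewrite /ball /= opprD addrCA subrr addr0 normrN.
  exact: le_lt_trans hd2.
have EG : L G = L (f' t) - h^-1 * (L (f (h + t)) - L (f t)).
  by rewrite /G LD ?LD ?LZ//; [ring|exact: cZ|exact: cZ].
rewrite -EG; apply: le_trans (L_bound M_hausdorff M_compact mu_g cG GB) _.
by rewrite mulrAC -mulrA ler_piMr ?(ltW e0)// ler_pdivrMr// mul1r lerDl.
Qed.

End Leibniz.

(** * From joint smoothness to time derivatives and time slices *)

Section Spacetime.
Variables (R : realType) (n : nat) (M : ptopologicalType) (A : atlas R n M).
Variables (J : set R) (Jo : open J).
Implicit Types (f : R -> M -> R) (i : idx A).

Definition stdom i :=
  [set z : 'rV[R]_(1 + n) | J (lsubmx z 0 0) /\ cod i (rsubmx z)].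

Definition stfun f i (z : 'rV[R]_(1 + n)) := f (lsubmx z 0 0) (param i (rsubmx z)).

Definition ddt f (t : R) (p : M) : R := 'D_1 (fun s => f s p) t.

Lemma stdom_open i : open (stdom i).
Proof.
have cl (z : 'rV[R]_(1 + n)) : (lsubmx z' 0 0) @[z' --> z] --> lsubmx z 0 0.
  rewrite mxE; under eq_fun do rewrite mxE; exact: coord_continuous.
have cr (z : 'rV[R]_(1 + n)) : rsubmx z' @[z' --> z] --> rsubmx z.
  apply: (@cvg_mx _ (nbhs z)) => a b.
  rewrite mxE; under eq_fun do rewrite mxE; exact: coord_continuous.
apply: openI.
  exact: (@open_comp _ _ (fun z : 'rV[R]_(1 + n) => lsubmx z 0 0) J (fun z _ => cl z) Jo).
exact: (@open_comp _ _ (fun z : 'rV[R]_(1 + n) => rsubmx z) (cod i) (fun z _ => cr z)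
  (@cod_isopen _ _ _ A i)).
Qed.

Lemma stdom_row0 i s (y : 'rV[R]_n) : J s -> cod i y -> stdom i (row0 s y).
Proof. by move=> Js iy; rewrite /stdom /= row0_lsub row0_rsub. Qed.

Lemma stfun_row0 f i s (y : 'rV[R]_n) : stfun f i (row0 s y) = f s (param i y).
Proof. by rewrite /stfun row0_lsub row0_rsub. Qed.

Lemma ddt_stfun f i s (y : 'rV[R]_n) :
  partial (lshift n 0) (stfun f i) (row0 s y) = ddt f s (param i y).
Proof.
rewrite partial_row0l; congr ('D_1 _ s); apply/funext => s'; exact: stfun_row0.
Qed.

Lemma spacetime_ddt f : spacetime_smooth A J f -> spacetime_smooth A J (ddt f).
Proof.
move=> sf i.
have E : {in stdom i, partial (lshift n 0) (stfun f i) =1 stfun (ddt f) i}.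
  by move=> z _; rewrite -(row0K z) ddt_stfun stfun_row0.
apply: (smooth_on_ext (@stdom_open i) E).
exact: (smooth_on_partial (lshift n 0) (sf i)).
Qed.

Lemma spacetime_jcont f : spacetime_smooth A J f -> jcont J f.
Proof.
move=> sf t p Jt; pose i := chart_at A p.
have ip : dom i p := dom_chart_at A p.
have cS := Ck_continuous (smooth_on_C1 (sf i)) (stdom_row0 Jt (cod_coord ip)).
have cz : (fun z : R * M => stfun f i (row0 z.1 (coord i z.2))) z @[z --> (t, p)]
    --> stfun f i (row0 t (coord i p)).
  apply: (cvg_comp (fun z : R * M => row0 z.1 (coord i z.2)) (stfun f i) _ cS).
  apply: (cvg_comp (fun z : R * M => (coord i z.2, z.1))
    (fun z : 'rV[R]_n * R => row0 z.2 z.1) _ (@row0_continuous _ _ t (coord i p))).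
  have cc : (fun z : R * M => coord i z.2) z @[z --> (t, p)] --> coord i p.
    exact: (cvg_comp snd (coord i) cvg_snd (Defs.coord_continuous ip)).
  exact: (cvg_pair cc cvg_fst).
have E : {near (t, p), (fun z : R * M => stfun f i (row0 z.1 (coord i z.2))) =1
    (fun z => f z.1 z.2)}.
  have N : \forall q \near p, dom i q.
    by apply: open_nbhs_nbhs; split => //; exact: dom_open.
  have N' : \forall z \near (t, p), dom i z.2 by exact: (cvg_snd (F := nbhs t) N).
  by apply: filterS N' => z iz; rewrite stfun_row0 coordK.
rewrite /prop_for /continuous_at -(nbhs_singleton E).
exact: cvg_trans (near_eq_cvg E) cz.
Qed.

Lemma spacetime_has_dt f : spacetime_smooth A J f -> has_dt J f (ddt f).
Proof.
move=> sf; split; [exact: spacetime_jcont|exact/spacetime_jcont/spacetime_ddt|].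
move=> t p Jt; pose i := chart_at A p; have ip : dom i p := dom_chart_at A p.
have D := Ck_derivable (k := lshift n 0) (smooth_on_C1 (sf i))
  (stdom_row0 Jt (cod_coord ip)).
have E : (fun s => stfun f i (row0 s (coord i p))) = (fun s => f s p).
  by apply/funext => s; rewrite stfun_row0 coordK.
have := derivable_row0l D; rewrite E => D1.
by split.
Qed.

(** Partials of a slice are slices of partials, which drives the induction on the order. *)
Lemma Ck_row0r (U : set 'rV[R]_(1 + n)) (V : set 'rV[R]_n) N F s :
  (forall y, V y -> U (row0 s y)) -> Ck U N F -> Ck V N (fun y => F (row0 s y)).
Proof.
move=> VU; elim: N F => [|N IH] F CF.
  apply/Ck0P => y Vy.
  exact: (continuous_comp (@row0r_continuous _ _ s y) (Ck_continuous CF (VU y Vy))).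
apply/CkSP; split.
- move=> y Vy.
  exact: (continuous_comp (@row0r_continuous _ _ s y) (Ck_continuous CF (VU y Vy))).
- move=> k y Vy; have /derivable1P := Ck_derivable (k := rshift 1 k) CF (VU y Vy).
  move=> D; apply/derivable1P; move: D.
  congr (derivable _ (0 : R) (1 : R)); apply/funext => h.
  by rewrite row0_shiftr.
- move=> k; have := IH _ (Ck_partial (rshift 1 k) CF).
  by under eq_fun do rewrite partial_row0r.
Qed.

Lemma spacetime_slice f t : spacetime_smooth A J f -> J t -> smoothM A (f t).
Proof.
move=> sf Jt i; apply/smooth_onP => N.
have := (smooth_onP _ _).1 (sf i) N.
move=> /(Ck_row0r (fun y iy => stdom_row0 (i := i) Jt iy)).
have -> // : (fun y : 'rV[R]_n => f (lsubmx (row0 t y) 0 0) (param i (rsubmx (row0 t y))))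
    = f t \o param i by apply/funext => y; exact: stfun_row0.
Qed.

End Spacetime.

(** * Evolution of the pressure *)

Section Pressure.
Variables (R : realType) (n : nat) (M : ptopologicalType).
Hypotheses (M_hausdorff : hausdorff_space M) (M_compact : compact [set: M]).
Variables (A : atlas R n M) (g : metric A).
Variables (mu : {measure set (borel M) -> \bar R}) (mu_g : riemannian_measure g mu).
Implicit Types (f h v w : M -> R) (p q : M).

Local Notation inner := (inner g).
Local Notation lap := (laplacian g).
Local Notation L := (L mu).
Local Notation smoothM := (smoothM A).
Local Notation green := (green M_hausdorff M_compact mu_g).

Lemma smoothM_D f h : smoothM f -> smoothM h -> smoothM (fun p => f p + h p).
Proof. by move=> sf sh i; exact: (smooth_onD (@cod_isopen _ _ _ A i) (sf i) (sh i)). Qed.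

Lemma smoothM_M f h : smoothM f -> smoothM h -> smoothM (fun p => f p * h p).
Proof. by move=> sf sh i; exact: (smooth_onM (@cod_isopen _ _ _ A i) (sf i) (sh i)). Qed.

Lemma smoothM_cst c : smoothM (fun=> c).
Proof. by move=> i; exact: (@smooth_on_cst _ _ (cod i) c). Qed.

Lemma L_smoothD f h : smoothM f -> smoothM h -> L (fun p => f p + h p) = L f + L h.
Proof.
move=> sf sh; apply: (LD M_hausdorff M_compact mu_g); exact: smoothM_continuous.
Qed.

Lemma L_smoothZ c f : smoothM f -> L (fun p => c * f p) = c * L f.
Proof.
move=> sf; apply: (LZ M_hausdorff M_compact mu_g); exact: smoothM_continuous.
Qed.

Lemma green_sym f h : smoothM f -> smoothM h ->
  L (fun p => f p * lap h p) = L (fun p => h p * lap f p).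
Proof.
move=> sf sh; apply: (etrans (green sh (smoothM_Ck 1 sf))).
apply: (etrans _ (esym (green sf (smoothM_Ck 1 sh)))); apply: congr1.
apply: L_ext => p; exact: (innerC g p (smoothM_Ck 1 sh) (smoothM_Ck 1 sf)).
Qed.

Definition bochner_density v p :=
  tensor_normsq g p (hessian g v p) + ricci g p (grad g v p).

Lemma bochner_densityE v p : smoothM v ->
  lap (inner v v) p = 2 * bochner_density v p + 2 * inner v (lap v) p.
Proof. exact: (bochner M_hausdorff M_compact mu_g). Qed.

(** Regularity is read off from Bochner's formula: the density equals half the Laplacian of
    [|grad v|^2] minus the product of the gradients of [v] and of its Laplacian, both known to be
    smooth on [M]. *)
Lemma smoothM_bochner_density v : smoothM v -> smoothM (bochner_density v).
Proof.
move=> sv; have sl := smoothM_laplacian M_hausdorff M_compact mu_g sv.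
have sq := smoothM_inner g sv sv.
have E : bochner_density v =
    (fun p => 2^-1 * lap (inner v v) p + -1 * inner v (lap v) p).
  apply/funext => p; rewrite bochner_densityE// mulrDr !mulKf// mulN1r addrK.
  by [].
rewrite E; apply: smoothM_D.
  apply: (smoothM_M (smoothM_cst 2^-1)).
  exact: (smoothM_laplacian M_hausdorff M_compact mu_g sq).
apply: (smoothM_M (smoothM_cst (-1))).
exact: (smoothM_inner g sv sl).
Qed.

(** Green's formula gives [z = - (c + b)] and [int (Delta v)^2 w = - (a + b)], Bochner gives
    [y = 2 x + 2 a], and [vw] gives [(m - 1) c = m a]. The left-hand side [2 (m - 1) z + y] is
    therefore [2 x - 2 (m - 1) (a + b)]. *)
Lemma bochner_integral v w m : smoothM v -> smoothM w ->
  (forall h p, (m - 1) * (v p * inner w h p) = m * (w p * inner v h p)) ->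
  L (fun p => ((m - 1) * (v p * lap v p) + inner v v p) * lap w p)
  + (m - 1) * L (fun p => v p * lap w p * lap v p) =
  2 * L (fun p => bochner_density v p * w p)
  + 2 * (m - 1) * L (fun p => lap v p ^+ 2 * w p).
Proof.
move=> sv sw vw; set s := lap v; set k := lap w.
have ss : smoothM s := smoothM_laplacian M_hausdorff M_compact mu_g sv.
have sk : smoothM k := smoothM_laplacian M_hausdorff M_compact mu_g sw.
have sq := smoothM_inner g sv sv.
have sb := smoothM_bochner_density sv.
have svs := smoothM_inner g sv ss.
have svw := smoothM_inner g sv sw.
have sws := smoothM_inner g sw ss.
have swv := smoothM_inner g sw sv.
pose a := L (fun p => w p * inner v s p).
pose b := L (fun p => s p * inner v w p).
pose c := L (fun p => v p * inner w s p).
pose x := L (fun p => bochner_density v p * w p).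
pose y := L (fun p => inner v v p * k p).
pose z := L (fun p => v p * s p * k p).
have E1 : L (fun p => ((m - 1) * (v p * s p) + inner v v p) * k p) = (m - 1) * z + y.
  transitivity (L (fun p => (m - 1) * (v p * s p * k p) + inner v v p * k p)).
    by apply: L_ext => p; rewrite [LHS]mulrDl; congr (_ + _); exact: esym (mulrA _ _ _).
  have s1 := smoothM_M (smoothM_M sv ss) sk.
  by rewrite (L_smoothD (smoothM_M (smoothM_cst (m - 1)) s1) (smoothM_M sq sk)) (L_smoothZ _ s1).
have E2 : L (fun p => v p * k p * s p) = z.
  by apply: L_ext => p; exact: mulrAC.
have E3 : y = 2 * x + 2 * a.
  rewrite /y (green_sym sq sw).
  transitivity (L (fun p => 2 * (bochner_density v p * w p) + 2 * (w p * inner v s p))).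
    apply: L_ext => p; have B := bochner_densityE p sv.
    have alg (c1 c2 c3 c4 : R) : c1 = 2 * c2 + 2 * c3 ->
      c4 * c1 = 2 * (c2 * c4) + 2 * (c4 * c3) by move=> ->; ring.
    exact: (alg _ _ _ _ B).
  have s1 := smoothM_M sb sw; have s2 := smoothM_M sw svs.
  rewrite (L_smoothD (smoothM_M (smoothM_cst 2) s1) (smoothM_M (smoothM_cst 2) s2)).
  by rewrite (L_smoothZ _ s1) (L_smoothZ _ s2).
have E4 : z = - (c + b).
  rewrite /z (green sw (smoothM_Ck 1 (smoothM_M sv ss))); congr (- _).
  transitivity (L (fun p => v p * inner w s p + s p * inner v w p)).
    apply: L_ext => p.
    rewrite (innerM g w p (smoothM_Ck 1 sv) (smoothM_Ck 1 ss)); congr (_ + _ * _).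
    exact: (innerC g p (smoothM_Ck 1 sw) (smoothM_Ck 1 sv)).
  exact: (L_smoothD (smoothM_M sv sws) (smoothM_M ss svw)).
have E5 : (m - 1) * c = m * a.
  rewrite -(L_smoothZ (m - 1) (smoothM_M sv sws)) -(L_smoothZ m (smoothM_M sw svs)).
  by apply: L_ext => p; exact: vw.
have E6 : L (fun p => s p ^+ 2 * w p) = - (a + b).
  transitivity (L (fun p => w p * s p * lap v p)).
    by apply: L_ext => p; rewrite [LHS]mulrC; exact: mulrA.
  rewrite (green sv (smoothM_Ck 1 (smoothM_M sw ss))); congr (- _).
  transitivity (L (fun p => w p * inner v s p + s p * inner v w p)).
    by apply: L_ext => p; exact: (innerM g v p (smoothM_Ck 1 sw) (smoothM_Ck 1 ss)).
  exact: (L_smoothD (smoothM_M sw svs) (smoothM_M ss svw)).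
have alg (X1 X2 X6 a0 b0 c0 x0 y0 z0 : R) : X1 = (m - 1) * z0 + y0 -> X2 = z0 ->
    y0 = 2 * x0 + 2 * a0 -> z0 = - (c0 + b0) -> (m - 1) * c0 = m * a0 ->
    X6 = - (a0 + b0) -> X1 + (m - 1) * X2 = 2 * x0 + 2 * (m - 1) * X6.
  move=> -> -> -> -> e5 ->.
  have -> : (m - 1) * - (c0 + b0) = - (m * a0) - (m - 1) * b0 by rewrite -e5; ring.
  ring.
exact: (alg _ _ _ _ _ _ _ _ _ E1 E2 E3 E4 E5 E6).
Qed.

End Pressure.

Lemma powR_subr1 (R : realType) (x r : R) : 0 < x -> x `^ (r - 1) * x = x `^ r.
Proof.
move=> x0; rewrite -[X in _ * X]powRr1 ?ltW// -powRD ?subrK//.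
by apply/implyP => _; rewrite gt_eqF.
Qed.

Lemma is_derive1M (R : realType) (f h : R -> R) (t df dh : R) :
  is_derive t 1 f df -> is_derive t 1 h dh ->
  is_derive t 1 (fun s => f s * h s) (df * h t + f t * dh).
Proof.
move=> D1 D2; apply: (is_derive_eq (is_deriveM D1 D2)).
by rewrite addrC; congr (_ + _); exact: mulrC.
Qed.

(* [(s N)' = - (s^(a+1) E)'] for [N = - s^a E]. *)
Lemma weighted_second_derivative (R : realType) (J : set R) (E E' : R -> R)
    (a t E2 : R) : open J -> (forall s, J s -> 0 < s) ->
  (forall s, J s -> is_derive s 1 E (E' s)) -> J t -> is_derive t 1 E' E2 ->
  let N := fun s : R => - s `^ a * E s in
  derivable N t 1 /\
  is_derive t 1 (fun s => s * derive1 N s + N s)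
    (- (t `^ (a + 1) * E2 + 2 * (a + 1) * t `^ a * E' t
        + a * (a + 1) * t `^ (a - 1) * E t)).
Proof.
move=> Jo J0 dE Jt dE' N.
have dP r s : J s -> is_derive s 1 (fun s => s `^ r) (r * s `^ (r - 1)).
  by move=> Js; exact: is_derive1_powR (J0 s Js).
have dN s : J s -> is_derive s 1 N (- (a * s `^ (a - 1)) * E s + - s `^ a * E' s).
  by move=> Js; apply: is_derive1M (dE s Js); apply: is_deriveN; exact: dP.
split; first by have [] := dN t Jt.
pose W s := - (a + 1) * s `^ a * E s + - s `^ (a + 1) * E' s.
have near_W : \near t, W t = t * derive1 N t + N t.
  have : \forall s \near t, J s by exact: open_nbhs_nbhs.
  apply: filterS => s Js; have [_ dNs] := dN s Js.
  rewrite derive1E dNs /W /N -(powR_subr1 (a + 1) (J0 s Js)) addrK.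
  by rewrite -(powR_subr1 a (J0 s Js)); ring.
apply: (near_eq_is_derive near_W).
have dW1 : is_derive t 1 (fun s => - (a + 1) * s `^ a) (- (a + 1) * (a * t `^ (a - 1))).
  have := is_derive1M (is_derive_cst (- (a + 1)) t 1) (dP a t Jt).
  by move=> D; apply: (is_derive_eq D); rewrite /cst mul0r add0r.
have dW2 : is_derive t 1 (fun s => - s `^ (a + 1)) (- ((a + 1) * t `^ (a + 1 - 1))).
  by apply: is_deriveN; exact: dP.
have D := is_deriveD (is_derive1M dW1 (dE t Jt)) (is_derive1M dW2 dE').
apply: (is_derive_eq D); rewrite addrK; ring.
Qed.

(** * Derivatives of the entropy along the flow *)

Section Evolution.
Variables (R : realType) (n : nat) (M : ptopologicalType).
Hypotheses (M_hausdorff : hausdorff_space M) (M_compact : compact [set: M]).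
Variables (A : atlas R n M) (g : metric A).
Variables (mu : {measure set (borel M) -> \bar R}) (mu_g : riemannian_measure g mu).
Variables (m : R) (m_neq1 : m != 1) (J : set R) (Jo : open J).
Variables (u : R -> M -> R) (u_smooth : spacetime_smooth A J u).
Hypothesis u_gt0 : forall t p, J t -> 0 < u t p.
Hypothesis u_pme : forall t p, J t ->
  derive1 (fun s => u s p) t = laplacian g (fun q => u t q `^ m) p.

Local Notation inner := (inner g).
Local Notation lap := (laplacian g).
Local Notation L := (L mu).
Local Notation smoothM := (smoothM A).
Local Notation LD := (L_smoothD M_hausdorff M_compact mu_g).
Local Notation LZ := (L_smoothZ M_hausdorff M_compact mu_g).

Let c := m / (m - 1).
Let v t p := c * u t p `^ (m - 1).
Let w t p := c * u t p `^ m.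
(** The equation makes this the Laplacian of [w t]. In this form it has a time derivative by the
    joint smoothness of [u], without differentiating a Laplacian in time. *)
Let k t p := c * ddt u t p.
Let dv t p := c * ((m - 1) * u t p `^ (m - 1 - 1) * ddt u t p).
Let dw t p := c * (m * u t p `^ (m - 1) * ddt u t p).

Let cm : c * (m - 1) = m.
Proof. by rewrite /c divfK// subr_eq0. Qed.

Let su t : J t -> smoothM (u t).
Proof. exact: spacetime_slice. Qed.

Let u0 t : J t -> forall p, 0 < u t p.
Proof. by move=> Jt p; exact: u_gt0. Qed.

Let sv t : J t -> smoothM (v t).
Proof. by move=> Jt; exact: smoothM_cpowR (su Jt) (u0 Jt). Qed.

Let sw t : J t -> smoothM (w t).
Proof. by move=> Jt; exact: smoothM_cpowR (su Jt) (u0 Jt). Qed.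

Let du : has_dt J u (ddt u).
Proof. exact: (spacetime_has_dt Jo u_smooth). Qed.

Let dvE : has_dt J v dv.
Proof. by apply: has_dtZ; exact: has_dt_powR du u_gt0. Qed.

Let dwE : has_dt J w dw.
Proof. by apply: has_dtZ; exact: has_dt_powR du u_gt0. Qed.

Let dk : has_dt J k (fun s p => c * ddt (ddt u) s p).
Proof. by apply: has_dtZ; exact: (spacetime_has_dt Jo (spacetime_ddt Jo u_smooth)). Qed.

Lemma pressure_mass t p : J t -> v t p * u t p = w t p.
Proof. by move=> Jt; rewrite /v /w -mulrA powR_subr1// u0. Qed.

Lemma lap_mass t p : J t -> lap (w t) p = k t p.
Proof.
move=> Jt; have := u_pme p Jt; rewrite derive1E /k /ddt => ->.
(* The constants 1 and [c] in the same expansion differ by the factor [c], which here stands for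
   linearity of the Laplacian. *)
have E : (fun q => u t q `^ m) = (fun q => 1 * u t q `^ m).
  by apply/funext => q; rewrite mul1r.
have E1 := laplacian_cpowR g 1 m p (su Jt) (u0 Jt).
have E2 := laplacian_cpowR g c m p (su Jt) (u0 Jt).
rewrite E; apply: (etrans E2); rewrite E1; ring.
Qed.

Lemma dw_pressure t p : J t -> dw t p = (m - 1) * (v t p * k t p).
Proof.
have alg (Y d : R) : c * (m * Y * d) = (m - 1) * (c * Y * (c * d)).
  by transitivity (c * (c * (m - 1) * Y * d)); [rewrite cm|ring].
by move=> _; exact: alg.
Qed.

Lemma dv_pressure t p : J t ->
  dv t p = (m - 1) * (v t p * lap (v t) p) + inner (v t) (v t) p.
Proof.
move=> Jt; have kE := lap_mass p Jt.
have E1 := laplacian_cpowR g c m p (su Jt) (u0 Jt).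
have E2 := laplacian_cpowR g c (m - 1) p (su Jt) (u0 Jt).
have E3 := inner_cpowR g (v t) c (m - 1) p (su Jt) (u0 Jt).
have E4 := inner_cpowR g (u t) c (m - 1) p (su Jt) (u0 Jt).
have E5 := innerC g p (smoothM_Ck 1 (su Jt)) (smoothM_Ck 1 (sv Jt)).
have P1 := powR_subr1 (m - 1) (u0 Jt p).
have P2 := powR_subr1 (m - 1 - 1) (u0 Jt p).
(* [Y], [Y1], [Y2] are the powers of [u] with exponents [m - 3], [m - 2], [m - 1]. Everything is
   then expressed through the Laplacian of [u] and [|grad u|^2], and [c d] is the Laplacian of
   [w]. *)
have alg (U Y Y1 Y2 lu G q iuv iv lv lw d : R) : Y1 * U = Y2 -> Y * U = Y1 ->
    lw = c * d -> lw = c * (m * Y2) * lu + c * (m * (m - 1) * Y1) * G ->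
    lv = c * ((m - 1) * Y1) * lu + c * ((m - 1) * (m - 1 - 1) * Y) * G ->
    q = c * ((m - 1) * Y1) * iuv -> iuv = c * ((m - 1) * Y1) * G ->
    c * ((m - 1) * Y1 * d) = (m - 1) * (c * Y2 * lv) + q.
  move=> <- <- -> cd -> -> ->.
  transitivity ((m - 1) * (Y * U) * (c * d)); first by ring.
  by rewrite cd /c; field; rewrite subr_eq0.
exact: (alg _ _ _ _ _ _ _ _ _ _ _ _ P1 P2 kE E1 E2 E3 (etrans E5 E4)).
Qed.

Let sk t : J t -> smoothM (k t).
Proof.
move=> Jt; have -> : k t = lap (w t) by apply/funext => p; rewrite lap_mass.
exact: (smoothM_laplacian M_hausdorff M_compact mu_g (sw Jt)).
Qed.

Let sl t : J t -> smoothM (lap (v t)).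
Proof. by move=> Jt; exact: (smoothM_laplacian M_hausdorff M_compact mu_g (sv Jt)). Qed.

Let flux t := L (fun p => v t p * k t p).

Lemma mass_derive t : J t -> is_derive t 1 (fun s => L (w s)) ((m - 1) * flux t).
Proof.
move=> Jt; have D := L_derive M_hausdorff M_compact mu_g Jo dwE Jt.
apply: (is_derive_eq D); rewrite /flux -(LZ (m - 1) (smoothM_M (sv Jt) (sk Jt))).
by apply: L_ext => p; exact: dw_pressure.
Qed.

(** The two times are independent so that, with [t] frozen, the Laplacian sits on [v t] while [s]
    varies. *)
Lemma flux_sym s t : J s -> J t ->
  L (fun p => v t p * k s p) = L (fun p => w s p * lap (v t) p).
Proof.
move=> Js Jt; rewrite -(green_sym M_hausdorff M_compact mu_g (sv Jt) (sw Js)).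
by apply: L_ext => p; rewrite lap_mass.
Qed.

(* The polarisation
     v_s k_s = (v_s - v_t) (k_s - k_t) + v_s k_t + v_t k_s - v_t k_t
   with [k = Delta w] and the self-adjointness of [Delta] reduce the derivative
   to those of [v] and [w]: the time derivative never meets a space derivative. *)
Lemma flux_derive t : J t -> is_derive t 1 flux
  (L (fun p => dv t p * k t p) + L (fun p => dw t p * lap (v t) p)).
Proof.
move=> Jt; have cts f := @smoothM_continuous _ _ _ A f.
(* Both factors vanish at [s = t], so the derivative of this product is 0 there, whatever the time
   derivative of [k] is. *)
pose r s p := (v s p + -1 * v t p) * (k s p + -1 * k t p).
have sN f : smoothM f -> smoothM (fun p => -1 * f p).
  by move=> sf; exact: (smoothM_M (@smoothM_cst _ _ _ A (-1)) sf).
have dr := has_dtM (has_dtD dvE (has_dt_const J (cts _ (sN _ (sv Jt)))))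
  (has_dtD dk (has_dt_const J (cts _ (sN _ (sk Jt))))).
have d1 := L_derive M_hausdorff M_compact mu_g Jo dr Jt.
have d2 := L_derive M_hausdorff M_compact mu_g Jo
  (has_dtM dvE (has_dt_const J (cts _ (sk Jt)))) Jt.
have d3 := L_derive M_hausdorff M_compact mu_g Jo
  (has_dtM dwE (has_dt_const J (cts _ (sl Jt)))) Jt.
have E s : J s -> L (r s) + (L (fun p => v s p * k t p)
    + (L (fun p => w s p * lap (v t) p) + -1 * flux t)) = flux s.
  move=> Js; rewrite -(flux_sym Js Jt).
  have s1 : smoothM (r s).
    exact: (smoothM_M (smoothM_D (sv Js) (sN _ (sv Jt))) (smoothM_D (sk Js) (sN _ (sk Jt)))).
  have s2 := smoothM_M (sv Js) (sk Jt).
  have s3 := smoothM_M (sv Jt) (sk Js).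
  have s4 := smoothM_M (sv Jt) (sk Jt).
  have s5 := smoothM_D s3 (sN _ s4); have s6 := smoothM_D s2 s5.
  have F0 : L (fun p => r s p + (v s p * k t p + (v t p * k s p + -1 * (v t p * k t p))))
      = flux s by apply: L_ext => p; rewrite /r; ring.
  have alg (x0 x1 x2 x3 x4 x5 x6 x7 : R) : x0 = x1 -> x0 = x2 + x3 -> x3 = x4 + x5 ->
      x5 = x6 + -1 * x7 -> x2 + (x4 + (x6 + -1 * x7)) = x1 by move=> <- -> -> ->.
  apply: (alg _ _ _ _ _ _ _ _ F0 (LD s1 s6) (LD s2 s5)).
  by rewrite -(LZ (-1) s4); exact: (LD s3 (sN _ s4)).
have near_E : \forall s \near t, L (r s) + (L (fun p => v s p * k t p)
    + (L (fun p => w s p * lap (v t) p) + -1 * flux t)) = flux s.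
  have : \forall s \near t, J s by exact: open_nbhs_nbhs.
  by apply: filterS => s; exact: E.
apply: (near_eq_is_derive near_E).
have D := is_deriveD d1 (is_deriveD d2 (is_deriveD d3 (is_derive_cst (-1 * flux t) t 1))).
apply: (is_derive_eq D); rewrite addr0 addrA; congr (_ + _); last first.
  by apply: L_ext => p; rewrite mulr0 addr0.
have -> : L (fun p => (dv t p + 0) * (k t p + -1 * k t p) +
    (v t p + -1 * v t p) * (c * ddt (ddt u) t p + 0)) = 0.
  transitivity (L (fun p => 0 * v t p)).
    by apply: L_ext => p; rewrite !mulN1r !subrr mulr0 !mul0r addr0.
  by rewrite (LZ 0 (sv Jt)) mul0r.
by rewrite add0r; apply: L_ext => p; rewrite mulr0 addr0.
Qed.

Lemma mass_second_derive t : J t -> is_derive t 1 (fun s => (m - 1) * flux s)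
  ((m - 1) * (2 * L (fun p => bochner_density g (v t) p * w t p)
              + 2 * (m - 1) * L (fun p => lap (v t) p ^+ 2 * w t p))).
Proof.
move=> Jt; have D := is_derive1M (is_derive_cst (m - 1) t 1) (flux_derive Jt).
apply: (is_derive_eq D); rewrite mul0r add0r; apply: congr1.
(* Both sides are [c^2 m (m - 1) u^(2 m - 2)] times the product of the gradients of [u] and [h]. *)
have vw h p : (m - 1) * (v t p * inner (w t) h p) = m * (w t p * inner (v t) h p).
  have E1 := inner_cpowR g h c m p (su Jt) (u0 Jt).
  have E2 := inner_cpowR g h c (m - 1) p (su Jt) (u0 Jt).
  have P1 := powR_subr1 m (u0 Jt p).
  have P2 := powR_subr1 (m - 1) (u0 Jt p).
  have alg (U Y1 Y2 Y3 i1 i2 i : R) : Y2 * U = Y3 -> Y1 * U = Y2 ->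
      i1 = c * (m * Y2) * i -> i2 = c * ((m - 1) * Y1) * i ->
      (m - 1) * (c * Y2 * i1) = m * (c * Y3 * i2) by move=> <- <- -> ->; ring.
  exact: (alg _ _ _ _ _ _ _ P1 P2 E1 E2).
have B := bochner_integral M_hausdorff M_compact mu_g (sv Jt) (sw Jt) vw.
rewrite -B; congr (_ + _).
  by apply: L_ext => p; rewrite dv_pressure// lap_mass.
rewrite -(LZ (m - 1) (smoothM_M (smoothM_M (sv Jt) (smoothM_laplacian M_hausdorff
  M_compact mu_g (sw Jt))) (sl Jt))).
apply: L_ext => p; rewrite dw_pressure// lap_mass//; exact: esym (mulrA _ _ _).
Qed.

(** [derive1] is total, so the first conclusion certifies that [derive1 N] is a true derivative at
    every time of [J]. The proof reduces both sides to the integrals against [w] of the Bochner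
    density, [(Delta v)^2], [Delta v] and 1. *)
Lemma entropy_derive (a b t : R) : (forall s, J s -> 0 < s) -> J t ->
  b = n%:R * (m - 1) -> a = b / (b + 2) -> b + 2 != 0 ->
  let N := fun s : R => - s `^ a * L (fun p => v s p * u s p) in
  derivable N t 1 /\
  is_derive t 1 (fun s => s * derive1 N s + N s)
    (- 2 * (m - 1) * t `^ (a + 1) *
       L (fun p => (tensor_normsq g p (hessian g (v t) p
                      + ((b + 2) * t)^-1 *: metric_at g p)
                    + ricci g p (grad g (v t) p)) * (v t p * u t p))
     - 2 * t `^ (a + 1) *
       L (fun p => ((m - 1) * lap (v t) p + a / t) ^+ 2 * (v t p * u t p))).
Proof.
move=> J0 Jt bE aE b2 N.
have dE s : J s -> is_derive s 1 (fun s => L (fun p => v s p * u s p)) ((m - 1) * flux s).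
  move=> Js; apply: (near_eq_is_derive _ (mass_derive Js)).
  have : \forall s' \near s, J s' by exact: open_nbhs_nbhs.
  by apply: filterS => s' Js'; apply: L_ext => p; rewrite pressure_mass.
have [dN dW] := weighted_second_derivative a Jo J0 dE Jt (mass_second_derive Jt).
split; first exact: dN.
apply: (is_derive_eq dW).
have sW : smoothM (fun p => w t p) := sw Jt.
have s1 := smoothM_M (smoothM_bochner_density M_hausdorff M_compact mu_g (sv Jt)) (sw Jt).
have s2 := smoothM_M (sl Jt) (sw Jt).
have s3 := smoothM_M (smoothM_M (sl Jt) (sl Jt)) (sw Jt).
have scst (d : R) f : smoothM f -> smoothM (fun p => d * f p).
  exact: smoothM_M (smoothM_cst d).
set d := ((b + 2) * t)^-1.
have fluxE : flux t = L (fun p => lap (v t) p * w t p).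
  by rewrite /flux (flux_sym Jt Jt); apply: L_ext => p; exact: mulrC.
have E0 : L (fun p => v t p * u t p) = L (w t).
  by apply: L_ext => p; exact: pressure_mass.
have E1 : L (fun p => (tensor_normsq g p (hessian g (v t) p + d *: metric_at g p)
      + ricci g p (grad g (v t) p)) * (v t p * u t p)) =
    L (fun p => bochner_density g (v t) p * w t p)
    + (2 * d * L (fun p => lap (v t) p * w t p) + n%:R * d ^+ 2 * L (w t)).
  rewrite -(LZ (2 * d) s2) -(LZ (n%:R * d ^+ 2) sW).
  rewrite -(LD (scst _ _ s2) (scst _ _ sW)) -(LD s1 (smoothM_D (scst _ _ s2) (scst _ _ sW))).
  apply: L_ext => p; rewrite pressure_mass//.
  rewrite (tensor_normsq_shift g d p (sv Jt)) /bochner_density; ring.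
have E3 : L (fun p => lap (v t) p ^+ 2 * w t p) = L (fun p => lap (v t) p * lap (v t) p * w t p).
  by [].
have E2 : L (fun p => ((m - 1) * lap (v t) p + a / t) ^+ 2 * (v t p * u t p)) =
    (m - 1) ^+ 2 * L (fun p => lap (v t) p ^+ 2 * w t p)
    + (2 * (m - 1) * (a / t) * L (fun p => lap (v t) p * w t p)
       + (a / t) ^+ 2 * L (w t)).
  rewrite E3 -(LZ _ s3) -(LZ _ s2) -(LZ _ sW).
  rewrite -(LD (scst _ _ s2) (scst _ _ sW)).
  rewrite -(LD (scst _ _ s3) (smoothM_D (scst _ _ s2) (scst _ _ sW))).
  apply: L_ext => p; rewrite pressure_mass//; ring.
rewrite E0 E1 E2 fluxE.
have t0 := J0 t Jt.
have P1 := powR_subr1 (a + 1) t0; rewrite addrK in P1.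
have P2 := powR_subr1 a t0.
(* [T] is the power of [t] with exponent [a - 1]. The coefficients of [x] and [z] agree directly.
   Those of [y] agree when [1 - a = 2 / (b + 2)], which is the choice of [a]; those of [e] when
   [a (1 - a) = 2 b / (b + 2)^2], which then holds, the factor [b] being [n (m - 1)]. *)
have alg (T x y z e : R) : 
    - (T * t * t * ((m - 1) * (2 * x + 2 * (m - 1) * z))
       + 2 * (a + 1) * (T * t) * ((m - 1) * y) + a * (a + 1) * T * e) =
    - 2 * (m - 1) * (T * t * t) * (x + (2 * d * y + n%:R * d ^+ 2 * e))
    - 2 * (T * t * t) * ((m - 1) ^+ 2 * z
        + (2 * (m - 1) * (a / t) * y + (a / t) ^+ 2 * e)).
  have tn0 : t != 0 by rewrite gt_eqF.
  rewrite aE /d; move: b2; rewrite bE => b2; field.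
  by rewrite tn0 b2.
by rewrite -P1 -P2; exact: alg.
Qed.

End Evolution.

Theorem theorem5p1 (R : realType) (n : nat) (M : ptopologicalType)
  (M_hausdorff : hausdorff_space M) (M_compact : compact [set: M])
  (A : atlas R n M) (g : metric A)
  (mu : {measure set (borel M) -> \bar R}) (mu_g : riemannian_measure g mu)
  (m : R) (m_gt0 : 0 < m) (m_neq1 : m != 1)
  (J : set R) (J_interval : is_interval J) (J_open : open J)
  (J_gt0 : forall t, J t -> 0 < t)
  (u : R -> M -> R) (u_smooth : spacetime_smooth A J u)
  (u_gt0 : forall t p, J t -> 0 < u t p)
  (u_pme : forall t p, J t ->
     derive1 (fun s => u s p) t = laplacian g (fun q => u t q `^ m) p) :
  let v := fun (t : R) (p : M) => m / (m - 1) * u t p `^ (m - 1) in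
  let F1 := fun (t : R) (p : M) => (m - 1) * laplacian g (v t) p in
  let b := n%:R * (m - 1) in
  let a := b / (b + 2) in
  let N := fun t : R => - t `^ a * \int[mu]_p (v t p * u t p) in
  let W := fun t : R => t * derive1 N t + N t in
  b + 2 != 0 ->
  forall t : R, J t ->
    derivable N t 1 /\
    is_derive t 1 W
      (- 2 * (m - 1) * t `^ (a + 1) *
         \int[mu]_p ((tensor_normsq g p
                        (hessian g (v t) p
                         + ((b + 2) * t)^-1 *: metric_at g p)
                      + ricci g p (grad g (v t) p)) * (v t p * u t p))
       - 2 * t `^ (a + 1) *
         \int[mu]_p ((F1 t p + a / t) ^+ 2 * (v t p * u t p))).
Proof.
move=> v F1 b a N W b2 t Jt.
exact: (entropy_derive M_hausdorff M_compact mu_g m_neq1 J_open u_smooth u_gt0 u_pme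
  J_gt0 Jt erefl erefl b2).
Qed.
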